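(* Let $M\cong\mathbb{Z}^2$ be a lattice and let $P\subset M\otimes_{\mathbb{Z}}\mathbb{R}$ be a $2$-dimensional rational polytope which is preserved by the action of a reflection group $W$. Let $X_P$ and $X_{P/W}$ be the toric varieties associated with $P$ and with the fundamental region $P/W$, respectively. Then there is a ring isomorphism $$H^\ast(X_{P/W};\mathbb{Q})\cong H^\ast(X_P;\mathbb{Q})^W .$$
   Context: Let $N=\operatorname{Hom}(M,\mathbb{Z})$ with natural pairing $\langle\ ,\ \rangle\colon M\times N\to\mathbb{Z}$, extended to real coefficients. A rational polytope $P\subset M\otimes_{\mathbb{Z}}\mathbb{R}$ with edges $E_1,\dots,E_m$ is written without redundant inequalities as $$P=\bigcap_{i=1}^m\{\mathbf{x}\in M\otimes_{\mathbb{Z}}\mathbb{R}\mid \langle\mathbf{x},\lambda_i\rangle+a_i\le 0\},$$ with $\lambda_i\in N$ the primitive outward normal vector of $E_i$ and $a_i<0$ (so the origin is in the interior of $P$). The reflection group $W$ is a finite group of linear automorphisms of $M\otimes_{\mathbb{Z}}\mathbb{R}$ preserving $M$ (hence acting dually on $N$) and mapping $P$ onto itself. It is either the group of order $2$ generated by a single reflection $\sigma$, or a dihedral group $D_{2\ell}=\langle s_1,s_2\mid s_1^2=s_2^2=(s_1s_2)^\ell=1\rangle$ of order $2\ell$ with $\ell\ge 3$, generated by two reflections $s_1,s_2$ whose fixed lines bound a chamber of $W$, i.e. (with respect to a $W$-invariant inner product) a cone of angle $\pi/\ell$. Here a reflection is a linear involution fixing a line pointwise and acting by $-1$ on a complementary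 line. The fundamental region $P/W$ is a convex polygon in $P$ which is the closure of a region containing one representative of each $W$-orbit. If $W=\langle\sigma\rangle$, then $P/W=\{\mathbf{x}\in P\mid\langle\mathbf{x},\eta\rangle\le 0\}$, where $\eta\in N$ is a primitive vector such that the fixed line of $\sigma$ is $\{\langle\mathbf{x},\eta\rangle=0\}$. If $W=D_{2\ell}$, then $P/W=\{\mathbf{x}\in P\mid\langle\mathbf{x},\eta_1\rangle\le0\}\cap\{\mathbf{x}\in P\mid\langle\mathbf{x},\eta_2\rangle\le 0\}$, where $\eta_i\in N$ is a primitive vector such that the fixed line of $s_i$ is $\{\langle\mathbf{x},\eta_i\rangle=0\}$, with signs chosen so that $\{\langle \mathbf{x},\eta_1\rangle\le 0,\ \langle \mathbf{x},\eta_2\rangle\le 0\}$ is a chamber of $W$. The polygon $P/W$ is again a convex polygon whose edges have normal vectors in $N$. For a convex polygon $Q\subset M\otimes_{\mathbb{Z}}\mathbb{R}$ whose edges $F_1,\dots,F_m$ have primitive outward normals $\lambda_1,\dots,\lambda_m\in N$, $X_Q$ denotes the complex projective toric surface associated with the normal fan of $Q$. By the theorem of Jurkiewicz and Danilov, $$H^\ast(X_Q;\mathbb{Q})=\mathbb{Q}[x_1,\dots,x_m]/(\mathcal{I}+\mathcal{J}),\quad \deg x_i=2,$$ where $\mathcal{I}=\langle \prod_{k=1}^r x_{i_k}\mid \bigcap_{k=1}^r F_{i_k}=\emptyset\rangle$ and $\mathcal{J}=\langle\sum_{i=1}^m\langle u,\lambda_i\rangle x_i\mid u\in M\rangle$.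 The action of $W$ on $P$ induces a $W$-action on $X_P$ and hence on $H^\ast(X_P;\mathbb{Q})$. On generators it is given by $w(x_i)=x_j$ if $w(E_i)=E_j$. $H^\ast(X_P;\mathbb{Q})^W$ is the subring of invariants. *)

(* Defs.v *)
From HB Require Import structures.
From mathcomp Require Import all_boot all_order all_fingroup all_algebra.
From mathcomp Require Import generic_quotient finmap mxrepresentation.
From mathcomp Require Import all_classical all_reals topology normedtype.
From mathcomp Require Import -(notations) mpoly.

Set Implicit Arguments.
Unset Strict Implicit.
Unset Printing Implicit Defensive.

Import Order.TTheory GRing.Theory Num.Theory.
Import numFieldNormedType.Exports.

Local Open Scope classical_set_scope.
Local Open Scope ring_scope.
Local Open Scope quotient_scope.

(* A basis of M is fixed, so that M and N = Hom(M, Z) are both 'rV[int]_2 with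
   the standard pairing, and M (x) K is 'rV[K]_2. *)
Definition pairing (K : nzRingType) (x : 'rV[K]_2) (l : 'rV[int]_2) : K :=
  \sum_(j < 2) x 0 j * (l 0 j)%:~R.

Definition primitive (l : 'rV[int]_2) : bool := coprimez (l 0 0) (l 0 1).

(* Integral matrices act on row vectors on the right, as in mxrepresentation. *)
Definition lact (K : nzRingType) (A : 'M[int]_2) (x : 'rV[K]_2) : 'rV[K]_2 :=
  x *m map_mx intr A.

(* The dual action on N: <x A, dual_act A l> = <x, l>. *)
Definition dual_act (A : 'M[int]_2) (l : 'rV[int]_2) : 'rV[int]_2 :=
  l *m (invmx A)^T.

Lemma pairingE (K : comNzRingType) (x : 'rV[K]_2) l :
  pairing x l = (x *m (map_mx intr l)^T) 0 0.
Proof. by rewrite !mxE; apply: eq_bigr => j _; rewrite !mxE. Qed.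

Lemma lactK (K : comNzRingType) A : A \in unitmx ->
  cancel (@lact K A) (@lact K (invmx A)).
Proof.
by move=> uA x; rewrite /lact -mulmxA -map_mxM mulmxV // map_mx1 mulmx1.
Qed.

Lemma lactKV (K : comNzRingType) A : A \in unitmx ->
  cancel (@lact K (invmx A)) (@lact K A).
Proof.
by move=> uA x; rewrite /lact -mulmxA -map_mxM mulVmx // map_mx1 mulmx1.
Qed.

Lemma pairing_dual (K : comNzRingType) A (x : 'rV[K]_2) l : A \in unitmx ->
  pairing (lact A x) (dual_act A l) = pairing x l.
Proof.
move=> uA; rewrite !pairingE /lact /dual_act map_mxM trmx_mul -map_trmx trmxK.
by rewrite mulmxA -[x *m _ *m _]mulmxA -map_mxM mulmxV // map_mx1 mulmx1.
Qed.

Lemma dual_act_primitive A l :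
  A \in unitmx -> primitive l -> primitive (dual_act A l).
Proof.
move=> uA /coprimezP[[u v] /= huv].
have hp (x y : int) k : pairing (\row_j (if j == 0 then x else y)) k
    = x * k 0 0 + y * k 0 1.
  by rewrite /pairing big_ord_recl big_ord1 !mxE /= !intz; congr (_ + _ * k _ _);
    apply/val_inj.
have := pairing_dual (\row_j (if j == 0 then u else v)) l uA.
rewrite hp huv; move: (lact _ _) => w hw.
apply/coprimezP; exists (w 0 0, w 0 1); rewrite /= -hw -hp.
congr pairing; apply/rowP => j; rewrite mxE.
case: eqP => [->//|]; case: j => [[|[|j]] lt_j] //= j0; last first.
  by congr (w _ _); apply/val_inj.
by case: j0; apply/val_inj.
Qed.

Section Polygons.
Variable R : realType.
Implicit Types (Q : set 'rV[R]_2) (l : 'rV[int]_2) (A : 'M[int]_2).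

Definition polytope m (lam : 'I_m -> 'rV[int]_2) (a : 'I_m -> R) :
    set 'rV[R]_2 :=
  [set x | forall i, pairing x (lam i) + a i <= 0].

Definition polygon_presentation m (lam : 'I_m -> 'rV[int]_2) (a : 'I_m -> R) :=
  [/\ forall i, primitive (lam i),
      forall i, a i < 0,
      bounded_set (polytope lam a)
    & (* no inequality is redundant *)
      forall i, exists2 x : 'rV[R]_2,
        forall j, j != i -> pairing x (lam j) + a j <= 0
        & ~ pairing x (lam i) + a i <= 0].

Definition face Q l : set 'rV[R]_2 :=
  [set x | Q x /\ forall y, Q y -> pairing y l <= pairing x l].

(* The primitive outward normals of the edges of Q, edges being the faces with
   at least two points. *)
Definition edge_normals Q : set 'rV[int]_2 :=
  [set l | primitive l /\ exists x y, [/\ x <> y, face Q l x & face Q l y]].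

(* fset_set lists a finite set, and returns fset0 on infinite sets; the edge
   normals of a convex polygon are finitely many. *)
Definition normals Q : seq 'rV[int]_2 := fset_set (edge_normals Q).

Definition nedges Q : nat := size (normals Q).

Definition normal Q (i : 'I_(nedges Q)) : 'rV[int]_2 :=
  tnth (in_tuple (normals Q)) i.

Definition edge Q (i : 'I_(nedges Q)) : set 'rV[R]_2 := face Q (normal i).


(* By edge_edge_perm below, lact A maps E_i onto E_(edge_perm A i) when A is a
   lattice automorphism preserving Q; the default value i is then not used. *)
Definition edge_perm Q A (i : 'I_(nedges Q)) : 'I_(nedges Q) :=
  odflt i [pick j | normal j == dual_act A (normal i)].

Lemma lact_preserve Q A : lact A @` Q = Q ->
  forall x, Q x -> Q (lact A x).
Proof. by move=> AQ x Qx; rewrite -AQ; exists x. Qed.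

Lemma lactV_preserve Q A : A \in unitmx -> lact A @` Q = Q ->
  forall x, Q x -> Q (lact (invmx A) x).
Proof. by move=> uA AQ x; rewrite -{1}AQ => -[y Qy <-]; rewrite lactK. Qed.

Lemma face_lact Q A l : A \in unitmx -> lact A @` Q = Q ->
  face Q (dual_act A l) = lact A @` face Q l.
Proof.
move=> uA AQ; apply/seteqP; split => x.
  move=> [Qx xM]; exists (lact (invmx A) x); last by rewrite lactKV.
  split=> [|y Qy]; first exact: lactV_preserve.
  rewrite -(pairing_dual _ _ uA) -[leRHS](pairing_dual _ _ uA) lactKV //.
  by apply: xM; apply: lact_preserve.
move=> [y [Qy yM] <-]; split=> [|z Qz]; first exact: lact_preserve.
rewrite -[z](lactKV uA) !pairing_dual //; apply: yM.
exact: lactV_preserve.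
Qed.

Lemma edge_normals_dual Q A l : A \in unitmx -> lact A @` Q = Q ->
  edge_normals Q l -> edge_normals Q (dual_act A l).
Proof.
move=> uA AQ [pl [x [y [xy fx fy]]]]; split; first exact: dual_act_primitive.
exists (lact A x), (lact A y); rewrite face_lact //.
split; [by move/(can_inj (lactK uA)) | by exists x | by exists y].
Qed.

Lemma mem_normals Q l : l \in normals Q -> edge_normals Q l.
Proof.
rewrite /normals; case: (pselect (finite_set (edge_normals Q))) => [fQ|nfQ].
  by move=> /=; rewrite (in_fset_set fQ) inE.
by rewrite /fset_set; case: pselect.
Qed.

Lemma normals_dual Q A l : A \in unitmx -> lact A @` Q = Q ->
  l \in normals Q -> dual_act A l \in normals Q.
Proof.
move=> uA AQ; rewrite /normals.
case: (pselect (finite_set (edge_normals Q))) => [fQ|nfQ].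
  by rewrite /= !(in_fset_set fQ) !inE; apply: edge_normals_dual.
by rewrite /fset_set; case: pselect.
Qed.

Lemma normal_inj Q : injective (@normal Q).
Proof.
move=> i j; rewrite /normal !(tnth_nth 0) => /eqP.
by rewrite nth_uniq ?fset_uniq // => /eqP/val_inj.
Qed.

Lemma normal_edge_perm Q A (i : 'I_(nedges Q)) :
  A \in unitmx -> lact A @` Q = Q ->
  normal (edge_perm A i) = dual_act A (normal i).
Proof.
move=> uA AQ; rewrite /edge_perm; case: pickP => [j /eqP //|nj].
have /tnthP[j jE] : dual_act A (normal i) \in in_tuple (normals Q).
  by apply: normals_dual => //; apply: mem_tnth.
by have := nj j; rewrite /normal -jE eqxx.
Qed.

Lemma edge_edge_perm Q A (i : 'I_(nedges Q)) :
  A \in unitmx -> lact A @` Q = Q ->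
  edge (edge_perm A i) = lact A @` edge i.
Proof. by move=> uA AQ; rewrite /edge normal_edge_perm // face_lact. Qed.

Lemma edge_perm_inj Q A : A \in unitmx -> lact A @` Q = Q ->
  injective (@edge_perm Q A).
Proof.
move=> uA AQ i j /(congr1 (@normal Q)); rewrite !normal_edge_perm // /dual_act.
move/(congr1 (mulmx^~ A^T)); rewrite -!mulmxA -trmx_mul mulmxV // trmx1 !mulmx1.
exact: normal_inj.
Qed.

End Polygons.

Definition ideal_gen (S : comNzRingType) (G : set S) (p : S) : Prop :=
  exists2 s : seq (S * S), forall c, c \in s -> G c.2
                         & p = \sum_(c <- s) c.1 * c.2.

(* rat[x_1, ..., x_n], with one variable per edge of Q *)
Notation edge_ring Q := (mpoly (nedges Q) rat).

Section Cohomology.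
Variable R : realType.
Implicit Types (Q : set 'rV[R]_2) (A : 'M[int]_2).

Definition edge_var Q (i : 'I_(nedges Q)) : edge_ring Q := mpolyX rat (mnm1 i).

Definition stanley_reisner_gens Q : set (edge_ring Q) :=
  [set p | exists2 S : {set 'I_(nedges Q)},
     \bigcap_(i in [set` S]) edge i = set0 & p = \prod_(i in S) edge_var i].

Definition linear_gens Q : set (edge_ring Q) :=
  [set p | exists u : 'rV[int]_2,
     p = \sum_i mpolyC _ (pairing u (normal i))%:~R * edge_var i].

Arguments stanley_reisner_gens Q : clear implicits.
Arguments linear_gens Q : clear implicits.

Definition coh_ideal Q : {pred edge_ring Q} :=
  fun p => `[< ideal_gen (stanley_reisner_gens Q `|` linear_gens Q) p >].
Arguments coh_ideal Q : clear implicits.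

Lemma ideal_gen_closed (S : comNzRingType) (G : set S) a p q :
  ideal_gen G p -> ideal_gen G q -> ideal_gen G (a * p + q).
Proof.
move=> [s sG ->] [t tG ->]; exists ([seq (a * c.1, c.2) | c <- s] ++ t).
  by move=> c; rewrite mem_cat => /orP[/mapP[d /sG ? ->]|/tG].
rewrite big_cat big_map /= mulr_sumr; congr (_ + _).
by apply: eq_bigr => c _; rewrite mulrA.
Qed.

Lemma ideal_gen_sub (S : comNzRingType) (G : set S) p : G p -> ideal_gen G p.
Proof.
move=> Gp; exists [:: (1, p)]; last by rewrite big_seq1 mul1r.
by move=> c; rewrite inE => /eqP ->.
Qed.

Lemma coh_ideal_closed Q : idealr_closed (coh_ideal Q).
Proof.
split.
- by apply/asboolP; exists [::] => //; rewrite big_nil.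
- apply/negP => /asboolP[s sG /(congr1 (meval (fun=> 0)))].
  rewrite rmorph1 raddf_sum big1_seq => [/eqP|c /andP[_ /sG cG]].
    by rewrite oner_eq0.
  rewrite /= mevalM; suff -> : meval (fun=> 0) c.2 = 0 by rewrite mulr0.
  case: cG => [[S eS ->]|[u ->]].
    rewrite rmorph_prod; have [i iS] : exists i, i \in S.
      apply/set0Pn/eqP => S0; have : [set: 'rV[R]_2] 0 by [].
      suff -> : [set: 'rV[R]_2] = set0 by [].
      rewrite -eS; apply/esym/seteqP; split => // x _ i /=.
      by rewrite S0 finset.in_set0.
    by rewrite (bigD1 i iS) /= mevalXU mul0r.
  by rewrite raddf_sum big1 // => i _; rewrite /= mevalM /= mevalXU mulr0.
- move=> a p q /asboolP pI /asboolP qI.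
  by apply/asboolP; apply: ideal_gen_closed.
Qed.

HB.instance Definition _ Q :=
  isIdealr.Build (edge_ring Q) (coh_ideal Q) (coh_ideal_closed Q).

(* H^*(X_Q; rat), through the Jurkiewicz-Danilov presentation: toric varieties
   and their singular cohomology are not available. The degree-2k part is the
   image of the homogeneous polynomials of degree k. *)
Definition cohomology Q := {ideal_quot (coh_ideal Q)}.
HB.instance Definition _ Q := GRing.ComNzRing.on (cohomology Q).

Section Action.
Variables (Q : set 'rV[R]_2) (A : 'M[int]_2).

Definition edge_ring_act : edge_ring Q -> edge_ring Q :=
  mmap (@mpolyC (nedges Q) rat) (fun i => edge_var (edge_perm A i)).

HB.instance Definition _ := GRing.RMorphism.on edge_ring_act.

(* The map induced by edge_ring_act on the quotient, see coh_act_pi. *)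
Definition coh_act (y : cohomology Q) : cohomology Q :=
  \pi_(cohomology Q) (edge_ring_act (repr y)).

Hypothesis uA : A \in unitmx.
Hypothesis AQ : lact A @` Q = Q.

Lemma edge_ring_act_var i :
  edge_ring_act (edge_var i) = edge_var (edge_perm A i).
Proof. by rewrite /edge_ring_act mmapX mmap1U. Qed.

Lemma edge_ring_act_ideal p :
  p \in coh_ideal Q -> edge_ring_act p \in coh_ideal Q.
Proof.
move=> /asboolP[s sG ->]; rewrite rmorph_sum; apply/asboolP.
exists [seq (edge_ring_act c.1, edge_ring_act c.2) | c <- s]; last first.
  by rewrite big_map; apply: eq_bigr => c _; rewrite rmorphM.
move=> _ /mapP[c /sG cG ->] /=; case: cG => [[S eS ->]|[u ->]]; [left|right].
  exists (edge_perm A @: S)%SET.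
    apply/seteqP; split => // x xS.
    suff : set0 (lact (invmx A) x) by [].
    rewrite -eS => i iS.
    have : edge (edge_perm A i) x by apply: xS; apply: imset_f.
    by rewrite edge_edge_perm // => -[y ey <-]; rewrite lactK.
  rewrite rmorph_prod big_imset /=; last by move=> i j _ _; apply: edge_perm_inj.
  by apply: eq_bigr => i _; rewrite edge_ring_act_var.
exists (lact A u); rewrite rmorph_sum.
rewrite [RHS](reindex_inj (edge_perm_inj uA AQ)) /=; apply: eq_bigr => i _.
rewrite rmorphM /= edge_ring_act_var normal_edge_perm // pairing_dual //.
by rewrite /edge_ring_act mmapC.
Qed.

Lemma coh_act_pi p :
  coh_act (\pi p) = \pi_(cohomology Q) (edge_ring_act p).
Proof.
apply/eqP; rewrite /coh_act -Quotient.idealrBE -rmorphB.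
by apply: edge_ring_act_ideal; rewrite Quotient.idealrBE reprK.
Qed.

Lemma coh_act_zmod_morphism : zmod_morphism coh_act.
Proof.
move=> x y; rewrite -[x]reprK -[y]reprK -rmorphB !coh_act_pi.
by rewrite !rmorphB.
Qed.

Lemma coh_act_monoid_morphism : monoid_morphism coh_act.
Proof.
split=> [|x y].
  by rewrite -[1 in LHS](rmorph1 \pi_(cohomology Q)) coh_act_pi !rmorph1.
by rewrite -[x]reprK -[y]reprK -rmorphM !coh_act_pi !rmorphM.
Qed.

End Action.

End Cohomology.

Section ReflectionGroups.
Variables (R : realType) (gT : finGroupType) (W : {group gT}).
Variable rW : mx_representation int W 2.

Definition preserves (P : set 'rV[R]_2) : Prop :=
  forall w, w \in W -> lact (rW w) @` P = P.

(* The eigenvectors u and v span the plane, so A is an involution. *)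
Definition is_reflection (A : 'M[int]_2) : Prop :=
  exists u v : 'rV[R]_2,
    [/\ u != 0, v != 0, lact A u = u & lact A v = - v].

Definition fixed_line (A : 'M[int]_2) (eta : 'rV[int]_2) : Prop :=
  forall x : 'rV[R]_2, lact A x = x <-> pairing x eta = 0.

Definition mirrors : set 'rV[R]_2 :=
  [set x | exists t, [/\ t \in W, is_reflection (rW t) & lact (rW t) x = x]].

Definition is_chamber (C : set 'rV[R]_2) : Prop :=
  exists2 x, ~ mirrors x & C = closure (connected_component (~` mirrors) x).

Definition half_plane (eta : 'rV[int]_2) : set 'rV[R]_2 :=
  [set x | pairing x eta <= 0].

Definition order2_region (P Q : set 'rV[R]_2) : Prop :=
  exists (s : gT) (eta : 'rV[int]_2),
    [/\ W :=: <[s]>%g, is_reflection (rW s), primitive eta,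
        fixed_line (rW s) eta
      & Q = P `&` half_plane eta].

Definition dihedral_region (P Q : set 'rV[R]_2) : Prop :=
  exists (l : nat) (s1 s2 : gT) (eta1 eta2 : 'rV[int]_2),
    [/\ [/\ (3 <= l)%N, W :=: <<[set s1; s2]%SET>>%g,
            [/\ s1 ^+ 2 = 1, s2 ^+ 2 = 1 & (s1 * s2) ^+ l = 1]%g
          & #|W| = l.*2],
        is_reflection (rW s1) /\ is_reflection (rW s2),
        [/\ primitive eta1, primitive eta2,
            fixed_line (rW s1) eta1 & fixed_line (rW s2) eta2],
        is_chamber (half_plane eta1 `&` half_plane eta2)
      & Q = (P `&` half_plane eta1) `&` (P `&` half_plane eta2)].

(* W is a reflection group and Q is a fundamental region P/W; P/W depends on
   the choice of the signs of the eta's. *)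
Definition fundamental_region (P Q : set 'rV[R]_2) : Prop :=
  order2_region P Q \/ dihedral_region P Q.

Section Invariants.
Variables (P : set 'rV[R]_2) (WP : preserves P).

Definition invariant : {pred cohomology P} :=
  fun y => `[< forall w, w \in W -> coh_act (rW w) y = y >].

Lemma invariant_subring : subring_closed invariant.
Proof.
split=> [|x y /asboolP xW /asboolP yW|x y /asboolP xW /asboolP yW];
  apply/asboolP => w Ww; have uw := repr_mx_unit rW Ww.
- by have [] := coh_act_monoid_morphism uw (WP Ww).
- by rewrite (coh_act_zmod_morphism uw (WP Ww)) xW ?yW.
- by have [_ ->] := coh_act_monoid_morphism uw (WP Ww); rewrite xW ?yW.
Qed.

(* WP is a parameter only because the closure properties depend on it. *)
Definition invariant_pred of preserves P := invariant.

Record invariants := Invariants {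
  invariant_val : cohomology P;
  _ : invariant_val \in invariant_pred WP
}.

HB.instance Definition _ := [isSub for invariant_val].
HB.instance Definition _ := [Choice of invariants by <:].
HB.instance Definition _ :=
  GRing.isSubringClosed.Build (cohomology P) (invariant_pred WP)
    invariant_subring.
HB.instance Definition _ := [SubChoice_isSubComNzRing of invariants by <:].

End Invariants.

End ReflectionGroups.

(* Main.v *)
Require Import Defs.
From HB Require Import structures.
From mathcomp Require Import all_boot all_order all_fingroup all_algebra.
From mathcomp Require Import mxrepresentation.
From mathcomp Require Import all_classical all_reals topology normedtype.
From mathcomp Require Import -(notations) mpoly.
From mathcomp Require generic_quotient.
From mathcomp Require Import ring lra.

(** Rationally, the cohomology of a complete toric surface only depends on the
    intersection form of its boundary curves. For a polygon with normals n_i the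
    ring of the Jurkiewicz-Danilov presentation lives in degrees 0, 2 and 4
    (coh_formP): products of three edges vanish (coh_deg3), and in degree 4 all
    vertices are proportional because consecutive ones are and the boundary is
    connected (coh_vertex, succ_connected). Conversely, degree 4 is not zero:
    the matrix isect of intersection numbers, 1 / |det (n_i, n_j)| for adjacent
    edges, with self-intersections forced by the linear relations, defines a
    functional on quadratic polynomials that kills the ideal. Reading Taylor
    coefficients at 0 (coh_ideal_taylor) thus decides when a class is zero.

    Let Q be the part of P in the chamber C. A normal of P is called dominant if
    the vector representing it for an invariant inner product lies in C. Each
    orbit of edges has exactly one dominant member, and its normal is maximal in
    the orbit on C (dominant_max). Hence Q is bounded by the dominant edges of P
    and by the walls (fund_polygonal), and strict fundamentality of C controls
    which edges meet (dominant_disjoint, dominant_neighbour).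

    In terms of support functions, an invariant polygon is determined by its
    heights on the dominant edges, and restricting it to C divides the area by
    the order of the group. Dually, the isomorphism sends a dominant edge of Q to
    the sum of its orbit in P; the class of a wall is then imposed by the linear
    relation of the vector u k dual to that wall. These classes satisfy the
    relations of Q (cmp_ideal). The only delicate one is the disjointness of a
    dominant edge F from a wall: the class of the wall times F is, up to sign,
    the linear relation of u k times F, since an edge meeting F can only be
    separated from its dominant representative by another wall, whose reflection
    fixes u k.

    Bijectivity is checked degree by degree. In degree 2, invariant classes are
    combinations of orbit sums by averaging, and a relation between orbit sums
    comes from an invariant vector, thus is already a relation on Q. In degree 4
    both sides are lines, and the map between them is not zero: the class with
    the heights of P as coefficients is a combination of orbit sums, and its
    square, twice the area of P, is positive (ample_square_gt0). *)

Set Implicit Arguments.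
Unset Strict Implicit.
Unset Printing Implicit Defensive.
Import Order.TTheory GRing.Theory Num.Theory.
Import numFieldNormedType.Exports.

Local Open Scope classical_set_scope.
Local Open Scope ring_scope.

(** * Plane geometry *)

Definition det2 (l l' : 'rV[int]_2) : int := l 0 0 * l' 0 1 - l 0 1 * l' 0 0.

(** The quarter turn: by pairing_dir, det2 l l' is the rate at which l' grows
    along an edge with outward normal l. *)
Definition rot (l : 'rV[int]_2) : 'rV[int]_2 :=
  \row_j (if j == 0 then - l 0 1 else l 0 0).

Section Pairing.
Variable K : comNzRingType.
Implicit Types (x y : 'rV[K]_2) (l : 'rV[int]_2).

Lemma pairing2 x l : pairing x l = x 0 0 * (l 0 0)%:~R + x 0 1 * (l 0 1)%:~R.
Proof.
rewrite /pairing big_ord_recl big_ord1; congr (_ + x _ _ * (l _ _)%:~R).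
  exact/val_inj.
exact/val_inj.
Qed.

Lemma row2P (x y : 'rV[K]_2) : x 0 0 = y 0 0 -> x 0 1 = y 0 1 -> x = y.
Proof.
move=> e0 e1; apply/rowP => j.
case: (unliftP 0 j) => [k ->|-> //]; rewrite ord1.
by have -> : lift 0 0 = 1 :> 'I_2 by apply/val_inj.
Qed.

Lemma pairingDl x y l : pairing (x + y) l = pairing x l + pairing y l.
Proof. by rewrite !pairing2 !mxE; ring. Qed.

Lemma pairingZl a x l : pairing (a *: x) l = a * pairing x l.
Proof. by rewrite !pairing2 !mxE; ring. Qed.

Lemma pairingNl x l : pairing (- x) l = - pairing x l.
Proof. by rewrite !pairing2 !mxE; ring. Qed.

Lemma pairingBl x y l : pairing (x - y) l = pairing x l - pairing y l.
Proof. by rewrite pairingDl pairingNl. Qed.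

Lemma pairing0l l : pairing (0 : 'rV[K]_2) l = 0.
Proof. by rewrite !pairing2 !mxE; ring. Qed.

Lemma pairing_delta a l : pairing (delta_mx 0 a : 'rV[K]_2) l = (l 0 a)%:~R.
Proof.
rewrite /pairing (bigD1 a) //= big1 => [|j ja].
  by rewrite mxE !eqxx mul1r addr0.
by rewrite mxE (negbTE ja) andbF mul0r.
Qed.

Lemma pairing_suml (I : Type) (r : seq I) (P : pred I) (F : I -> 'rV[K]_2) l :
  pairing (\sum_(i <- r | P i) F i) l = \sum_(i <- r | P i) pairing (F i) l.
Proof.
by elim/big_rec2: _ => [|i x y _ <-]; rewrite ?pairing0l // pairingDl.
Qed.

Definition dir l : 'rV[K]_2 := map_mx intr (rot l).

Lemma pairing_dir l l' : pairing (dir l) l' = (det2 l l')%:~R.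
Proof. by rewrite pairing2 !mxE /= /det2; ring. Qed.

End Pairing.

Lemma pairing_map (K L : comNzRingType) (f : {rmorphism K -> L}) x l :
  pairing (map_mx f x) l = f (pairing x l).
Proof. by rewrite !pairing2 !mxE rmorphD !rmorphM !rmorph_int. Qed.

Lemma det2C l l' : det2 l l' = - det2 l' l.
Proof. by rewrite /det2; ring. Qed.

Lemma det2ll l : det2 l l = 0.
Proof. by rewrite /det2; ring. Qed.

Definition norm2 (l : 'rV[int]_2) : int := l 0 0 ^+ 2 + l 0 1 ^+ 2.

Lemma norm2_gt0 l : l != 0 -> 0 < norm2 l.
Proof.
move=> l0; rewrite lt_def addr_ge0 ?sqr_ge0 // andbT.
apply: contra l0; rewrite paddr_eq0 ?sqr_ge0 // !sqrf_eq0 => /andP[/eqP a /eqP b].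
by apply/eqP; apply: row2P; rewrite ?a ?b mxE.
Qed.

Lemma primitive_neq0 l : primitive l -> l != 0.
Proof.
by move=> pl; apply/eqP => l0; move: pl; rewrite /primitive l0 !mxE.
Qed.

Lemma pairing_self (K : comNzRingType) (l : 'rV[int]_2) :
  pairing (map_mx intr l : 'rV[K]_2) l = (norm2 l)%:~R.
Proof. by rewrite pairing2 !mxE /norm2; ring. Qed.

(** Coordinates in the orthogonal frame of n and its quarter turn, cleared of
    denominators so as to hold over any commutative ring. *)
Lemma pairing_decomp (K : comNzRingType) (x : 'rV[K]_2) (n l : 'rV[int]_2) :
  (norm2 n)%:~R * pairing x l =
    pairing x n * pairing (map_mx intr n) l + pairing x (rot n) * pairing (dir K n) l.
Proof. by rewrite !pairing2 !mxE /norm2 /=; ring. Qed.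

(** Cramer's rule for l in terms of n and n', cleared of denominators. *)
Lemma pairing_cramer (K : comNzRingType) (x : 'rV[K]_2) (n n' l : 'rV[int]_2) :
  (det2 n n')%:~R * pairing x l =
    (det2 l n')%:~R * pairing x n + (det2 n l)%:~R * pairing x n'.
Proof. by rewrite !pairing2 /det2; ring. Qed.

Definition dot2 (l l' : 'rV[int]_2) : int := l 0 0 * l' 0 0 + l 0 1 * l' 0 1.

Lemma pairing_dot (K : comNzRingType) l l' :
  pairing (map_mx intr l : 'rV[K]_2) l' = (dot2 l l')%:~R.
Proof. by rewrite pairing2 !mxE /dot2; ring. Qed.

(** Bezout coefficients of l exhibit l' as an integral multiple of l, and
    conversely; positivity leaves the multiple 1. *)
Lemma primitive_parallel l l' : primitive l -> primitive l' ->
  det2 l l' = 0 -> 0 < dot2 l l' -> l = l'.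
Proof.
move=> /coprimezP[[u v] /= e] /coprimezP[[u' v'] /= e'] d0 dot0.
set k := u * l' 0 0 + v * l' 0 1; set k' := u' * l 0 0 + v' * l 0 1.
have k0 : l' 0 0 = k * l 0 0.
  transitivity (l' 0 0 * (u * l 0 0 + v * l 0 1) + v * det2 l l').
    by rewrite d0 e; ring.
  by rewrite /k /det2; ring.
have k1 : l' 0 1 = k * l 0 1.
  transitivity (l' 0 1 * (u * l 0 0 + v * l 0 1) - u * det2 l l').
    by rewrite d0 e; ring.
  by rewrite /k /det2; ring.
have kk : k * k' = 1 by rewrite -e' k0 k1 /k'; ring.
have kp : 0 < k.
  have e2 : dot2 l l' = k * (l 0 0 ^+ 2 + l 0 1 ^+ 2).
    by rewrite /dot2 k0 k1; ring.
  rewrite ltNge; apply/negP => kn; move: dot0; rewrite e2 ltNge => /negP; apply.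
  by rewrite mulr_le0_ge0 // addr_ge0 ?sqr_ge0.
have kE : k = 1.
  have /eqP := congr1 absz kk; rewrite abszM muln_eq1 => /andP[/eqP ka _].
  by rewrite -(gtz0_abs kp) ka.
by apply: row2P; rewrite ?k0 ?k1 kE mul1r.
Qed.

Section RealPlane.
Variable R : realType.
Implicit Types (x y : 'rV[R]_2) (l : 'rV[int]_2).

Lemma pairing_eq0_dir x l : l != 0 -> pairing x l = 0 ->
  exists t, x = t *: dir R l.
Proof.
move=> l0; rewrite pairing2 => xl.
have n0 : ((norm2 l)%:~R : R) != 0 by rewrite intr_eq0 gt_eqF // norm2_gt0.
exists (pairing x (rot l) / (norm2 l)%:~R).
have H (a b c d N t : R) : N != 0 -> t = c / N -> a * N = c * d -> a = t * d.
  by move=> N0 -> h; apply: (mulIf N0); rewrite h; field.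
apply: row2P; rewrite !mxE /=; apply: (H _ 0 _ _ _ _ n0 erefl);
  rewrite pairing2 !mxE /= /norm2 rmorphD !rmorphXn /= rmorphN;
  move: xl; set a := x 0 0; set b := x 0 1; set p := (l 0 0)%:~R;
  set q := (l 0 1)%:~R => xl.
  transitivity (a * q ^+ 2 - b * q * p + p * (a * p + b * q)); first by ring.
  by rewrite xl; ring.
transitivity (b * p ^+ 2 - a * q * p + q * (a * p + b * q)); first by ring.
by rewrite xl; ring.
Qed.

Lemma pairing_ext (l l' : 'rV[int]_2) :
  (forall x : 'rV[R]_2, pairing x l = pairing x l') -> l = l'.
Proof.
move=> e; apply: row2P.
  have := e (\row_j (j == 0)%:R); rewrite !pairing2 !mxE /= !mul1r !mul0r !addr0.
  by move/intr_inj.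
have := e (\row_j (j == 1)%:R); rewrite !pairing2 !mxE /= !mul1r !mul0r !add0r.
by move/intr_inj.
Qed.

Lemma dir_neq0 l : l != 0 -> dir R l != 0.
Proof.
move=> l0; apply: contra_neq l0 => /rowP d0.
have /eqP := d0 0; rewrite !mxE /= intr_eq0 oppr_eq0 => /eqP h1.
have /eqP := d0 1; rewrite !mxE /= intr_eq0 => /eqP h0.
by apply: row2P; rewrite mxE.
Qed.

(** The only form of openness that is needed: interior points, and relative
    interior points of edges, are perturbed by it. *)
Lemma small_eps (T : eqType) (s : seq T) (P : pred T) (a b : T -> R) :
  (forall i, i \in s -> P i -> a i < 0) ->
  exists2 e : R, 0 < e &
    forall i t, i \in s -> P i -> 0 <= t -> t <= e -> a i + t * b i < 0.
Proof.
elim: s => [|i s IHs] a0; first by exists 1.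
have [j js|e e0 he] := IHs; first by apply: a0; rewrite inE js orbT.
have [e' e'0 he'] : exists2 e' : R, 0 < e' &
    forall t, P i -> 0 <= t -> t <= e' -> a i + t * b i < 0.
  case: (boolP (P i)) => Pi; last by exists 1.
  have {a0}a0 := a0 _ (mem_head _ _) Pi.
  have c0 : 0 < `|b i| + 1 by rewrite ltr_wpDl.
  exists (- a i / (`|b i| + 1)); first by rewrite divr_gt0 ?oppr_gt0.
  move=> t _ t0; rewrite ler_pdivlMr // mulrDr mulr1 => te.
  have : t * b i <= t * `|b i| by rewrite ler_wpM2l // ler_norm.
  have [->|tn] := eqVneq t 0; first by rewrite mul0r addr0.
  have : 0 < t by rewrite lt_def tn.
  move: te; move: (t * b i) (t * `|b i|) => x y *; lra.
exists (Num.min e e'); first by rewrite lt_min e0.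
move=> j t; rewrite inE le_min => /orP[/eqP -> ? ? /andP[_]|js ? ? /andP[+ _]].
  exact: he'.
exact: he.
Qed.

Lemma le0_limit (a b : R) : (forall e, 0 < e -> a + e * b <= 0) -> a <= 0.
Proof.
move=> h; rewrite leNgt; apply/negP => a0.
have c0 : 0 < `|b| + 1 by rewrite ltr_wpDl.
have bc : - b < `|b| + 1.
  by apply: le_lt_trans (ler_norm _) _; rewrite normrN ltrDl.
move: (`|b| + 1) c0 bc => c c0 bc.
have t0 : 0 < a / c by rewrite divr_gt0.
have /h := divr_gt0 t0 (ltr0n R 2); rewrite leNgt => /negP; apply.
have -> : a = a / c * c by rewrite divfK // gt_eqF.
rewrite mulfK ?gt_eqF //; move: (a / c) t0 => t t0; nra.
Qed.

Lemma bounded_coord (Q : set 'rV[R]_2) : bounded_set Q ->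
  forall l, exists M : R, forall x, Q x -> pairing x l <= M.
Proof.
move=> [M [_ hM]] l; have {}hM := hM (M + 1) (ltr_pwDr ltr01 (lexx _)).
exists ((M + 1) * (`|(l 0 0)%:~R| + `|(l 0 1)%:~R|)) => x /hM /= xM.
rewrite pairing2 mulrDr; apply: le_trans (ler_norm _) _.
apply: le_trans (ler_normD _ _) _; rewrite !normrM.
have xc j : `|x 0 j| <= M + 1.
  apply: le_trans xM; rewrite [leRHS]/Num.Def.normr /= mx_normrE.
  by apply/bigmax_geP; right => /=; exists (0, j).
by apply: lerD; apply: ler_wpM2r.
Qed.

End RealPlane.

(** * Polygons *)

Section Polygon.
Variable R : realType.
Implicit Types (Q : set 'rV[R]_2) (x y z d : 'rV[R]_2) (l : 'rV[int]_2).

(** An irredundant presentation indexed by the normals themselves, h being the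
    heights of the edges. Irredundancy is the existence, on each edge, of a
    point that lies on no other edge. *)
Record polygonal (L : seq 'rV[int]_2) (h : 'rV[int]_2 -> R) Q : Prop :=
  Polygonal {
  pg_mem : forall x, Q x <-> forall l, l \in L -> pairing x l <= h l;
  pg_primitive : forall l, l \in L -> primitive l;
  pg_bounded : bounded_set Q;
  pg_interior : exists x, forall l, l \in L -> pairing x l < h l;
  pg_edge : forall l, l \in L -> exists2 z, pairing z l = h l
    & forall l', l' \in L -> l' != l -> pairing z l' < h l'
}.

Section Normals.
Variables (L : seq 'rV[int]_2) (h : 'rV[int]_2 -> R) (Q : set 'rV[R]_2).
Hypothesis H : polygonal L h Q.

Lemma pg_edge_in l : l \in L -> exists z, [/\ Q z, pairing z l = h l
    & forall l', l' \in L -> l' != l -> pairing z l' < h l'].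
Proof.
move=> lL; have [z zl zs] := pg_edge H lL; exists z; split=> //.
apply/(pg_mem H) => l' l'L; have [->|ll'] := eqVneq l' l; first by rewrite zl.
exact/ltW/zs.
Qed.

Lemma pg_face l x : l \in L -> face Q l x <-> Q x /\ pairing x l = h l.
Proof.
move=> lL; split=> [[Qx xM]|[Qx xl]]; last first.
  by split=> // y /(pg_mem H)/(_ l lL); rewrite xl.
split=> //; apply/eqP; rewrite eq_le; apply/andP; split.
  by have /(pg_mem H)/(_ l lL) := Qx.
by have [z [Qz <- _]] := pg_edge_in lL; apply: xM.
Qed.

(** If a primitive l outside L were constant on a segment where it is maximal,
    the edges through the midpoint of the segment could only have the opposite
    normal, and the midpoint could be pushed along l inside Q. *)
Lemma pg_edge_normals : edge_normals Q = [set` L].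
Proof.
apply/seteqP; split=> l /=; last first.
  move=> lL; split; first exact: (pg_primitive H).
  have l0 := primitive_neq0 (pg_primitive H lL).
  have [z [Qz zl zs]] := pg_edge_in lL.
  have [|e e0 he] := @small_eps R _ L (predC1 l) (fun l' => pairing z l' - h l')
      (fun l' => pairing (dir R l) l').
    by move=> l' l'L /= ll'; rewrite subr_lt0; apply: zs.
  exists z, (z + e *: dir R l); split.
  - move/eqP; rewrite -subr_eq0 opprD addNKr oppr_eq0 scaler_eq0 gt_eqF //=.
    by rewrite (negbTE (dir_neq0 R l0)).
  - exact/pg_face.
  - apply/pg_face => //; rewrite pairingDl pairingZl pairing_dir det2ll mulr0.
    rewrite addr0; split=> //; apply/(pg_mem H) => l' l'L.
    rewrite pairingDl pairingZl; have [->|ll'] := eqVneq l' l.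
      by rewrite pairing_dir det2ll mulr0 addr0 zl.
    have /= := he l' e l'L ll' (ltW e0) (lexx _); lra.
move=> [pl [x [y [xy [Qx xM] [Qy yM]]]]].
apply: contrapT => /negP lL.
have xyl : pairing (x - y) l = 0.
  by apply/eqP; rewrite pairingBl subr_eq0 eq_le xM // yM.
have [t xyt] := pairing_eq0_dir (primitive_neq0 pl) xyl.
have t0 : t != 0.
  by apply: contra_not_neq xy => t0; apply/eqP; rewrite -subr_eq0 xyt t0 scale0r.
have [m mE] : exists m : 'rV[R]_2,
    forall l', pairing m l' = 2^-1 * (pairing x l' + pairing y l').
  by exists (2^-1 *: (x + y)) => l'; rewrite pairingZl pairingDl.
have [|e e0 he] := @small_eps R _ L (fun l' => pairing m l' < h l')
    (fun l' => pairing m l' - h l') (fun l' => pairing (map_mx intr l) l').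
  by move=> l' _; rewrite subr_lt0.
have Qme : Q (m + e *: map_mx intr l).
  apply/(pg_mem H) => l' l'L; rewrite pairingDl pairingZl.
  have [ml|ml] := boolP (pairing m l' < h l').
    by have /= := he l' e l'L ml (ltW e0) (lexx _); lra.
  have /(pg_mem H)/(_ l' l'L) xl' := Qx; have /(pg_mem H)/(_ l' l'L) yl' := Qy.
  have e1 : pairing x l' = h l' by rewrite mE in ml; lra.
  have e2 : pairing y l' = h l' by rewrite mE in ml; lra.
  have : pairing (x - y) l' = 0 by rewrite pairingBl e1 e2 subrr.
  rewrite xyt pairingZl pairing_dir => /eqP; rewrite mulf_eq0 (negbTE t0) /=.
  rewrite intr_eq0 => /eqP dl.
  rewrite mE e1 e2 pairing_dot; have : dot2 l l' <= 0.
    rewrite leNgt; apply: contraNN lL => dp.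
    by rewrite (primitive_parallel pl (pg_primitive H l'L) dl dp).
  rewrite -(ler_int R) mulr0z => dn; have := mulr_ge0_le0 (ltW e0) dn; lra.
have := xM _ Qme; rewrite pairingDl pairingZl mE pairing_self.
have -> : pairing y l = pairing x l by apply/eqP; rewrite eq_le xM // yM.
have : 0 < e * (norm2 l)%:~R.
  by rewrite mulr_gt0 // ltr0z norm2_gt0 // primitive_neq0.
lra.
Qed.

Lemma pg_normals : normals Q =i L.
Proof.
move=> l; rewrite /normals /= pg_edge_normals.
rewrite in_fset_set; last exact: finite_seq.
by apply/idP/idP; rewrite inE.
Qed.

Lemma pg_self : polygonal (normals Q) h Q.
Proof.
split.
- move=> x; split=> [/(pg_mem H) xL l|xL]; first by rewrite pg_normals => /xL.
  by apply/(pg_mem H) => l lL; apply: xL; rewrite pg_normals.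
- by move=> l; rewrite pg_normals; apply: (pg_primitive H).
- exact: (pg_bounded H).
- by have [x xL] := pg_interior H; exists x => l; rewrite pg_normals; apply: xL.
- move=> l; rewrite pg_normals => /(pg_edge H)[z zl zs]; exists z => // l'.
  by rewrite pg_normals; apply: zs.
Qed.

End Normals.

Section Edges.
Variables (Q : set 'rV[R]_2) (h : 'rV[int]_2 -> R).
Hypothesis H : polygonal (normals Q) h Q.
Implicit Types i j k : 'I_(nedges Q).
Notation n := (@Defs.normal R Q).

Lemma mem_normal i : n i \in normals Q.
Proof. exact: mem_tnth. Qed.
Hint Resolve mem_normal : core.

Lemma normalsP l : l \in normals Q -> exists i, l = n i.
Proof. by move=> /(tnthP (in_tuple (normals Q)))[i ->]; exists i. Qed.

Lemma normal_primitive i : primitive (n i).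
Proof. exact: (pg_primitive H). Qed.

Lemma normal_neq0 i : n i != 0.
Proof. exact: primitive_neq0 (normal_primitive i). Qed.

Lemma pg_memi x : Q x <-> forall i, pairing x (n i) <= h (n i).
Proof.
split=> [/(pg_mem H) Qx i|Qx]; first exact: Qx.
by apply/(pg_mem H) => l /normalsP[i ->].
Qed.

Lemma edgeP i x : edge i x <-> Q x /\ pairing x (n i) = h (n i).
Proof. exact: (pg_face H). Qed.

Lemma pg_edgei i : exists z, edge i z /\
  forall j, j != i -> pairing z (n j) < h (n j).
Proof.
have [z [Qz zi zs]] := pg_edge_in H (mem_normal i); exists z.
split; first exact/edgeP.
by move=> j ji; apply: zs => //; rewrite (inj_eq (@normal_inj _ _)).
Qed.

Definition touch i j : bool := `[< exists x, edge i x /\ edge j x >].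

Lemma touchC i j : touch i j = touch j i.
Proof. by apply/asboolP/asboolP => -[x [? ?]]; exists x. Qed.

(** Parallel normals of two edges through p would be opposite, and an interior
    point would then lie on the wrong side of one of the edges. *)
Lemma touch_det i j : i != j -> touch i j -> det2 (n i) (n j) != 0.
Proof.
move=> ij /asboolP[p [/edgeP[Qp pi] /edgeP[_ pj]]]; apply/eqP => d0.
have [x0 x0s] := pg_interior H.
have yi : pairing (x0 - p) (n i) < 0 by rewrite pairingBl pi subr_lt0 x0s.
have yj : pairing (x0 - p) (n j) < 0 by rewrite pairingBl pj subr_lt0 x0s.
have [dp|dn] := ltP 0 (dot2 (n i) (n j)).
  have := primitive_parallel (normal_primitive i) (normal_primitive j) d0 dp.
  by move/normal_inj/eqP; rewrite (negbTE ij).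
have := pairing_decomp (x0 - p) (n i) (n j).
rewrite pairing_dir d0 mulr0 addr0 pairing_dot.
have : (0 : R) < (norm2 (n i))%:~R by rewrite ltr0z norm2_gt0 // normal_neq0.
move: dn; rewrite -(ler_int R) mulr0z; move: yi yj.
move: (pairing _ _) (pairing _ _) (_%:~R) (_%:~R) => a b c d; nra.
Qed.

(** The normals satisfy a linear relation whose coefficients are determinants.
    At a relative interior point of one of the edges, measured from x, the two
    other terms must cancel, so any two coefficients have opposite signs. *)
Lemma three_edges i j k x : i != j -> j != k -> i != k ->
  edge i x -> edge j x -> edge k x -> False.
Proof.
move=> ij jk ik ei ej ek.
have d1 : det2 (n i) (n j) != 0.
  by apply: touch_det => //; apply/asboolP; exists x.
have /edgeP[Qx xi] := ei; have /edgeP[_ xj] := ej; have /edgeP[_ xk] := ek.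
pose a : R := (det2 (n i) (n j))%:~R; pose b : R := (det2 (n j) (n k))%:~R.
pose c : R := (det2 (n k) (n i))%:~R.
have a0 : a != 0 by rewrite intr_eq0.
have key y : a * pairing y (n k) + b * pairing y (n i) + c * pairing y (n j) = 0.
  have := pairing_cramer y (n i) (n j) (n k).
  rewrite [det2 (n k) (n j)]det2C [det2 (n i) (n k)]det2C !rmorphN /= -/a -/b -/c.
  by move=> ->; ring.
have h1 i' : exists2 y : 'rV[R]_2, edge i' x -> pairing y (n i') = 0 &
    forall j', j' != i' -> edge j' x -> pairing y (n j') < 0.
  have [z [/edgeP[Qz zi] zs]] := pg_edgei i'; exists (z - x).
    by move=> /edgeP[_ xi']; rewrite pairingBl zi xi' subrr.
  by move=> j' j'i /edgeP[_ xj']; rewrite pairingBl xj' subr_lt0 zs.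
have [y1 /(_ ei) y1i y1n] := h1 i; have [y2 /(_ ej) y2j y2n] := h1 j.
have [y3 /(_ ek) y3k y3n] := h1 k.
have opp (u v p q : R) : p < 0 -> q < 0 -> u * p + v * q = 0 ->
    (0 < u -> v < 0) /\ (u < 0 -> 0 < v).
  by move=> p0 q0 e; split=> u0; rewrite ltNge; apply/negP => v0; nra.
have [ca1 ca2] : (0 < a -> c < 0) /\ (a < 0 -> 0 < c).
  apply: (opp _ _ (pairing y1 (n k)) (pairing y1 (n j))).
  - by apply: y1n => //; rewrite eq_sym.
  - by apply: y1n => //; rewrite eq_sym.
  - by have := key y1; rewrite y1i mulr0 addr0.
have [ba1 ba2] : (0 < a -> b < 0) /\ (a < 0 -> 0 < b).
  apply: (opp _ _ (pairing y2 (n k)) (pairing y2 (n i))).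
  - by apply: y2n => //; rewrite eq_sym.
  - exact: y2n.
  - by have := key y2; rewrite y2j mulr0 addr0.
have [cb1 cb2] : (0 < b -> c < 0) /\ (b < 0 -> 0 < c).
  apply: (opp _ _ (pairing y3 (n i)) (pairing y3 (n j))).
  - exact: y3n.
  - exact: y3n.
  - by have := key y3; rewrite y3k mulr0 add0r.
have [a1|a1|a1] := ltgtP a 0; last by rewrite a1 eqxx in a0.
  by have := lt_trans (cb1 (ba2 a1)) (ca2 a1); rewrite ltxx.
by have := lt_trans (ca1 a1) (cb2 (ba1 a1)); rewrite ltxx.
Qed.

End Edges.
End Polygon.

(** The segment from an interior point to a point violating a single inequality
    crosses the edge at a point that is on no other edge. *)
Lemma polygonal_intro (R : realType) L h (Q : set 'rV[R]_2) :
  (forall x, Q x <-> forall l, l \in L -> pairing x l <= h l) ->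
  (forall l, l \in L -> primitive l) -> bounded_set Q ->
  (exists x : 'rV[R]_2, forall l, l \in L -> pairing x l < h l) ->
  (forall l, l \in L -> exists2 x : 'rV[R]_2, h l < pairing x l &
     forall l', l' \in L -> l' != l -> pairing x l' <= h l') ->
  polygonal L h Q.
Proof.
move=> Qm Lp Qb [x0 x0s] irr; split=> //; first by exists x0.
move=> l lL.
have [x xl xs] := irr l lL; have x0l := x0s l lL.
have d0 : 0 < pairing x l - pairing x0 l by rewrite subr_gt0 (lt_trans x0l).
pose t := (h l - pairing x0 l) / (pairing x l - pairing x0 l).
have t0 : 0 < t by apply: divr_gt0 => //; rewrite subr_gt0.
have t1 : t < 1 by rewrite ltr_pdivrMr // mul1r ltrD2r.
exists (x0 + t *: (x - x0)) => [|l' l'L ll'].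
  by rewrite pairingDl pairingZl pairingBl divfK ?gt_eqF //; ring.
rewrite pairingDl pairingZl pairingBl.
have := x0s l' l'L; have := xs l' l'L ll'; move: t0 t1.
by move: t (pairing x l') (pairing x0 l') (h l') => *; nra.
Qed.

Section Presentation.
Variables (R : realType) (m : nat) (lam : 'I_m -> 'rV[int]_2) (a : 'I_m -> R).
Hypothesis hP : polygon_presentation lam a.

Definition presentation_height l : R :=
  if [pick i | lam i == l] is Some i then - a i else 0.

(** Of two edges with the same normal, the farther one would be redundant. *)
Lemma presentation_inj : injective lam.
Proof.
move=> i j e; apply/eqP; apply: contraT => ij; have [_ _ _ irr] := hP.
have [x xs /negP xi] := irr i; have [y ys /negP yj] := irr j.
have := xs j; have := ys i; rewrite ij eq_sym ij => /(_ isT) yi /(_ isT) xj.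
by move: xi yj yi xj; rewrite e -!ltNge; lra.
Qed.

Lemma presentation_heightE i : presentation_height (lam i) = - a i.
Proof.
rewrite /presentation_height; case: pickP => [j /eqP/presentation_inj -> //|/(_ i)].
by rewrite eqxx.
Qed.

Lemma presentation_polygonal :
  polygonal [seq lam i | i <- enum 'I_m] presentation_height (polytope lam a).
Proof.
have [lp an bd irr] := hP.
have memL l : l \in [seq lam i | i <- enum 'I_m] -> exists i, l = lam i.
  by move=> /mapP[i _ ->]; exists i.
apply: polygonal_intro => //.
- move=> x; split=> [Px l /memL[i ->]|xL i].
    by rewrite presentation_heightE; have := Px i; lra.
  have := xL (lam i); rewrite map_f ?mem_enum // presentation_heightE => /(_ isT).
  by lra.
- by move=> l /memL[i ->].
- by exists 0 => l /memL[i ->]; rewrite presentation_heightE pairing0l oppr_gt0.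
- move=> l /memL[i ->]; have [x xs /negP xi] := irr i; exists x.
    by rewrite presentation_heightE; move: xi; rewrite -ltNge; lra.
  move=> l' /memL[j ->]; rewrite (inj_eq presentation_inj) presentation_heightE.
  by move=> /xs; lra.
Qed.

Lemma presentation_height_gt0 l : l \in normals (polytope lam a) ->
  0 < presentation_height l.
Proof.
rewrite (pg_normals presentation_polygonal) => /mapP[i _ ->].
by rewrite presentation_heightE oppr_gt0; have [] := hP.
Qed.

End Presentation.

Section Boundary.
Variables (R : realType) (Q : set 'rV[R]_2) (h : 'rV[int]_2 -> R).
Hypothesis H : polygonal (normals Q) h Q.
Implicit Types (i j k : 'I_(nedges Q)) (x z d : 'rV[R]_2) (l : 'rV[int]_2).
Notation n := (@Defs.normal R Q).

Lemma escape z d l : Q z -> 0 < pairing d l -> exists i, 0 < pairing d (n i).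
Proof.
move=> Qz dl; apply: contrapT => hn.
have dn i : pairing d (n i) <= 0.
  by rewrite leNgt; apply/negP => di; apply: hn; exists i.
have [M hM] := bounded_coord (pg_bounded H) l.
pose t : R := (`|M| + `|pairing z l| + 1) / pairing d l.
have t0 : 0 <= t by rewrite divr_ge0 ?(ltW dl) // !addr_ge0.
have : Q (z + t *: d).
  apply/(pg_memi H) => i; rewrite pairingDl pairingZl.
  have := mulr_ge0_le0 t0 (dn i); have /(pg_memi H)/(_ i) := Qz; lra.
move/hM; rewrite pairingDl pairingZl divfK ?gt_eqF //.
have := ler_norm M; have := ler_norm (- pairing z l); rewrite normrN.
by move: (`|M|) (`|_|) => *; lra.
Qed.

(** The exit time of a ray is the least ratio of slack to speed among the edges
    it approaches. *)
Lemma exit_point z d l : Q z -> 0 < pairing d l -> exists t i,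
  [/\ 0 <= t, 0 < pairing d (n i) & edge i (z + t *: d)].
Proof.
move=> Qz dl; have [i0 di0] := escape Qz dl.
pose F i : R := (h (n i) - pairing z (n i)) / pairing d (n i).
case: (@arg_minP _ _ _ i0 (fun i => 0 < pairing d (n i)) F di0) => i di iM.
have t0 : 0 <= F i.
  by rewrite divr_ge0 ?(ltW di) // subr_ge0; have /(pg_memi H) := Qz.
exists (F i), i; split=> //; apply/(edgeP H); split; last first.
  by rewrite pairingDl pairingZl divfK ?gt_eqF //; ring.
apply/(pg_memi H) => j; rewrite pairingDl pairingZl.
have zj : pairing z (n j) <= h (n j) by have /(pg_memi H) := Qz.
have [dj|dj] := ltP 0 (pairing d (n j)).
  by have := iM j dj; rewrite {2}/F ler_pdivlMr //; lra.
by have := mulr_ge0_le0 t0 dj; lra.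
Qed.

Lemma next_edge i : exists j, (0 < det2 (n i) (n j)) && touch i j.
Proof.
have [z [/(edgeP H)[Qz zi] _]] := pg_edgei H i.
have [|t [j [t0 dj ej]]] := @exit_point z (dir R (n i)) (rot (n i)) Qz.
  have -> : pairing (dir R (n i)) (rot (n i)) = (norm2 (n i))%:~R.
    by rewrite /dir pairing_self /norm2 /rot !mxE /=; congr (_%:~R); ring.
  by rewrite ltr0z norm2_gt0 // (normal_neq0 H).
exists j; move: dj; rewrite pairing_dir ltr0z => ->; apply/asboolP.
exists (z + t *: dir R (n i)); split=> //; have /(edgeP H)[Qe _] := ej.
apply/(edgeP H); split=> //.
by rewrite pairingDl pairingZl pairing_dir det2ll mulr0 addr0.
Qed.

Lemma prev_edge i : exists j, (0 < det2 (n j) (n i)) && touch j i.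
Proof.
have [z [/(edgeP H)[Qz zi] _]] := pg_edgei H i.
have [|t [j [t0 dj ej]]] := @exit_point z (- dir R (n i)) (- rot (n i)) Qz.
  have -> : pairing (- dir R (n i)) (- rot (n i)) = (norm2 (n i))%:~R.
    by rewrite pairing2 /dir !mxE /= /norm2; ring.
  by rewrite ltr0z norm2_gt0 // (normal_neq0 H).
exists j; move: dj; rewrite pairingNl pairing_dir -rmorphN /= -det2C ltr0z => ->.
apply/asboolP; exists (z + t *: - dir R (n i)); split=> //.
have /(edgeP H)[Qe _] := ej; apply/(edgeP H); split=> //.
by rewrite pairingDl pairingZl pairingNl pairing_dir det2ll oppr0 mulr0 addr0.
Qed.

Definition succ i : 'I_(nedges Q) := xchoose (next_edge i).

Lemma succ_det i : 0 < det2 (n i) (n (succ i)).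
Proof. by have /andP[] := xchooseP (next_edge i). Qed.

Lemma succ_touch i : touch i (succ i).
Proof. by have /andP[] := xchooseP (next_edge i). Qed.

Lemma det2_gt0_neq i j : 0 < det2 (n i) (n j) -> i != j.
Proof. by apply: contraTneq => ->; rewrite det2ll. Qed.

Lemma succ_neq i : i != succ i.
Proof. exact: det2_gt0_neq (succ_det i). Qed.

Lemma edge_line i x z : edge i x -> edge i z ->
  exists t, z = x + t *: dir R (n i).
Proof.
move=> /(edgeP H)[_ xi] /(edgeP H)[_ zi].
have [|t zx] := @pairing_eq0_dir R (z - x) (n i) (normal_neq0 H i).
  by rewrite pairingBl xi zi subrr.
by exists t; rewrite -zx addrC subrK.
Qed.

(** Each end point cannot lie beyond the other along edge i, so they coincide,
    and three edges would meet there. *)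
Lemma next_uniq i j k : touch i j -> touch i k ->
  0 < det2 (n i) (n j) -> 0 < det2 (n i) (n k) -> j = k.
Proof.
move=> /asboolP[x [xi xj]] /asboolP[y [yi yk]] dj dk.
apply: contrapT => /eqP jk.
have [t yE] := edge_line xi yi.
have /(edgeP H)[Qx xj'] := xj; have /(edgeP H)[Qy yk'] := yk.
have h1 : t * (det2 (n i) (n j))%:~R <= 0.
  have /(pg_memi H)/(_ j) := Qy; rewrite yE pairingDl pairingZl pairing_dir xj'.
  by lra.
have h2 : 0 <= t * (det2 (n i) (n k))%:~R.
  have /(pg_memi H)/(_ k) := Qx; rewrite -yk' yE pairingDl pairingZl pairing_dir.
  by lra.
have t0 : t = 0.
  apply/eqP; rewrite eq_le; apply/andP; split.
    by rewrite -(@pmulr_lle0 _ ((det2 (n i) (n j))%:~R)) ?ltr0z.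
  by rewrite -(@pmulr_lge0 _ ((det2 (n i) (n k))%:~R)) ?ltr0z.
have xy : x = y by rewrite yE t0 scale0r addr0.
apply: (@three_edges _ _ _ H i j k x) => //; try exact: det2_gt0_neq.
by rewrite xy.
Qed.

Lemma prev_uniq i j k : touch j i -> touch k i ->
  0 < det2 (n j) (n i) -> 0 < det2 (n k) (n i) -> j = k.
Proof.
move=> /asboolP[x [xj xi]] /asboolP[y [yk yi]] dj dk.
apply: contrapT => /eqP jk.
have [t yE] := edge_line xi yi.
have /(edgeP H)[Qx xj'] := xj; have /(edgeP H)[Qy yk'] := yk.
have h1 : 0 <= t * (det2 (n j) (n i))%:~R.
  have /(pg_memi H)/(_ j) := Qy; rewrite yE pairingDl pairingZl pairing_dir xj'.
  by rewrite [det2 _ (n j)]det2C rmorphN /=; lra.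
have h2 : t * (det2 (n k) (n i))%:~R <= 0.
  have /(pg_memi H)/(_ k) := Qx; rewrite -yk' yE pairingDl pairingZl pairing_dir.
  by rewrite [det2 _ (n k)]det2C rmorphN /=; lra.
have t0 : t = 0.
  apply/eqP; rewrite eq_le; apply/andP; split.
    by rewrite -(@pmulr_lle0 _ ((det2 (n k) (n i))%:~R)) ?ltr0z.
  by rewrite -(@pmulr_lge0 _ ((det2 (n j) (n i))%:~R)) ?ltr0z.
have xy : x = y by rewrite yE t0 scale0r addr0.
apply: (@three_edges _ _ _ H j i k x) => //; try exact: det2_gt0_neq.
  by rewrite eq_sym; apply: det2_gt0_neq.
by rewrite xy.
Qed.

Lemma succP i j : touch i j -> 0 < det2 (n i) (n j) -> j = succ i.
Proof. by move=> m d; apply: next_uniq m (succ_touch i) d (succ_det i). Qed.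

Lemma succ_inj : injective succ.
Proof.
move=> i j e; have mi := succ_touch i; have di := succ_det i.
by apply: prev_uniq mi _ di _; rewrite e; [apply: succ_touch | apply: succ_det].
Qed.

Lemma succ_surj i : exists k, i = succ k.
Proof. by have [k /andP[d m]] := prev_edge i; exists k; apply: succP. Qed.

Lemma touch_succ i j : touch i j -> i != j -> j = succ i \/ i = succ j.
Proof.
move=> m ij; have := touch_det H ij m.
case: (ltgtP 0 (det2 (n i) (n j))) => // [d _|d _]; first by left; apply: succP.
by right; apply: succP; [rewrite touchC | rewrite det2C oppr_gt0].
Qed.

Lemma succ2_neq k : succ (succ k) != k.
Proof.
apply/eqP => e; have := succ_det (succ k); rewrite e det2C oppr_gt0.
by rewrite ltNge (ltW (succ_det k)).
Qed.

(** A normal in the cone over a vertex is maximal at that vertex, and nowhere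
    else when it differs from the two generators; it has no edge of its own. *)
Lemma normal_cone i j :
  0 <= det2 (n i) (n j) -> 0 <= det2 (n j) (n (succ i)) -> j = i \/ j = succ i.
Proof.
move=> d1 d2; apply: contrapT => hj.
have ji : j != i by apply: contra_notN hj => /eqP; left.
have js : j != succ i by apply: contra_notN hj => /eqP; right.
have /asboolP[p [/(edgeP H)[Qp pi] /(edgeP H)[_ ps]]] := succ_touch i.
have [z [/(edgeP H)[Qz zj] zs]] := pg_edgei H j.
have yi : pairing (z - p) (n i) < 0 by rewrite pairingBl pi subr_lt0 zs // eq_sym.
have ys : pairing (z - p) (n (succ i)) < 0.
  by rewrite pairingBl ps subr_lt0 zs // eq_sym.
have yj : 0 <= pairing (z - p) (n j).
  by rewrite pairingBl zj subr_ge0; have /(pg_memi H) := Qp.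
have := pairing_cramer (z - p) (n i) (n (succ i)) (n j).
have := succ_det i; move: d1 d2; rewrite -!(ler_int R) -(ltr_int R) !mulr0z.
set a := _%:~R; set b := _%:~R; set c := _%:~R => a0 b0 c0 e.
have : a <= 0 by have := mulr_ge0 (ltW c0) yj; rewrite e; nra.
have : b <= 0 by have := mulr_ge0 (ltW c0) yj; rewrite e; nra.
move=> b1 a1; have aE : a = 0 by lra.
have bE : b = 0 by lra.
move: aE bE => /eqP; rewrite intr_eq0 => /eqP dij /eqP; rewrite intr_eq0 => /eqP djs.
(* n j would be parallel to both n i and n (succ i) *)
have := pairing_cramer (map_mx intr (n j) : 'rV[R]_2) (n i) (n (succ i)) (n j).
rewrite djs dij !mul0r addr0 pairing_self => /eqP.
rewrite mulf_eq0 !intr_eq0 gt_eqF ?succ_det //= gt_eqF //.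
by rewrite norm2_gt0 // (normal_neq0 H).
Qed.

(** The simplex method: on a set of edges closed under succession, the form
    n j is maximal at a vertex whose cone of normals contains n j. *)
Lemma succ_connected (A : pred 'I_(nedges Q)) i0 :
  (forall i, A i = A (succ i)) -> A i0 -> forall j, A j.
Proof.
move=> AS Ai0 j.
have vertex i : exists x, edge i x /\ edge (succ i) x.
  exact/asboolP/succ_touch.
pose v i := projT1 (cid (vertex i)).
have vi i : edge i (v i) by have [] := projT2 (cid (vertex i)).
have vs i : edge (succ i) (v i) by have [] := projT2 (cid (vertex i)).
have step i : exists2 t : R, 0 < t & v (succ i) = v i + t *: dir R (n (succ i)).
  have [t e] := edge_line (vs i) (vi (succ i)); exists t => //.
  have /(edgeP H)[Qv vss] := vs (succ i); have /(edgeP H)[Qi _] := vi i.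
  have dp := succ_det (succ i); rewrite lt_def; apply/andP; split.
    apply/eqP => t0; have ve : v (succ i) = v i by rewrite e t0 scale0r addr0.
    apply: (@three_edges _ _ _ H i (succ i) (succ (succ i)) (v i)).
    - exact: succ_neq.
    - exact: succ_neq.
    - by rewrite eq_sym succ2_neq.
    - exact: vi.
    - exact: vs.
    - by rewrite -ve.
  have /(pg_memi H)/(_ (succ (succ i))) := Qi.
  rewrite -vss e pairingDl pairingZl pairing_dir lerDl.
  by rewrite pmulr_lge0 // ltr0z.
case: (@arg_maxP _ _ _ i0 A (fun i => pairing (v i) (n j)) Ai0) => i Ai iM.
have [k ik] := succ_surj i.
have [||ji|js] := @normal_cone i j.
- have [t t0 e] := step k; have Ak : A k by rewrite AS -ik.
  have := iM k Ak; rewrite /= ik e pairingDl pairingZl pairing_dir lerDl.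
  by rewrite pmulr_rge0 // ler0z.
- have [t t0 e] := step i; have As : A (succ i) by rewrite -AS.
  have := iM _ As; rewrite /= e pairingDl pairingZl pairing_dir gerDl.
  by rewrite pmulr_rle0 // lerz0 det2C oppr_le0.
- by rewrite ji.
- by rewrite js -AS.
Qed.

Lemma nedges_gt0 : exists i : 'I_(nedges Q), True.
Proof.
have [x0 x0s] := pg_interior H.
have Qx : Q x0 by apply/(pg_mem H) => l /x0s/ltW.
have l0 : delta_mx 0 0 != 0 :> 'rV[int]_2.
  by apply/eqP => /rowP/(_ 0); rewrite !mxE.
have [|i _] := @escape x0 (map_mx intr (delta_mx 0 0)) (delta_mx 0 0) Qx.
  by rewrite pairing_self ltr0z norm2_gt0.
by exists i.
Qed.

End Boundary.

(** * Taylor coefficients of polynomials and the presentation ideal *)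

Section Taylor.
Variable n : nat.
Implicit Types (p q : mpoly n rat) (i j : 'I_n).

Definition mvar i : mpoly n rat := mpolyX rat (mnm1 i).

Definition ev0 : mpoly n rat -> rat := meval (fun=> 0).
HB.instance Definition _ := GRing.RMorphism.on ev0.

Definition diff0 i p : rat := ev0 (mderiv i p).

Lemma diff0_is_additive i : zmod_morphism (diff0 i).
Proof. by move=> p q; rewrite /diff0 !raddfB. Qed.
HB.instance Definition _ i :=
  GRing.isZmodMorphism.Build (mpoly n rat) rat (diff0 i) (diff0_is_additive i).

Lemma ev0_var i : ev0 (mvar i) = 0.
Proof. by rewrite /ev0 mevalXU. Qed.

Lemma ev0C c : ev0 (mpolyC n c) = c.
Proof. exact: mevalC. Qed.

Lemma diff0M i p q : diff0 i (p * q) = diff0 i p * ev0 q + ev0 p * diff0 i q.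
Proof. by rewrite /diff0 mderivM rmorphD !rmorphM. Qed.

Lemma diff0C i c : diff0 i (mpolyC n c) = 0.
Proof. by rewrite /diff0 mderivC rmorph0. Qed.

Lemma mderiv_var i j : mderiv i (mvar j) = (i == j)%:R.
Proof.
rewrite /mvar mderivX mnm1E eq_sym; have [->|_] := eqVneq j i; last first.
  by rewrite scale0r.
have -> : mnm_sub (mnm1 i) (mnm1 i) = mnm0.
  by apply/mnmP => k; rewrite mnmBE mnm0E subnn.
by rewrite mpolyX0 scale1r.
Qed.

Lemma diff0_var i j : diff0 i (mvar j) = (i == j)%:R.
Proof. by rewrite /diff0 mderiv_var rmorph_nat. Qed.

Variable c : 'I_n -> 'I_n -> rat.
Hypothesis cC : forall i j, c i j = c j i.

(** Twice the value of the bilinear form c on the degree 2 part of p, expressed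
    by second derivatives so that the Leibniz rule applies. *)
Definition quad p : rat := \sum_i \sum_j c i j * diff0 i (mderiv j p).

Lemma quad_is_additive : zmod_morphism quad.
Proof.
move=> p q; rewrite /quad -sumrB; apply: eq_bigr => i _.
by rewrite -sumrB; apply: eq_bigr => j _; rewrite !raddfB /= mulrBr.
Qed.
HB.instance Definition _ :=
  GRing.isZmodMorphism.Build (mpoly n rat) rat quad quad_is_additive.

Lemma quadM p q : quad (p * q) = quad p * ev0 q + ev0 p * quad q
  + 2 * \sum_i \sum_j c i j * diff0 i p * diff0 j q.
Proof.
have sw : \sum_i \sum_j c i j * diff0 i p * diff0 j q =
    \sum_i \sum_j c i j * diff0 j p * diff0 i q.
  rewrite exchange_big; apply: eq_bigr => i _; apply: eq_bigr => j _.
  by rewrite cC.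
rewrite mulr_natl mulr2n {2}sw /quad mulr_suml mulr_sumr -!big_split /=.
apply: eq_bigr => i _; rewrite mulr_suml mulr_sumr -!big_split /=.
apply: eq_bigr => j _; rewrite mderivM raddfD /= !diff0M.
rewrite -!/(diff0 _ _); ring.
Qed.

Lemma quadC a : quad (mpolyC n a) = 0.
Proof.
rewrite /quad big1 // => i _; rewrite big1 // => j _.
by rewrite mderivC raddf0 mulr0.
Qed.

Lemma quad_var k : quad (mvar k) = 0.
Proof.
rewrite /quad big1 // => i _; rewrite big1 // => j _.
by rewrite mderiv_var -[_%:R]/(_%:R) -mpolyC_nat diff0C mulr0.
Qed.

Lemma quad_var2 k l : quad (mvar k * mvar l) = 2 * c k l.
Proof.
rewrite quadM !quad_var !mul0r !mulr0 !add0r; congr (_ * _).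
rewrite (bigD1 k) //= [X in _ + X]big1 ?addr0 => [|i ik]; last first.
  by rewrite big1 // => j _; rewrite diff0_var (negbTE ik) mulr0 mul0r.
rewrite (bigD1 l) //= big1 ?addr0 => [|j jl]; last first.
  by rewrite [diff0 j _]diff0_var (negbTE jl) mulr0.
by rewrite !diff0_var !eqxx !mulr1.
Qed.

End Taylor.

Lemma rmorph_mmap n (S : comNzRingType) (phi : {rmorphism mpoly n rat -> S}) p :
  phi p = mmap (phi \o @mpolyC n rat) (fun i => phi (mvar i)) p.
Proof.
elim/mpolyind: p => [|c m p _ _ IHp]; first by rewrite !rmorph0.
rewrite !rmorphD IHp; congr (_ + _).
rewrite -mul_mpolyC !rmorphM /= mmapC mmapX mpolyXE_id rmorph_prod; congr (_ * _).
by apply: eq_bigr => i _; rewrite rmorphXn.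
Qed.

(** * The cohomology ring of a polygon *)

Section PolygonRing.
Variables (R : realType) (Q : set 'rV[R]_2) (h : 'rV[int]_2 -> R).
Hypothesis H : polygonal (normals Q) h Q.
Implicit Types (i j k : 'I_(nedges Q)).
Notation n := (@Defs.normal R Q).
Notation s := (@succ R Q h H).

(** The intersection number of two distinct boundary curves of the toric
    surface. *)
Definition off_coef i j : rat :=
  if touch i j then (`|det2 (n i) (n j)|%:~R)^-1 else 0.

(** The intersection matrix of the boundary curves; the self-intersection is the
    value forced by the linear relation of the vector n i. *)
Definition isect i j : rat :=
  if i == j then - (\sum_(k | k != i) (dot2 (n i) (n k))%:~R * off_coef i k)
                 / (norm2 (n i))%:~R
  else off_coef i j.

Lemma isectC i j : isect i j = isect j i.
Proof.
rewrite /isect eq_sym; case: eqVneq => [->//|_].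
by rewrite /off_coef touchC det2C normrN.
Qed.

Lemma norm2_neq0 (K : numFieldType) i : (norm2 (n i))%:~R != 0 :> K.
Proof. by rewrite intr_eq0 gt_eqF // norm2_gt0 // (normal_neq0 H). Qed.

Lemma off_succ i : (det2 (n i) (n (s i)))%:~R * off_coef i (s i) = 1.
Proof.
rewrite /off_coef succ_touch gtr0_norm ?succ_det // mulfV //.
by rewrite intr_eq0 gt_eqF // succ_det.
Qed.

(** Only the two neighbours of an edge contribute; they lie on different sides
    of it, and their terms are 1 and -1. *)
Lemma sum_det_off i :
  \sum_(j | j != i) (det2 (n i) (n j))%:~R * off_coef i j = 0.
Proof.
have [k ->] := succ_surj H i; rewrite (bigD1 (s (s k))) /=; last first.
  by rewrite eq_sym succ_neq.
rewrite off_succ (bigD1 k) /=; last first.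
  by rewrite succ_neq eq_sym succ2_neq.
rewrite big1 => [|j /andP[/andP[j1 j2] j3]]; last first.
  rewrite /off_coef; case: ifP => [m|_]; last by rewrite mulr0.
  have [|e|/succ_inj e] := touch_succ H m; first by rewrite eq_sym.
    by rewrite e eqxx in j2.
  by rewrite e eqxx in j3.
have := off_succ k; rewrite /off_coef touchC [det2 (n (s k)) _]det2C normrN.
by rewrite rmorphN mulNr => ->; rewrite addr0 subrr.
Qed.

(** Along n i this is the choice of the self-intersection, and along the edge
    it is sum_det_off. Hence the matrix passes to the quotient by the linear
    relations. *)
Lemma isect_lin (u : 'rV[rat]_2) i : \sum_j pairing u (n j) * isect i j = 0.
Proof.
apply: (mulfI (norm2_neq0 rat i)); rewrite mulr0 mulr_sumr.
under eq_bigr do rewrite mulrA pairing_decomp mulrDl pairing_dot pairing_dir -!mulrA.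
rewrite big_split /= -!mulr_sumr.
have -> : \sum_j (dot2 (n i) (n j))%:~R * isect i j = 0.
  rewrite (bigD1 i) //= {1}/isect eqxx mulrCA.
  rewrite -/(norm2 (n i)) [dot2 _ _]/(_ + _) -!expr2 -/(norm2 _).
  rewrite mulfV ?norm2_neq0 // mulr1 addrC; apply/eqP; rewrite subr_eq0; apply/eqP.
  by apply: eq_bigr => j ji; rewrite /isect eq_sym (negbTE ji).
have -> : \sum_j (det2 (n i) (n j))%:~R * isect i j = 0.
  rewrite (bigD1 i) //= det2ll mul0r add0r -[RHS](sum_det_off i).
  by apply: eq_bigr => j ji; rewrite /isect eq_sym (negbTE ji).
by rewrite !mulr0 addr0.
Qed.

Lemma isect_linr (u : 'rV[R]_2) i :
  \sum_j pairing u (n j) * ratr (isect i j) = 0.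
Proof.
have e a : \sum_j ((n j 0 a)%:~R : R) * ratr (isect i j) = 0.
  apply: etrans (etrans (congr1 (@ratr R) (isect_lin (delta_mx 0 a) i)) (rmorph0 _)).
  rewrite rmorph_sum; apply: eq_bigr => j _.
  by rewrite rmorphM pairing_delta rmorph_int.
transitivity (u 0 0 * (\sum_j (n j 0 0)%:~R * ratr (isect i j))
              + u 0 1 * (\sum_j (n j 0 1)%:~R * ratr (isect i j))).
  rewrite !mulr_sumr -big_split /=; apply: eq_bigr => j _.
  by rewrite pairing2; ring.
by rewrite !e !mulr0 addr0.
Qed.

(** An ample class meets an edge in the length of the edge. Moving the origin to
    a vertex of the edge, which changes nothing by isect_linr, only the
    neighbour at the other end contributes. *)
Lemma ample_edge_gt0 i : 0 < \sum_j h (n j) * (ratr (isect i j) : R).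
Proof.
have /asboolP[p [/(edgeP H)[Qp pi] ps]] := succ_touch H i.
rewrite -[ltRHS]subr0 -[X in _ - X](isect_linr p i) -sumrB.
have h0 j : 0 <= h (n j) * ratr (isect i j) - pairing p (n j) * ratr (isect i j).
  rewrite -mulrBl; have [<-|ij] := eqVneq i j; first by rewrite pi subrr mul0r.
  rewrite mulr_ge0 //; first by rewrite subr_ge0; have /(pg_memi H) := Qp.
  rewrite /isect (negbTE ij) ler0q /off_coef; case: ifP => // _.
  by rewrite invr_ge0 ler0z normr_ge0.
have [k ik] := succ_surj H i.
rewrite (bigD1 k) //= ltr_pwDl ?sumr_ge0 // -mulrBl mulr_gt0 //.
  rewrite subr_gt0 lt_neqAle; have /(pg_memi H) -> := Qp; rewrite andbT.
  apply/eqP => pk; apply: (@three_edges _ _ _ H k i (s i) p) => //.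
  - by rewrite ik succ_neq.
  - exact: succ_neq.
  - by rewrite ik eq_sym succ2_neq.
  - exact/(edgeP H).
  - exact/(edgeP H).
have ki : k != i by rewrite ik succ_neq.
rewrite /isect eq_sym (negbTE ki) ltr0q /off_coef touchC {1}ik succ_touch.
rewrite invr_gt0 ltr0z normr_gt0; apply: (touch_det H); first by rewrite eq_sym.
by rewrite ik touchC succ_touch.
Qed.

Lemma ample_square_gt0 : (forall i, 0 < h (n i)) ->
  0 < \sum_i \sum_j h (n i) * h (n j) * (ratr (isect i j) : R).
Proof.
move=> h0; have [i0 _] := nedges_gt0 H.
have pos i : 0 < \sum_j h (n i) * h (n j) * (ratr (isect i j) : R).
  under eq_bigr do rewrite -mulrA.
  by rewrite -mulr_sumr mulr_gt0 // ample_edge_gt0.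
by rewrite (bigD1 i0) //= ltr_pwDl // sumr_ge0 // => i _; apply: ltW.
Qed.

Lemma edge_nonempty i : exists x, edge i x.
Proof. by have [x [xi _]] := pg_edgei H i; exists x. Qed.

(** The empty product and the single edges are excluded, as the plane and the
    edges are not empty. *)
Lemma sr_pair (S : {set 'I_(nedges Q)}) :
  \bigcap_(i in [set` S]) edge i = set0 ->
  exists i j, [/\ i != j, i \in S & j \in S].
Proof.
move=> S0; have [i iS] : exists i, i \in S.
  apply/set0Pn/eqP => SE; have : [set: 'rV[R]_2] 0 by [].
  suff -> : [set: 'rV[R]_2] = set0 by [].
  rewrite -S0; apply/esym/seteqP; split => // x _ i /=.
  by rewrite SE finset.in_set0.
have [x xi] := edge_nonempty i; apply: contrapT => h1.
suff : set0 x by [].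
rewrite -S0 => j /= jS; have [<-//|ij] := eqVneq i j.
by exfalso; apply: h1; exists i, j.
Qed.

Notation x_ := (@mvar (nedges Q)).

(** The Taylor coefficients of order 0, 1 and 2 that are needed to decide whether
    a class vanishes. The Leibniz rule reduces the last one to isect_lin on the
    linear generators, and to the coefficient of a disjoint pair on the others. *)
Lemma coh_ideal_taylor p : p \in @coh_ideal R Q ->
  [/\ ev0 p = 0,
      exists u : 'rV[rat]_2, forall i, diff0 i p = pairing u (n i)
    & quad isect p = 0].
Proof.
move=> /asboolP[t tG ->]; elim: t tG => [|c t IHt] tG.
  rewrite big_nil !raddf0; split=> //; exists 0 => i.
  by rewrite raddf0 pairing0l.
have [|e0 [u hu] q0] := IHt; first by move=> d dt; apply: tG; rewrite inE dt orbT.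
have cG := tG c (mem_head _ _); rewrite big_cons.
suff [c0 [v hv] cq] : [/\ ev0 (c.1 * c.2) = 0,
    exists u : 'rV[rat]_2, forall i, diff0 i (c.1 * c.2) = pairing u (n i)
    & quad isect (c.1 * c.2) = 0].
  split; [by rewrite rmorphD /= c0 e0 addr0| |by rewrite raddfD /= cq q0 addr0].
  by exists (v + u) => i; rewrite raddfD /= hv hu pairingDl.
move: c.1 c.2 cG => a b {c tG IHt t e0 u hu q0}.
case=> [[S S0 ->]|[u ->]]; last first.
  set l := \sum_i _; have l0 : ev0 l = 0.
    rewrite rmorph_sum big1 // => i _; rewrite rmorphM.
    by rewrite [X in _ * X]ev0_var mulr0.
  have l1 i : diff0 i l = pairing (map_mx intr u) (n i).
    rewrite raddf_sum (bigD1 i) //= big1 => [|j ji].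
      rewrite diff0M diff0C mul0r add0r ev0C addr0 [X in _ * X]diff0_var eqxx.
      by rewrite mulr1 pairing_map.
    rewrite diff0M diff0C mul0r add0r [X in _ * X]diff0_var eq_sym (negbTE ji).
    by rewrite mulr0.
  have l2 : quad isect l = 0.
    rewrite raddf_sum big1 // => i _ /=; rewrite quadM; last exact: isectC.
    rewrite quadC mul0r add0r [X in _ * X]quad_var mulr0 add0r big1 ?mulr0 // => j _.
    by rewrite big1 // => k _; rewrite diff0C mulr0 mul0r.
  split; first by rewrite rmorphM /= l0 mulr0.
    exists (ev0 a *: map_mx intr u) => i.
    by rewrite diff0M l0 mulr0 add0r l1 pairingZl.
  rewrite quadM ?l0 ?l2 ?mulr0 ?add0r; last exact: isectC.
  rewrite big1 ?mulr0 // => i _; under eq_bigr do rewrite l1 mulrAC.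
  rewrite -mulr_suml; under eq_bigr do rewrite mulrC.
  by rewrite isect_lin mul0r.
have [i [j [ij iS jS]]] := sr_pair S0.
have -> : \prod_(k in S) edge_var k =
    x_ i * x_ j * \prod_(k in S | (k != i) && (k != j)) x_ k :> mpoly _ _.
  rewrite (bigD1 i) //= (bigD1 j) /=; last by rewrite jS eq_sym.
  by rewrite mulrA; congr (_ * _); apply: eq_bigl => k; rewrite andbA.
set r := \prod_(k in S | _) _; rewrite mulrCA -mulrA.
set g := x_ j * (a * r); have xi0 := @ev0_var _ i.
have g0 : ev0 g = 0 by rewrite rmorphM /= ev0_var mul0r.
split; first by rewrite rmorphM /= xi0 mul0r.
  exists 0 => k; rewrite pairing0l diff0M xi0 g0.
  by rewrite mulr0 mul0r addr0.
rewrite /g mulrA quadM; last exact: isectC.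
rewrite quad_var2; last exact: isectC.
rewrite [ev0 (_ * x_ j)]rmorphM /= xi0 !mul0r addr0.
have prod0 (F : _ -> _ -> rat) : \sum_k \sum_l F k l * diff0 k (x_ i * x_ j)
    * diff0 l (a * r) = 0.
  rewrite big1 // => k _; rewrite big1 // => l _.
  by rewrite diff0M !ev0_var mulr0 mul0r addr0 mulr0 mul0r.
rewrite prod0 mulr0 addr0 rmorphM /=.
have [[k /and3P[kS ki kj]]|h2] := pselect (exists k, [&& k \in S, k != i & k != j]).
  rewrite /r (bigD1 k) /=; last by rewrite kS ki.
  by rewrite rmorphM /= ev0_var mul0r !mulr0.
rewrite /isect (negbTE ij) /off_coef ifF ?mulr0 ?mul0r //.
apply/negP => /asboolP[x [xi xj]]; suff : set0 x by [].
rewrite -S0 => k /= kS; have [->//|ki] := eqVneq k i.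
have [->//|kj] := eqVneq k j; exfalso; apply: h2; exists k.
by rewrite kS ki.
Qed.

End PolygonRing.

Section EdgeClasses.
Variables (R : realType) (Q : set 'rV[R]_2) (h : 'rV[int]_2 -> R).
Hypothesis H : polygonal (normals Q) h Q.
Implicit Types (i j k : 'I_(nedges Q)).
Notation n := (@Defs.normal R Q).
Notation s := (@succ R Q h H).

(** The projection and the constants are locked, so that rewriting with the
    morphism laws does not unfold them. *)
Definition coh_pi : {rmorphism mpoly (nedges Q) rat -> cohomology Q} :=
  locked (\pi_(cohomology Q)%qT : {rmorphism _ -> _}).

Definition coh_const : {rmorphism rat -> cohomology Q} :=
  locked (coh_pi \o @mpolyC (nedges Q) rat : {rmorphism _ -> _}).

Lemma coh_piP p : coh_pi p = (\pi_(cohomology Q) p)%qT.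
Proof. by rewrite /coh_pi; unlock. Qed.

Lemma coh_pi_surj y : exists p, y = coh_pi p.
Proof. by exists (generic_quotient.repr y); rewrite coh_piP reprK. Qed.

Lemma coh_constE c : coh_const c = coh_pi (mpolyC _ c).
Proof. by rewrite /coh_const; unlock. Qed.

Definition coh_edge i : cohomology Q := coh_pi (mvar i).

Notation K := coh_const.
Notation X := coh_edge.

Lemma coh_pi_eq0 p : coh_pi p = 0 <-> p \in @coh_ideal R Q.
Proof.
rewrite coh_piP -(rmorph0 (\pi_(cohomology Q))%qT); split=> [e|pI].
  by rewrite -[p]subr0 Quotient.idealrBE; apply/eqP.
by apply/eqP; rewrite -Quotient.idealrBE subr0.
Qed.

Lemma coh_piE p : coh_pi p = mmap K X p.
Proof. by rewrite (rmorph_mmap coh_pi p); unlock coh_const. Qed.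

Lemma coh_gen_eq0 p : (@stanley_reisner_gens R Q `|` @linear_gens R Q) p ->
  coh_pi p = 0.
Proof. by move=> pG; apply/coh_pi_eq0/asboolP/ideal_gen_sub. Qed.

Lemma coh_lin_int (u : 'rV[int]_2) : \sum_i K (pairing u (n i))%:~R * X i = 0.
Proof.
rewrite -[RHS](@coh_gen_eq0 (\sum_i mpolyC _ (pairing u (n i))%:~R * edge_var i)).
  by rewrite rmorph_sum; apply: eq_bigr => i _; rewrite rmorphM coh_constE.
by right; exists u.
Qed.

Lemma coh_lin (u : 'rV[rat]_2) : \sum_i K (pairing u (n i)) * X i = 0.
Proof.
transitivity (K (u 0 0) * (\sum_i K (pairing (delta_mx 0 0 : 'rV[int]_2) (n i))%:~R * X i)
   + K (u 0 1) * (\sum_i K (pairing (delta_mx 0 1 : 'rV[int]_2) (n i))%:~R * X i)).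
  rewrite !mulr_sumr -big_split; apply: eq_bigr => i _ /=.
  by rewrite !pairing_delta !intz pairing2 rmorphD !rmorphM mulrDl !mulrA.
by rewrite !coh_lin_int !mulr0 addr0.
Qed.

Lemma coh_sr (S : {set 'I_(nedges Q)}) :
  \bigcap_(i in [set` S]) edge i = set0 -> \prod_(i in S) X i = 0.
Proof.
move=> S0; rewrite -[RHS](@coh_gen_eq0 (\prod_(i in S) edge_var i)).
  by rewrite rmorph_prod.
by left; exists S.
Qed.

Lemma coh_disjoint i j : i != j -> ~~ touch i j -> X i * X j = 0.
Proof.
move=> ij /asboolPn m; have := @coh_sr [set i; j]%SET.
rewrite big_setU1 ?inE //= big_set1; apply; apply/seteqP; split=> // x xS.
by apply: m; exists x; split; apply: xS => /=; rewrite !inE eqxx ?orbT.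
Qed.

Lemma coh_distinct3 i j k : i != j -> j != k -> i != k -> X i * X j * X k = 0.
Proof.
move=> ij jk ik; have := @coh_sr [set i; j; k]%SET.
rewrite -finset.setUA big_setU1 ?inE ?negb_or ?ij //= big_setU1 ?inE //= big_set1 mulrA.
apply; apply/seteqP; split=> // x xS.
by apply: (three_edges H ij jk ik (x := x)); apply: xS => /=;
  rewrite !inE eqxx ?orbT.
Qed.

Lemma coh_const_mul_eq0 (c : rat) y : c != 0 -> K c * y = 0 -> y = 0.
Proof.
move=> c0 /(congr1 ( *%R (K c^-1))).
by rewrite mulr0 mulrA -rmorphM mulVf // rmorph1 mul1r.
Qed.

(** The linear relation of a vector on which n j vanishes trades one factor X i
    for edges other than i and j. *)
Lemma coh_sq_mul i j : i != j -> X i * X i * X j = 0.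
Proof.
move=> ij; have [m|m] := boolP (touch i j); last first.
  by rewrite -mulrA coh_disjoint // mulr0.
have d0 := touch_det H ij m.
apply: (@coh_const_mul_eq0 (det2 (n j) (n i))%:~R).
  by rewrite intr_eq0 det2C oppr_eq0.
have := congr1 ( *%R^~ (X i * X j)) (coh_lin (dir rat (n j))).
rewrite mul0r mulr_suml (bigD1 i) //= big1 ?addr0 => [|k ki].
  by rewrite pairing_dir -!mulrA.
have [->|kj] := eqVneq k j; first by rewrite pairing_dir det2ll rmorph0 !mul0r.
by rewrite -mulrA [X k * _]mulrA coh_distinct3 ?mulr0.
Qed.

Lemma coh_deg3 i j k : X i * X j * X k = 0.
Proof.
have [->|ij] := eqVneq i j; last first.
  have [<-|jk] := eqVneq j k; first by rewrite -mulrA mulrC coh_sq_mul // eq_sym.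
  have [<-|ik] := eqVneq i k; last exact: coh_distinct3.
  by rewrite mulrAC coh_sq_mul.
have [<-|jk] := eqVneq j k; last exact: coh_sq_mul.
apply: (@coh_const_mul_eq0 (norm2 (n j))%:~R).
  exact: (norm2_neq0 H).
have := congr1 ( *%R^~ (X j * X j)) (coh_lin (map_mx intr (n j))).
rewrite mul0r mulr_suml (bigD1 j) //= big1 ?addr0 => [|l lj].
  by rewrite pairing_self !mulrA.
by rewrite -mulrA [X l * _]mulrC coh_sq_mul ?mulr0 // eq_sym.
Qed.

(** The linear relation of the direction of an edge, multiplied by that edge,
    only involves the two vertices of the edge. *)
Lemma coh_vertex_step i :
  K (det2 (n i) (n (s i)))%:~R * (X i * X (s i)) =
  K (det2 (n (s i)) (n (s (s i))))%:~R * (X (s i) * X (s (s i))).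
Proof.
have := congr1 ( *%R^~ (X (s i))) (coh_lin (dir rat (n (s i)))).
rewrite mul0r mulr_suml (bigD1 i) //= (bigD1 (s (s i))) /=; last first.
  exact: succ2_neq.
rewrite big1 => [|k /andP[k1 k2]]; last first.
  have [->|ks] := eqVneq k (s i); first by rewrite pairing_dir det2ll rmorph0 !mul0r.
  rewrite -mulrA coh_disjoint ?mulr0 //; apply/negP; rewrite touchC => m.
  have [|e|/succ_inj e] := touch_succ H m; first by rewrite eq_sym.
    by rewrite e eqxx in k2.
  by rewrite e eqxx in k1.
rewrite addr0 !pairing_dir [det2 _ (n i)]det2C !rmorphN /= !mulNr addrC => /eqP.
rewrite subr_eq0 => /eqP; rewrite -!mulrA => <-.
by rewrite [X (s (s i)) * _]mulrC.
Qed.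

Definition edge0 : 'I_(nedges Q) := projT1 (cid (nedges_gt0 H)).

(** A vertex, as a cohomology class of top degree. *)
Definition coh_pt : cohomology Q := X edge0 * X (s edge0).

Lemma coh_vertex i : exists r, X i * X (s i) = K r * coh_pt.
Proof.
pose c i : rat := (det2 (n i) (n (s i)))%:~R.
have c0 k : c k != 0 by rewrite intr_eq0 gt_eqF // succ_det.
exists (c edge0 / c i).
pose A := [pred i | K (c i) * (X i * X (s i)) == K (c edge0) * coh_pt].
have /eqP e : A i.
  apply: (@succ_connected _ _ _ H A edge0) => [k|]; last exact/eqP.
  by rewrite /A /= coh_vertex_step.
by rewrite [_ / _]mulrC rmorphM -mulrA -e mulrA -rmorphM mulVf // rmorph1 mul1r.
Qed.

(** The linear relation of n i replaces one factor by edges different from i. *)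
Lemma coh_square i : exists r, X i * X i = K r * coh_pt.
Proof.
have edge_mul j : exists r, X i * (K (pairing (map_mx intr (n i) : 'rV[rat]_2) (n j)) * X j)
    = K r * coh_pt \/ i = j.
  have [->|ij] := eqVneq i j; first by exists 0; right.
  have [m|m] := boolP (touch i j); last first.
    exists 0; left; rewrite mulrCA coh_disjoint // mulr0 rmorph0 mul0r //.
  have [e|e] := touch_succ H m ij.
    have [r er] := coh_vertex i; rewrite e mulrCA er.
    by eexists; left; rewrite mulrA -rmorphM.
  have [r er] := coh_vertex j; rewrite e mulrCA [X _ * X j]mulrC er.
  by eexists; left; rewrite mulrA -rmorphM.
have [r hr] : exists r, \sum_(j | j != i)
    X i * (K (pairing (map_mx intr (n i) : 'rV[rat]_2) (n j)) * X j) = K r * coh_pt.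
  elim/big_ind: _ => [|_ _ [r ->] [r' ->]|j ji].
  - by exists 0; rewrite rmorph0 mul0r.
  - by exists (r + r'); rewrite rmorphD mulrDl.
  - by have [r [er|/esym/eqP]] := edge_mul j; [exists r | rewrite (negbTE ji)].
have := congr1 ( *%R (X i)) (coh_lin (map_mx intr (n i))).
rewrite mulr0 mulr_sumr (bigD1 i) //= hr pairing_self mulrCA => /eqP.
rewrite addr_eq0 => /eqP e.
exists (- ((norm2 (n i))%:~R^-1 * r)).
have N0 := norm2_neq0 H rat i.
transitivity (K (norm2 (n i))%:~R^-1 * (K (norm2 (n i))%:~R * (X i * X i))).
  by rewrite mulrA -rmorphM mulVf // rmorph1 mul1r.
by rewrite e mulrN mulrA -rmorphM rmorphN mulNr.
Qed.

Lemma coh_mul i j : exists r, X i * X j = K r * coh_pt.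
Proof.
have [->|ij] := eqVneq i j; first exact: coh_square.
have [m|m] := boolP (touch i j); last first.
  by exists 0; rewrite coh_disjoint // rmorph0 mul0r.
have [->|->] := touch_succ H m ij.
  by have [r er] := coh_vertex i; exists r.
by have [r er] := coh_vertex j; exists r; rewrite mulrC.
Qed.

Lemma coh_pt_edge i : coh_pt * X i = 0.
Proof. exact: coh_deg3. Qed.

(** The cohomology is concentrated in degrees 0, 2 and 4. *)
Definition coh_form (y : cohomology Q) : Prop :=
  exists a (b : 'I_(nedges Q) -> rat) c, y = K a + \sum_i K (b i) * X i + K c * coh_pt.

Lemma coh_formD y z : coh_form y -> coh_form z -> coh_form (y + z).
Proof.
move=> [a [b [c ->]]] [a' [b' [c' ->]]].
exists (a + a'), (fun i => b i + b' i), (c + c').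
rewrite !rmorphD [in RHS]mulrDl; under [in RHS]eq_bigr do rewrite rmorphD mulrDl.
by rewrite big_split /= addrACA; congr (_ + _); rewrite addrACA.
Qed.

Lemma coh_formZ a y : coh_form y -> coh_form (K a * y).
Proof.
move=> [a' [b' [c' ->]]]; exists (a * a'), (fun i => a * b' i), (a * c').
rewrite !mulrDr mulr_sumr !rmorphM !mulrA; congr (_ + _ + _).
by apply: eq_bigr => i _; rewrite rmorphM mulrA.
Qed.

Lemma coh_form_const a : coh_form (K a).
Proof.
exists a, (fun=> 0), 0; rewrite rmorph0 mul0r addr0 big1 ?addr0 // => i _.
by rewrite mul0r.
Qed.

Lemma coh_form_edge i : coh_form (X i).
Proof.
exists 0, (fun j => (j == i)%:R), 0; rewrite rmorph0 mul0r addr0 add0r.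
rewrite (bigD1 i) //= eqxx rmorph1 mul1r big1 ?addr0 // => j ji.
by rewrite (negbTE ji) rmorph0 mul0r.
Qed.

Lemma coh_form_pt : coh_form coh_pt.
Proof.
exists 0, (fun=> 0), 1; rewrite rmorph0 rmorph1 mul1r add0r big1 ?add0r // => i _.
by rewrite mul0r.
Qed.

Lemma coh_formM_edge i y : coh_form y -> coh_form (y * X i).
Proof.
move=> [a [b [c ->]]]; rewrite !mulrDl; apply: coh_formD; last first.
  by rewrite -mulrA coh_pt_edge mulr0 -(rmorph0 K); apply: coh_form_const.
apply: coh_formD; first by apply/coh_formZ/coh_form_edge.
rewrite mulr_suml; elim/big_ind: _ => [|x z|j _].
- by rewrite -(rmorph0 K); apply: coh_form_const.
- exact: coh_formD.
- rewrite -mulrA; apply: coh_formZ; have [r ->] := coh_mul j i.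
  exact/coh_formZ/coh_form_pt.
Qed.

Lemma coh_formP y : coh_form y.
Proof.
have [p ->] := coh_pi_surj y; rewrite coh_piE.
elim/mpolyind: p => [|a m p _ _ IHp].
  by rewrite rmorph0 -(rmorph0 K); apply: coh_form_const.
rewrite rmorphD /=; apply: coh_formD => //; rewrite mmapZ; apply: coh_formZ.
rewrite mmapX /mmap1.
elim/big_rec: _ => [|i z _ IHz]; first by rewrite -(rmorph1 K); apply: coh_form_const.
rewrite mulrC; elim: (m i) => [|e IHe]; first by rewrite expr0 mulr1.
by rewrite exprSr mulrA; apply: coh_formM_edge.
Qed.

End EdgeClasses.

(** * Reflection groups and their chambers *)

Section Chamber.
Variables (R : realType) (gT : finGroupType) (W : {group gT}).
Variable rW : mx_representation int W 2.
Hypothesis hrW : mx_faithful rW.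
Implicit Types (x y z : 'rV[R]_2) (l : 'rV[int]_2) (v w : gT).

Definition act w x : 'rV[R]_2 := lact (rW w) x.
Definition dact w l : 'rV[int]_2 := dual_act (rW w) l.

Lemma actD w x y : act w (x + y) = act w x + act w y.
Proof. exact: mulmxDl. Qed.

Lemma actZ w a x : act w (a *: x) = a *: act w x.
Proof. by rewrite /act /lact scalemxAl. Qed.

Lemma actB w x y : act w (x - y) = act w x - act w y.
Proof. exact: mulmxBl. Qed.

Lemma act0 w : act w 0 = 0.
Proof. exact: mul0mx. Qed.

Lemma act1 x : act 1%g x = x.
Proof. by rewrite /act /lact repr_mx1 map_mx1 mulmx1. Qed.

Lemma actM v w x : v \in W -> w \in W -> act (v * w)%g x = act w (act v x).
Proof. by move=> Wv Ww; rewrite /act /lact repr_mxM // map_mxM mulmxA. Qed.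

Lemma actVK w x : w \in W -> act w (act w^-1%g x) = x.
Proof. by move=> Ww; rewrite -actM ?groupV // mulVg act1. Qed.

Lemma actKV w x : w \in W -> act w^-1%g (act w x) = x.
Proof. by move=> Ww; rewrite -actM ?groupV // mulgV act1. Qed.

Lemma act_eq0 w x : w \in W -> act w x = 0 -> x = 0.
Proof. by move=> Ww e; rewrite -[x](actKV _ Ww) e act0. Qed.

Lemma pairing_act w x l : w \in W -> pairing (act w x) (dact w l) = pairing x l.
Proof. by move=> Ww; apply/pairing_dual/repr_mx_unit. Qed.

Lemma dactM v w l : v \in W -> w \in W -> dact (v * w)%g l = dact w (dact v l).
Proof.
move=> Wv Ww; apply: (@pairing_ext R) => x.
rewrite -[x](@actVK (v * w)%g) ?groupM // pairing_act ?groupM //.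
by rewrite [act (v * w)%g _]actM // !pairing_act.
Qed.

Lemma dact1 l : dact 1%g l = l.
Proof.
by apply: (@pairing_ext R) => x; rewrite -{1}[x]act1 pairing_act.
Qed.

Lemma dactVK w l : w \in W -> dact w (dact w^-1%g l) = l.
Proof. by move=> Ww; rewrite -dactM ?groupV // mulVg dact1. Qed.

Lemma dactKV w l : w \in W -> dact w^-1%g (dact w l) = l.
Proof. by move=> Ww; rewrite -dactM ?groupV // mulgV dact1. Qed.

Lemma pairing_dact w x l : w \in W -> pairing x (dact w l) = pairing (act w^-1%g x) l.
Proof. by move=> Ww; rewrite -{1}[x](actVK x Ww) pairing_act. Qed.

Lemma act_faithful w : w \in W -> (forall x, act w x = x) -> w = 1%g.
Proof.
move=> Ww fw; have /fintype.subsetP/(_ w) := hrW; rewrite !inE => h; apply/eqP/h.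
rewrite Ww mul1mx /=; apply/eqP/matrixP => i j.
have /rowP/(_ j) := fw (delta_mx 0 i).
rewrite /act /lact -rowE !mxE; rewrite /= => e; apply: (@intr_inj R).
by rewrite e eq_sym; case: (i == j).
Qed.

Definition dotp x y : R := x 0 0 * y 0 0 + x 0 1 * y 0 1.
Definition form x y : R := \sum_(w in W) dotp (act w x) (act w y).

Lemma dotpC x y : dotp x y = dotp y x.
Proof. by rewrite /dotp; ring. Qed.

Lemma formC x y : form x y = form y x.
Proof. by apply: eq_bigr => w _; apply: dotpC. Qed.

Lemma formDl x y z : form (x + y) z = form x z + form y z.
Proof.
rewrite /form -big_split; apply: eq_bigr => w _ /=.
by rewrite actD /dotp !mxE; ring.
Qed.

Lemma formZl a x z : form (a *: x) z = a * form x z.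
Proof.
rewrite /form mulr_sumr; apply: eq_bigr => w _ /=.
by rewrite actZ /dotp !mxE; ring.
Qed.

Lemma formBl x y z : form (x - y) z = form x z - form y z.
Proof. by rewrite formDl -scaleN1r formZl mulN1r. Qed.

Lemma formDr x y z : form x (y + z) = form x y + form x z.
Proof. by rewrite formC formDl !(formC x). Qed.

Lemma formZr a x z : form x (a *: z) = a * form x z.
Proof. by rewrite formC formZl formC. Qed.

Lemma formBr x y z : form x (y - z) = form x y - form x z.
Proof. by rewrite formC formBl !(formC x). Qed.

Lemma form_act w x y : w \in W -> form (act w x) (act w y) = form x y.
Proof.
move=> Ww; rewrite [RHS]/form (reindex_inj (mulgI w)) /=.
rewrite /form; apply: eq_big => [v|v Wv]; first by rewrite (groupMl _ Ww).
by rewrite !actM.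
Qed.

Lemma form_gt0 x : x != 0 -> 0 < form x x.
Proof.
move=> x0; have d0 z : 0 <= dotp z z by rewrite /dotp; nra.
rewrite /form (bigD1 1%g) //= ltr_pwDl ?sumr_ge0 // act1.
rewrite lt_def d0 andbT; apply: contra x0; rewrite /dotp -!expr2.
rewrite paddr_eq0 ?sqr_ge0 // !sqrf_eq0 => /andP[/eqP a /eqP b].
by apply/eqP/row2P; rewrite mxE.
Qed.

Lemma form_ext y z : (forall x, form x y = form x z) -> y = z.
Proof.
move=> e; apply/eqP; rewrite -subr_eq0; apply: contraT => /form_gt0.
by rewrite formBr e subrr ltxx.
Qed.

Lemma row2_delta x : x = x 0 0 *: delta_mx 0 0 + x 0 1 *: delta_mx 0 1.
Proof. by apply: row2P; rewrite !mxE /=; ring. Qed.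

Lemma sharp_exists l : exists y, forall x, form x y = pairing x l.
Proof.
pose e0 : 'rV[R]_2 := delta_mx 0 0; pose e1 : 'rV[R]_2 := delta_mx 0 1.
pose a := form e0 e0; pose b := form e0 e1; pose c := form e1 e1.
have e00 : e0 != 0.
  by apply/eqP => /rowP/(_ 0)/eqP; rewrite !mxE /= oner_eq0.
have a0 : 0 < a by apply: form_gt0.
have d0 : a * c - b ^+ 2 != 0.
  have : a *: e1 - b *: e0 != 0.
    apply/eqP => /rowP/(_ 1); rewrite !mxE /= !mulr1n mulr0 subr0 mulr1 => a1.
    by rewrite a1 ltxx in a0.
  move/form_gt0; apply: contraL => /eqP d.
  suff -> : form (a *: e1 - b *: e0) (a *: e1 - b *: e0) = a * (a * c - b ^+ 2).
    by rewrite d mulr0 ltxx.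
  by rewrite !(formBl, formBr, formZl, formZr) [form e1 e0]formC -/a -/b -/c; ring.
pose p : R := (l 0 0)%:~R; pose q : R := (l 0 1)%:~R.
exists (((c * p - b * q) / (a * c - b ^+ 2)) *: e0
      + ((a * q - b * p) / (a * c - b ^+ 2)) *: e1) => x.
rewrite {1}[x]row2_delta -/e0 -/e1 formDl !formZl !formDr !formZr.
rewrite [form e1 e0]formC -/a -/b -/c pairing2 -/p -/q.
by field.
Qed.

(** The vector representing a normal through the invariant inner product. *)
Definition sharp l : 'rV[R]_2 := projT1 (cid (sharp_exists l)).

Lemma form_sharp x l : form x (sharp l) = pairing x l.
Proof. exact: (projT2 (cid (sharp_exists l))). Qed.

Lemma sharp_act w l : w \in W -> sharp (dact w l) = act w (sharp l).
Proof.
move=> Ww; apply: form_ext => x; rewrite form_sharp pairing_dact // -form_sharp.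
by rewrite -(form_act _ _ Ww) actVK.
Qed.

Lemma sharp_inj : injective sharp.
Proof.
by move=> l l' e; apply: (@pairing_ext R) => x; rewrite -!form_sharp e.
Qed.

Lemma sharp_neq0 l : l != 0 -> sharp l != 0.
Proof.
apply: contra_neq => e; apply: (@pairing_ext R) => x.
by rewrite -form_sharp e -(scale0r 0) formZr mul0r pairing2 !mxE !mulr0 addr0.
Qed.

Lemma pairing_sharp_gt0 l : l != 0 -> 0 < pairing (sharp l) l.
Proof. by move=> l0; rewrite -form_sharp form_gt0 // sharp_neq0. Qed.

Lemma span2 x y z : x != 0 -> (forall t, y <> t *: x) ->
  exists a b, z = a *: x + b *: y.
Proof.
move=> x0 xy; pose d (x y : 'rV[R]_2) := x 0 0 * y 0 1 - x 0 1 * y 0 0.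
have d0 : d x y != 0.
  apply/eqP => d0; apply: (xy (dotp x y / dotp x x)).
  have n0 : dotp x x != 0.
    apply: contra x0; rewrite /dotp -!expr2.
    rewrite paddr_eq0 ?sqr_ge0 // !sqrf_eq0 => /andP[/eqP a /eqP b].
    by apply/eqP/row2P; rewrite mxE.
  have e0 : dotp x x * y 0 0 = dotp x y * x 0 0 - x 0 1 * d x y.
    by rewrite /dotp /d; ring.
  have e1 : dotp x x * y 0 1 = dotp x y * x 0 1 + x 0 0 * d x y.
    by rewrite /dotp /d; ring.
  apply: row2P; rewrite mxE; apply: (mulfI n0).
    by rewrite e0 d0 mulr0 subr0 mulrA [_ * (_ / _)]mulrC divfK.
  by rewrite e1 d0 mulr0 addr0 mulrA [_ * (_ / _)]mulrC divfK.
exists (d z y / d x y), (d x z / d x y); apply: row2P; rewrite !mxE.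
  by apply: (mulfI d0); move: d0; rewrite /d => d0; field.
by apply: (mulfI d0); move: d0; rewrite /d => d0; field.
Qed.

(** The eigenlines of a reflection are orthogonal for the invariant form, so that
    it is the orthogonal reflection determined by its mirror. *)
Lemma reflection_act w l x : w \in W -> is_reflection R (rW w) ->
  fixed_line R (rW w) l -> l != 0 ->
  act w x = x - (2 * pairing x l / pairing (sharp l) l) *: sharp l.
Proof.
move=> Ww [u [v [u0 v0 uw vw]]] fl l0.
rewrite -/(act w u) in uw; rewrite -/(act w v) in vw.
have ul : pairing u l = 0 by apply/fl.
have uv : form u v = 0.
  have := form_act u v Ww; rewrite uw vw -scaleN1r formZr; lra.
have ind t : v <> t *: u.
  move=> vu; move: v0 uv; rewrite vu formZr => v0 /eqP; rewrite mulf_eq0.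
  have [t0|t0] := eqVneq t 0; first by rewrite t0 scale0r eqxx in v0.
  by rewrite gt_eqF // form_gt0.
have [a [b sE]] := span2 (sharp l) u0 ind.
have a0 : a = 0.
  have := form_sharp u l; rewrite ul sE formDr !formZr uv mulr0 addr0 => /eqP.
  by rewrite mulf_eq0 [form u u == 0]gt_eqF ?form_gt0 // orbF => /eqP.
rewrite a0 scale0r add0r in sE.
have b0 : b != 0.
  by apply: contra_neq (sharp_neq0 l0) => b0; rewrite sE b0 scale0r.
have [p [q xE]] := span2 x u0 ind.
have q0 := pairing_sharp_gt0 l0.
have pl : pairing x l = (q / b) * pairing (sharp l) l.
  by rewrite xE pairingDl !pairingZl ul mulr0 add0r sE pairingZl mulrA divfK.
rewrite pl {1}xE actD !actZ uw vw {1}xE mulrA mulfK ?gt_eqF // sE scalerA.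
rewrite mulrA divfK // scalerN -addrA; congr (_ + _).
by rewrite -scalerBl -scaleNr; congr (_ *: _); ring.
Qed.

Lemma reflection_pairing w l x : w \in W -> is_reflection R (rW w) ->
  fixed_line R (rW w) l -> l != 0 -> pairing (act w x) l = - pairing x l.
Proof.
move=> Ww rw fl l0; rewrite (reflection_act x Ww rw fl l0) pairingBl pairingZl.
by rewrite divfK ?gt_eqF ?pairing_sharp_gt0 //; ring.
Qed.

Lemma reflection_invol w l : w \in W -> is_reflection R (rW w) ->
  fixed_line R (rW w) l -> l != 0 -> (w * w)%g = 1%g.
Proof.
move=> Ww rw fl l0; apply: act_faithful => [|x]; first by rewrite groupM.
rewrite actM // [LHS](reflection_act _ Ww rw fl l0) reflection_pairing //.
by rewrite (reflection_act x Ww rw fl l0) mulrN mulNr scaleNr opprK subrK.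
Qed.

End Chamber.

Section Walls.
Variables (R : realType) (gT : finGroupType) (W : {group gT}).
Variable rW : mx_representation int W 2.
Hypothesis hrW : mx_faithful rW.
Variables (K : finType) (s : K -> gT) (eta : K -> 'rV[int]_2) (u : K -> 'rV[rat]_2).
Implicit Types (x y z : 'rV[R]_2) (l : 'rV[int]_2) (v w : gT) (j k : K).
Notation act := (act rW).
Notation dact := (dact rW).
Notation form := (form rW).
Notation sharp := (@sharp R gT W rW).

Definition chamber x : Prop := forall k, pairing x (eta k) <= 0.

(** A strictly fundamental chamber: its walls are mirrors of W, and no element
    but 1 maps an interior point into it. The dual vectors u k make the walls
    independent, and distinct walls only meet at the origin; this covers half
    planes, with one wall, as well as sectors, with two. *)
Record strict_chamber : Prop := StrictChamber {
  wall_in : forall k, s k \in W;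
  wall_reflection : forall k, is_reflection R (rW (s k));
  wall_line : forall k, fixed_line R (rW (s k)) (eta k);
  wall_primitive : forall k, primitive (eta k);
  wall_dual : forall k j, pairing (u k) (eta j) = (k == j)%:R;
  wall_uniq : forall x j k, x != 0 -> pairing x (eta j) = 0 ->
    pairing x (eta k) = 0 -> j = k;
  chamber_strict : forall w y, w \in W -> (forall k, pairing y (eta k) < 0) ->
    chamber (act w y) -> w = 1%g
}.

Hypothesis C : strict_chamber.

Lemma wall_neq0 k : eta k != 0.
Proof. exact: primitive_neq0 (wall_primitive C k). Qed.

Let q k : R := pairing (sharp (eta k)) (eta k).

Lemma wall_sharp_gt0 k : 0 < q k.
Proof. exact: pairing_sharp_gt0 (wall_neq0 k). Qed.

Lemma wall_act k x :
  act (s k) x = x - (2 * pairing x (eta k) / q k) *: sharp (eta k).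
Proof.
apply: reflection_act; [exact: wall_in C k|exact: wall_reflection C k| |].
  exact: wall_line C k.
exact: wall_neq0.
Qed.

Lemma wall_fix k x : pairing x (eta k) = 0 -> act (s k) x = x.
Proof. by move=> e; rewrite wall_act e mulr0 mul0r scale0r subr0. Qed.

Lemma pairing_wall_act k x : pairing (act (s k) x) (eta k) = - pairing x (eta k).
Proof.
apply: reflection_pairing; [exact: wall_in C k|exact: wall_reflection C k| |].
  exact: wall_line C k.
exact: wall_neq0.
Qed.

Lemma form_wall k x y : form (act (s k) x) y =
  form x y - 2 * pairing x (eta k) / q k * pairing y (eta k).
Proof. by rewrite wall_act formBl formZl [form (sharp _) _]formC form_sharp. Qed.

Lemma wall_invol k : (s k * s k)%g = 1%g.
Proof.
apply: (@reflection_invol R _ _ _ hrW _ (eta k)); first exact: wall_in C k.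
- exact: wall_reflection C k.
- exact: wall_line C k.
- exact: wall_neq0.
Qed.

Lemma wallV k : (s k)^-1%g = s k.
Proof. by apply/eqP; rewrite eq_invg_mul wall_invol. Qed.

Definition chamber_center : 'rV[R]_2 := - \sum_k map_mx ratr (u k).

Lemma chamber_centerE j : pairing chamber_center (eta j) = -1.
Proof.
rewrite pairingNl pairing_suml (bigD1 j) //= big1 => [|k kj].
  by rewrite pairing_map (wall_dual C) eqxx rmorph1 addr0.
by rewrite pairing_map (wall_dual C) (negbTE kj) rmorph0.
Qed.

Lemma chamber_center_lt0 j : pairing chamber_center (eta j) < 0.
Proof. by rewrite chamber_centerE oppr_lt0. Qed.

(** Moving the representative of an orbit as far as possible in the direction
    of an interior point of the chamber brings it into the chamber. *)
Lemma towards_chamber x y : (forall k, pairing y (eta k) < 0) ->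
  exists w, [/\ w \in W, chamber (act w x)
    & forall v, v \in W -> form (act v x) y <= form (act w x) y].
Proof.
move=> yC.
case: (@arg_maxP _ _ _ 1%g (mem W) (fun w => form (act w x) y) (group1 W)) => w Ww wM.
exists w; split=> // k; have Ws := wall_in C k.
have := wM _ (groupM Ww Ws); rewrite /= actM // form_wall gerBl.
set p := pairing _ _; set r := pairing y _.
have -> : 2 * p / q k * r = 2 / q k * (p * r) by ring.
rewrite pmulr_rge0 ?divr_gt0 ?wall_sharp_gt0 // => h.
by rewrite leNgt; apply/negP => p0; have := yC k; rewrite -/r; nra.
Qed.

Lemma chamber_orbit x : exists2 w, w \in W & chamber (act w x).
Proof. by have [w [Ww wC _]] := towards_chamber x chamber_center_lt0; exists w. Qed.

Lemma chamber_push x e : chamber x -> 0 < e ->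
  forall k, pairing (x + e *: chamber_center) (eta k) < 0.
Proof.
by move=> xC e0 k; rewrite pairingDl pairingZl chamber_centerE; have := xC k; lra.
Qed.

(** Perturbing into the interior of the chamber, the strictness of interior
    points controls the boundary points, which lie on a single mirror. *)
Lemma chamber_return w x : w \in W -> chamber x -> chamber (act w x) ->
  act w x != 0 -> w = 1%g \/ exists2 k, w = s k & pairing (act w x) (eta k) = 0.
Proof.
move=> Ww xC wC w0.
pose neg k := pairing (act w x) (eta k) < 0.
pose c := act w chamber_center.
have [//|e e0 he] := @small_eps R _ (enum K) neg (fun k => pairing (act w x) (eta k))
  (fun k => pairing c (eta k)).
have wxe e1 : act w (x + e1 *: chamber_center) = act w x + e1 *: c.
  by rewrite actD actZ.
have [[k wk]|nw] := pselect (exists k, pairing (act w x) (eta k) = 0); last first.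
  left; apply: (chamber_strict C Ww (chamber_push xC e0)) => k.
  rewrite wxe pairingDl pairingZl ltW // (he _ _ _ _ (ltW e0)) ?mem_enum //.
  by rewrite /neg lt_neqAle wC andbT; apply/eqP => wk; apply: nw; exists k.
have negk j : j != k -> neg j.
  move=> jk; rewrite /neg lt_neqAle wC andbT; apply: contra jk => /eqP wj.
  by rewrite (wall_uniq C w0 wj wk).
have Ws := wall_in C k.
have [//|e' e'0 he'] := @small_eps R _ (enum K) neg
  (fun k => pairing (act w x) (eta k)) (fun j => pairing (act (s k) c) (eta j)).
have [ck|ck] := leP (pairing c (eta k)) 0.
  left; apply: (chamber_strict C Ww (chamber_push xC e0)) => j.
  rewrite wxe pairingDl pairingZl; have [->|jk] := eqVneq j k.
    by rewrite wk add0r mulr_ge0_le0 // ltW.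
  by rewrite ltW // (he _ _ _ _ (ltW e0)) ?mem_enum // negk.
right; exists k => //; apply/eqP; rewrite eq_mulgV1 wallV; apply/eqP.
apply: (chamber_strict C _ (chamber_push xC e'0)); first by rewrite groupM.
move=> j; rewrite actM // wxe actD actZ (wall_fix wk) pairingDl pairingZl.
have [->|jk] := eqVneq j k; last first.
  by rewrite ltW // (he' _ _ _ _ (ltW e'0)) ?mem_enum // negk.
by rewrite wk add0r pairing_wall_act mulr_ge0_le0 ?ltW // oppr_lt0.
Qed.

Lemma chamber_fixed w x : w \in W -> chamber x -> chamber (act w x) -> act w x = x.
Proof.
move=> Ww xC wC; have [w0|w0] := eqVneq (act w x) 0.
  by rewrite w0 (act_eq0 Ww w0).
have [->|[k wE wk]] := chamber_return Ww xC wC w0; first exact: act1.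
by rewrite -[LHS](wall_fix wk) -{1}wallV -wE actKV.
Qed.

Lemma chamber_stab w x : w \in W -> chamber x -> x != 0 -> act w x = x ->
  w = 1%g \/ exists2 k, w = s k & pairing x (eta k) = 0.
Proof. by move=> Ww xC x0 e; have := chamber_return Ww xC; rewrite e; apply. Qed.

(** * Dominant normals *)

(** By chamber_orbit and chamber_fixed every orbit of normals has exactly one
    dominant member. *)
Definition dominant l := [forall k, pairing (sharp l) (eta k) <= 0].

Lemma dominantP l : reflect (chamber (sharp l)) (dominant l).
Proof. exact: forallP. Qed.

(** For x in the interior of the chamber, the maximum over the orbit is reached
    at a representative of sharp l in the chamber, that is, at sharp l itself;
    points of the walls are limits of interior points. *)
Lemma dominant_max l x w : dominant l -> chamber x -> w \in W ->
  pairing x (dact w l) <= pairing x l.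
Proof.
move=> /dominantP lC xC Ww; rewrite -!(form_sharp rW) sharp_act // -subr_le0 -formBr.
apply: (@le0_limit _ _ (form chamber_center (act w (sharp l) - sharp l))) => e e0.
rewrite -formZl -formDl formC formBl subr_le0.
have yC := chamber_push xC e0.
have [v [Wv vC vM]] := towards_chamber (sharp l) yC.
by apply: le_trans (vM w Ww) _; rewrite (chamber_fixed Wv lC vC).
Qed.

Lemma dominant_orbit l : exists2 w, w \in W & dominant (dact w l).
Proof.
have [w Ww wC] := chamber_orbit (sharp l); exists w => //.
by apply/dominantP; rewrite sharp_act.
Qed.

Lemma dominant_uniq l w : w \in W -> dominant l -> dominant (dact w l) ->
  dact w l = l.
Proof.
move=> Ww /dominantP lC /dominantP; rewrite sharp_act // => wC.
by apply: (@sharp_inj R _ _ rW); rewrite sharp_act // (chamber_fixed Ww).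
Qed.

Lemma dominant_stab l w : w \in W -> dominant l -> l != 0 -> dact w l = l ->
  w = 1%g \/ exists2 k, w = s k & pairing (sharp l) (eta k) = 0.
Proof.
move=> Ww /dominantP lC l0 wl; apply: chamber_stab => //; first exact: sharp_neq0.
by rewrite -sharp_act // wl.
Qed.

Lemma wall_not_dominant k : ~~ dominant (eta k).
Proof.
by apply/negP => /dominantP/(_ k); rewrite leNgt wall_sharp_gt0.
Qed.

End Walls.

(** * Chambers bounded by mirrors *)

Section ChamberStrict.
Variables (R : realType) (gT : finGroupType) (W : {group gT}).
Variable rW : mx_representation int W 2.
Hypothesis hrW : mx_faithful rW.
Implicit Types (x y z : 'rV[R]_2) (l : 'rV[int]_2) (v w t : gT).
Notation act := (act rW).
Notation form := (form rW).

Lemma cycle_invol t w : (t * t)%g = 1%g -> w \in <[t]>%g -> w = 1%g \/ w = t.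
Proof.
move=> tt /cycleP[i ->]; elim: i => [|i [IHi|IHi]]; first by left.
  by right; rewrite expgS IHi mulg1.
by left; rewrite expgS IHi.
Qed.

Lemma order2_strict_chamber t eta : W = <[t]>%g :> {set gT} ->
  is_reflection R (rW t) -> primitive eta -> fixed_line R (rW t) eta ->
  strict_chamber R rW (fun _ : unit => t) (fun=> eta)
    (fun=> (norm2 eta)%:~R^-1 *: map_mx intr eta).
Proof.
move=> WE rt pe fl; have e0 := primitive_neq0 pe.
have Wt : t \in W by rewrite WE cycle_id.
split=> //.
- by move=> [] []; rewrite pairingZl pairing_self mulVf // intr_eq0 gt_eqF // norm2_gt0.
- by move=> x [] [].
move=> w y; rewrite WE => /(cycle_invol (reflection_invol hrW Wt rt fl e0))[//|->].
move=> /(_ tt) y0 /(_ tt); rewrite (reflection_pairing _ Wt rt fl e0) oppr_le0.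
by rewrite leNgt y0.
Qed.

Lemma form_continuous y : continuous (form^~ y).
Proof.
have -> : form^~ y = (fun x => x 0 0 * form (delta_mx 0 0) y
    + x 0 1 * form (delta_mx 0 1) y).
  by apply/funext => x; rewrite {1}[x]row2_delta formDl !formZl.
move=> x.
apply: (@continuousD R R 'rV[R]_2 (fun x => x 0 0 * form (delta_mx 0 0) y)
    (fun x => x 0 1 * form (delta_mx 0 1) y)).
  apply: (@continuousM R _ (fun x : 'rV[R]_2 => x 0 0) (fun=> _)).
    exact: coord_continuous.
  exact: cst_continuous.
apply: (@continuousM R _ (fun x : 'rV[R]_2 => x 0 1) (fun=> _)).
  exact: coord_continuous.
exact: cst_continuous.
Qed.

(** A connected component of the complement of the mirrors lies on one side of
    each mirror, so that no mirror meets the interior of its closure. *)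
Lemma chamber_mirror (K : finType) (eta : K -> 'rV[int]_2) :
  is_chamber rW [set x : 'rV[R]_2 | chamber eta x] ->
  forall t x, t \in W -> is_reflection R (rW t) ->
  (forall k, pairing x (eta k) < 0) -> act t x <> x.
Proof.
move=> [x0 x0m CE] t x Wt rt xU tx; have [a [b [a0 b0 ta tb]]] := rt.
rewrite -/(act t a) in ta; rewrite -/(act t b) in tb.
have perp z : act t z = z -> form z b = 0.
  by move=> tz; have := form_act rW z b Wt; rewrite tz tb -scaleN1r formZr; lra.
have bb := form_gt0 rW b0.
have ind r : b <> r *: a.
  move=> ba; have := perp a ta; rewrite ba formZr => /eqP; rewrite mulf_eq0.
  rewrite [form a a == 0]gt_eqF ?form_gt0 // orbF => /eqP r0.
  by move: b0; rewrite ba r0 scale0r eqxx.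
pose Kc := connected_component (~` @mirrors R _ _ rW) x0.
have Kneq z : Kc z -> form z b != 0.
  move=> Kz; apply/eqP => zb.
  suff : mirrors rW z by apply: (connected_component_sub Kz).
  exists t; split=> //; have [p [q zE]] := span2 z a0 ind.
  have q0 : q = 0.
    move: zb; rewrite zE formDl !formZl perp // mulr0 add0r => /eqP.
    by rewrite mulf_eq0 [form b b == 0]gt_eqF // orbF => /eqP.
  by rewrite zE q0 scale0r addr0 -/(act t _) actZ ta.
have Kcon : connected (form^~ b @` Kc).
  apply: connected_continuous_connected; first exact: component_connected.
  exact/continuous_subspaceT/form_continuous.
have x0K : Kc x0 by apply: connected_component_refl.
wlog x0b : b tb b0 perp bb ind Kneq Kcon / form x0 b < 0.
  move=> hw; have := Kneq _ x0K; case: (ltgtP (form x0 b) 0) => // x0b _.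
    exact: (hw b tb b0 perp bb ind Kneq Kcon x0b).
  apply: (hw (- b)).
  - by rewrite -[in LHS]scaleN1r actZ tb scaleN1r.
  - by rewrite oppr_eq0.
  - by move=> z tz; rewrite -scaleN1r formZr perp // mulr0.
  - by rewrite form_gt0 // oppr_eq0.
  - by move=> r e; apply: (ind (- r)); rewrite scaleNr -e opprK.
  - by move=> z Kz; rewrite -scaleN1r formZr mulN1r oppr_eq0 Kneq.
  - have -> : form^~ (- b) = (fun r => - r) \o form^~ b.
      by apply/funext => z /=; rewrite -scaleN1r formZr mulN1r.
    rewrite -image_comp; apply: connected_continuous_connected => //.
    by apply/continuous_subspaceT => ?; apply: opp_continuous.
  - by rewrite -scaleN1r formZr mulN1r oppr_lt0.
have Kle z : Kc z -> form z b <= 0.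
  move=> Kz; rewrite leNgt; apply/negP => zb.
  have /connected_intervalP/(_ _ _ (ex_intro2 _ _ x0 x0K erefl)
    (ex_intro2 _ _ z Kz erefl) 0) := Kcon.
  case; first by rewrite !ltW.
  by move=> z' Kz' /eqP; apply/negP/Kneq.
have Cle z : chamber eta z -> form z b <= 0.
  have cl : closed [set z | form z b <= 0].
    apply: (closed_comp (f := form^~ b) (D := [set r : R | r <= 0])).
      by move=> ? _; apply: form_continuous.
    exact: closed_le.
  move=> Cz; have : [set z | chamber eta z] z by [].
  rewrite CE => /(closureS (Kle : Kc `<=` [set z | form z b <= 0])).
  by rewrite -((closure_id _).1 cl).
have [//|e e0 he] := @small_eps R _ (enum K) xpredT (fun k => pairing x (eta k))
  (fun k => pairing b (eta k)).
have := Cle (x + e *: b).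
rewrite formDl formZl perp // add0r leNgt => h.
have : ~~ (0 < e * form b b).
  apply: h => k; rewrite pairingDl pairingZl ltW // (he _ _ _ _ (ltW e0)) //.
  by rewrite mem_enum.
by rewrite mulr_gt0.
Qed.

Section MirrorFree.
Variables (K : finType) (k0 : K) (s : K -> gT) (eta : K -> 'rV[int]_2).
Variable c : 'rV[R]_2.
Hypothesis Ws : forall k, s k \in W.
Hypothesis rs : forall k, is_reflection R (rW (s k)).
Hypothesis fs : forall k, fixed_line R (rW (s k)) (eta k).
Hypothesis cU : forall k, pairing c (eta k) < 0.
Hypothesis mirror_free : forall t x, t \in W -> is_reflection R (rW t) ->
  (forall k, pairing x (eta k) < 0) -> act t x <> x.
Let U x := forall k, pairing x (eta k) < 0.

Lemma reflection_conj v w : v \in W -> w \in W -> is_reflection R (rW w) ->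
  is_reflection R (rW (v * w * v^-1)%g).
Proof.
move=> Wv Ww [a [b [a0 b0 wa wb]]].
have WV : v^-1%g \in W by rewrite groupV.
rewrite -/(act w a) in wa; rewrite -/(act w b) in wb.
exists (act v^-1%g a), (act v^-1%g b); rewrite -!/(act (v * w * v^-1)%g _).
have e z : act (v * w * v^-1)%g (act v^-1%g z) = act v^-1%g (act w z).
  by rewrite actM ?groupM // actM // actVK.
split.
- by apply: contra_neq a0; apply: act_eq0.
- by apply: contra_neq b0; apply: act_eq0.
- by rewrite e wa.
- by rewrite e wb -[in LHS]scaleN1r actZ scaleN1r.
Qed.

(** As no mirror meets U, moving inside U cannot bring the image under w across
    a wall: the crossing point would lie on a mirror conjugate to that wall. *)
Lemma chamber_image w y z : w \in W -> U y -> U (act w y) -> U z -> U (act w z).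
Proof.
move=> Ww yU wyU zU k; rewrite ltNge; apply/negP => wz.
have wy := wyU k; pose p := pairing (act w y) (eta k).
pose q := pairing (act w z) (eta k).
have qp : 0 < q - p by rewrite /q /p; lra.
pose r := - p / (q - p).
have r0 : 0 < r by rewrite divr_gt0 // oppr_gt0.
have r1 : r <= 1 by rewrite ler_pdivrMr // mul1r /q; lra.
pose x := y + r *: (z - y).
have xU : U x.
  move=> j; rewrite pairingDl pairingZl pairingBl.
  have aux (a b t : R) : a < 0 -> b < 0 -> 0 < t -> t <= 1 -> a + t * (b - a) < 0.
    by move=> *; nra.
  by apply: aux.
have wx : pairing (act w x) (eta k) = 0.
  rewrite actD actZ actB pairingDl pairingZl pairingBl -/p -/q.
  by rewrite divfK ?gt_eqF //; ring.
have Wt : (w * s k * w^-1)%g \in W by rewrite !groupM ?groupV.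
apply: (mirror_free Wt (reflection_conj Ww (Ws k) (rs k)) xU).
rewrite actM ?groupM ?groupV // actM // -[RHS](actKV rW x Ww); congr (act _ _).
exact/(fs k).
Qed.

(** An element mapping the open chamber U into itself fixes a vector of U, hence
    is 1 or a reflection whose mirror meets U. *)
Lemma mirror_free_strict w y : w \in W -> U y -> chamber eta (act w y) -> w = 1%g.
Proof.
move=> Ww yU wyC; have WV : w^-1%g \in W by rewrite groupV.
have [//|e e0 he] := @small_eps R _ (enum K) xpredT (fun k => pairing y (eta k))
  (fun k => pairing (act w^-1%g c) (eta k)).
pose y' := y + e *: act w^-1%g c.
have y'U : U y'.
  by move=> k; rewrite pairingDl pairingZl (he _ _ _ _ (ltW e0)) ?mem_enum.
have wy'U : U (act w y').
  move=> k; rewrite actD actZ actVK // pairingDl pairingZl.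
  by have := wyC k; have := cU k; nra.
have iterU g z : g \in <[w]>%g -> U z -> U (act g z).
  move=> /cycleP[i ->] zU; elim: i => [|i IHi]; first by rewrite act1.
  by rewrite expgSr actM ?groupX //; apply: (chamber_image Ww y'U wy'U).
pose f := \sum_(g in <[w]>%g) act g c.
have fU : U f.
  move=> k; rewrite pairing_suml -oppr_gt0 -sumrN (bigD1 1%g) ?group1 //= act1.
  rewrite ltr_pwDl ?oppr_gt0 // sumr_ge0 // => g /andP[gw _].
  by rewrite oppr_ge0 ltW // iterU.
have sub g : g \in <[w]>%g -> g \in W by apply/fintype.subsetP; rewrite cycle_subG.
have wf : act w f = f.
  have actS (r : seq gT) (p : pred gT) F :
      act w (\sum_(g <- r | p g) F g) = \sum_(g <- r | p g) act w (F g).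
    by elim/big_rec2: _ => [|i z1 z2 _ <-]; rewrite ?act0 ?actD.
  rewrite actS [RHS](reindex_inj (mulIg w)) /=.
  apply: eq_big => [g|g gw]; first by rewrite groupMr ?cycle_id.
  by rewrite actM //; apply: sub.
have [//|w1] := eqVneq w 1%g; exfalso.
have f0 : f != 0.
  by apply/eqP => f0; have := fU k0; rewrite f0 pairing0l ltxx.
have ff := form_gt0 rW f0.
pose a : R := form (delta_mx 0 0) f; pose b : R := form (delta_mx 0 1) f.
pose v : 'rV[R]_2 := b *: delta_mx 0 0 - a *: delta_mx 0 1.
have vf : form v f = 0 by rewrite formBl !formZl -/a -/b; ring.
have v0 : v != 0.
  apply/eqP => v0; move: ff; rewrite {1}[f]row2_delta formDl !formZl -/a -/b.
  have := congr1 (fun x : 'rV[R]_2 => x 0 0) v0; rewrite !mxE /= => bE.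
  have := congr1 (fun x : 'rV[R]_2 => x 0 1) v0; rewrite !mxE /= => aE.
  have -> : a = 0 by lra.
  have -> : b = 0 by lra.
  by rewrite !mulr0 addr0 ltxx.
have vv := form_gt0 rW v0.
have ind r : v <> r *: f.
  move=> vE; have := vf; rewrite vE formZl => /eqP; rewrite mulf_eq0.
  rewrite [form f f == 0]gt_eqF // orbF => /eqP r0.
  by move: v0; rewrite vE r0 scale0r eqxx.
have [p [q wv]] := span2 (act w v) f0 ind.
have p0 : p = 0.
  have := form_act rW v f Ww; rewrite wf vf wv formDl !formZl vf mulr0 addr0.
  by move/eqP; rewrite mulf_eq0 [form f f == 0]gt_eqF // orbF => /eqP.
rewrite p0 scale0r add0r in wv.
have : q ^+ 2 = 1.
  apply: (mulIf (lt0r_neq0 vv)); rewrite mul1r -[RHS](form_act rW v v Ww) wv.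
  by rewrite formZl formZr mulrA expr2.
move/eqP; rewrite sqrf_eq1 => /orP[/eqP q1|/eqP q1]; rewrite q1 in wv.
  case/eqP: w1; apply: (act_faithful hrW Ww) => x.
  have [p' [q' ->]] := span2 x f0 ind.
  by rewrite actD !actZ wf wv scale1r.
apply: (mirror_free Ww _ fU wf); exists f, v; split=> //.
by rewrite -scaleN1r.
Qed.

End MirrorFree.

End ChamberStrict.

Section Dihedral.
Variables (R : realType) (gT : finGroupType) (W : {group gT}).
Variable rW : mx_representation int W 2.
Hypothesis hrW : mx_faithful rW.
Variables (n : nat) (s1 s2 : gT) (eta1 eta2 : 'rV[int]_2).
Hypothesis n3 : (3 <= n)%N.
Hypothesis WE : W = <<[set s1; s2]%SET>>%g :> {set gT}.
Hypothesis cardW : #|W| = n.*2.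
Hypotheses (r1 : is_reflection R (rW s1)) (r2 : is_reflection R (rW s2)).
Hypotheses (p1 : primitive eta1) (p2 : primitive eta2).
Hypotheses (f1 : fixed_line R (rW s1) eta1) (f2 : fixed_line R (rW s2) eta2).

Let Ws1 : s1 \in W. Proof. by rewrite WE mem_gen // !inE eqxx. Qed.
Let Ws2 : s2 \in W. Proof. by rewrite WE mem_gen // !inE eqxx orbT. Qed.

(** Two reflections with the same mirror coincide, since both are the orthogonal
    one; the group they generate then has at most two elements. *)
Lemma dihedral_walls_independent : det2 eta1 eta2 != 0.
Proof.
apply/eqP => d0; have e1 := primitive_neq0 p1; have e2 := primitive_neq0 p2.
have f21 : fixed_line R (rW s2) eta1.
  move=> x; rewrite (f2 x); have := pairing_decomp x eta1 eta2.
  have := pairing_decomp x eta2 eta1; rewrite !pairing_dir det2C d0 oppr0 !mulr0 !addr0.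
  have N0 l : l != 0 -> (norm2 l)%:~R != 0 :> R.
    by move=> l0; rewrite intr_eq0 gt_eqF // norm2_gt0.
  move=> h2 h1; split=> h0.
    by apply/eqP; move/eqP: h2; rewrite h0 mul0r mulf_eq0 (negbTE (N0 _ e2)).
  by apply/eqP; move/eqP: h1; rewrite h0 mul0r mulf_eq0 (negbTE (N0 _ e1)).
have s12 : s1 = s2.
  apply/eqP; rewrite eq_mulgV1; apply/eqP; apply: (act_faithful hrW (R := R)).
    by rewrite groupM ?groupV.
  move=> x; rewrite actM ?groupV // (reflection_act x Ws1 r1 f1 e1).
  by rewrite -(reflection_act x Ws2 r2 f21 e1) actKV.
have sub : W \subset [set 1%g; s1]%SET.
  apply/fintype.subsetP => w; rewrite WE -s12 finset.setUid => ws.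
  have := cycle_invol (reflection_invol hrW Ws1 r1 f1 e1) (w := w).
  by rewrite !inE => /(_ ws)[->|->]; rewrite eqxx ?orbT.
have := subset_leq_card sub; rewrite cardW cards2.
by move: n3; case: (n) => [|[|[|k]]] //; case: (_ != _).
Qed.

Definition dihedral_wall (b : bool) := if b then eta1 else eta2.

Lemma dihedral_strict_chamber :
  is_chamber rW (@half_plane R eta1 `&` @half_plane R eta2) ->
  strict_chamber R rW (fun b : bool => if b then s1 else s2) dihedral_wall
    (fun b : bool => if b then (det2 eta2 eta1)%:~R^-1 *: dir rat eta2
                     else (det2 eta1 eta2)%:~R^-1 *: dir rat eta1).
Proof.
move=> CW; have d12 := dihedral_walls_independent.
have d21 : det2 eta2 eta1 != 0 by rewrite det2C oppr_eq0.
set s := fun b : bool => _; set u := fun b : bool => _.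
have Ws k : s k \in W by case: k.
have rs k : is_reflection R (rW (s k)) by case: k.
have fs k : fixed_line R (rW (s k)) (dihedral_wall k) by case: k.
have dual k j : pairing (u k) (dihedral_wall j) = (k == j)%:R.
  case: k; case: j; rewrite pairingZl pairing_dir ?det2ll ?mulr0 //.
    by rewrite mulVf // intr_eq0.
  by rewrite mulVf // intr_eq0.
split=> //; first by case.
- move=> x [] [] x0 //= ej ek; case/eqP: x0; apply: row2P; rewrite mxE.
  + have := pairing_cramer x eta1 eta2 (delta_mx 0 0).
    rewrite ej ek !mulr0 addr0 => /eqP; rewrite mulf_eq0 intr_eq0 (negbTE d12) /=.
    by rewrite pairing2 !mxE /= mulr1 mulr0 addr0 => /eqP.
  + have := pairing_cramer x eta1 eta2 (delta_mx 0 1).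
    rewrite ej ek !mulr0 addr0 => /eqP; rewrite mulf_eq0 intr_eq0 (negbTE d12) /=.
    by rewrite pairing2 !mxE /= mulr1 mulr0 add0r => /eqP.
  + have := pairing_cramer x eta1 eta2 (delta_mx 0 0).
    rewrite ej ek !mulr0 addr0 => /eqP; rewrite mulf_eq0 intr_eq0 (negbTE d12) /=.
    by rewrite pairing2 !mxE /= mulr1 mulr0 addr0 => /eqP.
  + have := pairing_cramer x eta1 eta2 (delta_mx 0 1).
    rewrite ej ek !mulr0 addr0 => /eqP; rewrite mulf_eq0 intr_eq0 (negbTE d12) /=.
    by rewrite pairing2 !mxE /= mulr1 mulr0 add0r => /eqP.
have CE : @half_plane R eta1 `&` @half_plane R eta2
    = [set x : 'rV[R]_2 | chamber dihedral_wall x].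
  apply/seteqP; split=> x; first by move=> [? ?] [].
  by move=> h; split; [apply: (h true) | apply: (h false)].
rewrite CE in CW; move=> w y Ww yU wC.
pose c : 'rV[R]_2 := - (map_mx ratr (u true) + map_mx ratr (u false)).
apply: (mirror_free_strict hrW true (c := c) Ws rs fs _ (chamber_mirror CW)) Ww yU wC.
by move=> k; rewrite pairingNl pairingDl !pairing_map !dual; case: k;
  rewrite /= ?rmorph0 ?rmorph1 ?addr0 ?add0r oppr_lt0.
Qed.

End Dihedral.

(** * The fundamental polygon *)

Section Fundamental.
Variables (R : realType) (gT : finGroupType) (W : {group gT}).
Variable rW : mx_representation int W 2.
Hypothesis hrW : mx_faithful rW.
Variables (K : finType) (s : K -> gT) (eta : K -> 'rV[int]_2) (u : K -> 'rV[rat]_2).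
Hypothesis C : strict_chamber R rW s eta u.
Variables (P : set 'rV[R]_2) (h : 'rV[int]_2 -> R).
Hypothesis H : polygonal (normals P) h P.
Hypothesis h_gt0 : forall l, l \in normals P -> 0 < h l.
Hypothesis WP : preserves rW P.
Implicit Types (x y z : 'rV[R]_2) (l : 'rV[int]_2) (v w g : gT).
Notation act := (act rW).
Notation dact := (dact rW).
Notation chamber := (@chamber R K eta).
Notation dominant := (@dominant R gT W rW K eta).
Notation n := (@Defs.normal R P).

Lemma act_preserve w x : w \in W -> P x -> P (act w x).
Proof. by move=> Ww; apply: lact_preserve; apply: WP. Qed.

Lemma dact_normals w l : w \in W -> l \in normals P -> dact w l \in normals P.
Proof. by move=> Ww; apply: normals_dual; [apply: repr_mx_unit | apply: WP]. Qed.

Lemma h_dact w l : w \in W -> l \in normals P -> h (dact w l) = h l.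
Proof.
have le w' l' : w' \in W -> l' \in normals P -> h l' <= h (dact w' l').
  move=> Ww lP; have [z [Pz <- _]] := pg_edge_in H lP.
  rewrite -(pairing_act rW _ _ Ww).
  by have /(pg_mem H) := act_preserve Ww Pz; apply; apply: dact_normals.
move=> Ww lP; apply/eqP; rewrite eq_le le // andbT.
rewrite -{2}[l](dactKV R rW _ Ww); apply: le; first by rewrite groupV.
exact: dact_normals.
Qed.

Section FundamentalPolygon.
Variable Q : set 'rV[R]_2.
Hypothesis QE : forall x, Q x <-> P x /\ chamber x.

Definition wall_normals := [seq eta k | k <- enum K].
Definition fund_normals := [seq l <- normals P | dominant l] ++ wall_normals.
Definition fund_height l : R := if l \in wall_normals then 0 else h l.

Lemma eta_wall k : eta k \in wall_normals.
Proof. by apply: map_f; rewrite mem_enum. Qed.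

Lemma wall_normalsP l : reflect (exists k, l = eta k) (l \in wall_normals).
Proof.
by apply: (iffP mapP) => [[k _ ->]|[k ->]]; exists k; rewrite ?mem_enum.
Qed.

Lemma dominant_notin_walls l : dominant l -> l \notin wall_normals.
Proof.
move=> dl; apply/negP => /wall_normalsP[k e].
by move: dl; rewrite e (negbTE (wall_not_dominant C k)).
Qed.

Lemma fund_height_dominant l : dominant l -> fund_height l = h l.
Proof. by rewrite /fund_height => /dominant_notin_walls/negbTE ->. Qed.

Lemma fund_height_wall k : fund_height (eta k) = 0.
Proof. by rewrite /fund_height eta_wall. Qed.

Lemma fund_normalsP l : reflect
  ((l \in normals P /\ dominant l) \/ exists k, l = eta k) (l \in fund_normals).
Proof.
rewrite mem_cat mem_filter andbC.
by apply: (iffP orP) => -[/andP|/wall_normalsP]; [left|right|left|right].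
Qed.

Lemma eta_inj : injective eta.
Proof.
move=> j k e; have := wall_dual C j j; rewrite e (wall_dual C) eqxx.
by case: (j =P k) => // _ /eqP; rewrite eq_sym oner_eq0.
Qed.

(** Q is cut out by the dominant edges of P and the walls: over the chamber,
    a dominant normal exceeds all others of its orbit. *)
Lemma fund_polygonal : polygonal fund_normals fund_height Q.
Proof.
apply: polygonal_intro.
- move=> x; rewrite QE; split=> [[Px xC] l /fund_normalsP[[lP ld]|[k ->]]|xQ].
  + by rewrite fund_height_dominant //; have /(pg_mem H) := Px; apply.
  + by rewrite fund_height_wall.
  have xC : chamber x.
    by move=> k; rewrite -(fund_height_wall k) xQ //; apply/fund_normalsP; right; exists k.
  split=> //; apply/(pg_mem H) => l lP.
  have [w Ww ld] := dominant_orbit C l.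
  have wP := dact_normals Ww lP.
  rewrite -[l](dactKV R rW _ Ww).
  apply: (@le_trans _ _ (pairing x (dact w l))).
    by apply: (dominant_max hrW C) => //; rewrite groupV.
  rewrite h_dact ?groupV // -fund_height_dominant //.
  by apply: xQ; apply/fund_normalsP; left.
- move=> l /fund_normalsP[[lP _]|[k ->]]; first exact: (pg_primitive H).
  exact: wall_primitive C k.
- have [M [Mr hM]] := pg_bounded H; exists M; split=> // r Mr' x /QE[Px _].
  exact: hM.
- have [l lP _|e e0 he] := @small_eps R _ (normals P) xpredT (fun l => - h l)
    (fun l => pairing (chamber_center R u) l); first by rewrite oppr_lt0 h_gt0.
  exists (e *: chamber_center R u) => l /fund_normalsP[[lP ld]|[k ->]].
    rewrite fund_height_dominant // pairingZl.
    by have /= := he l e lP isT (ltW e0) (lexx _); lra.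
  by rewrite fund_height_wall pairingZl (chamber_centerE C) mulrN1 oppr_lt0.
- move=> l /fund_normalsP[[lP ld]|[k ->]]; last first.
    have [l' l'P _|e e0 he] := @small_eps R _ (normals P) xpredT (fun l => - h l)
      (fun l => pairing (map_mx ratr (u k)) l); first by rewrite oppr_lt0 h_gt0.
    exists (e *: map_mx ratr (u k)).
      by rewrite fund_height_wall pairingZl pairing_map (wall_dual C) eqxx rmorph1 mulr1.
    move=> l' /fund_normalsP[[l'P l'd] _|[j ->] jk].
      rewrite fund_height_dominant // pairingZl.
      by have /= := he l' e l'P isT (ltW e0) (lexx _); lra.
    rewrite fund_height_wall pairingZl pairing_map (wall_dual C).
    by rewrite (inj_eq eta_inj) eq_sym in jk; rewrite (negbTE jk) rmorph0 mulr0.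
  have [z [Pz zl zs]] := pg_edge_in H lP.
  have [w Ww wC] := chamber_orbit C z.
  have wl : dact w l = l.
    have /(pg_mem H)/(_ l lP) := act_preserve Ww Pz.
    have := dominant_max hrW C ld wC Ww; rewrite pairing_act // zl => h1 h2.
    have e : pairing (act w z) l = h l by apply/eqP; rewrite eq_le h2.
    move: e; rewrite -[in LHS](dactVK R rW l Ww) pairing_act // => e.
    have VP : dact w^-1%g l \in normals P by rewrite dact_normals ?groupV.
    have [wV|wV] := eqVneq (dact w^-1%g l) l; first by rewrite -{1}wV dactVK.
    by have := zs _ VP wV; rewrite e h_dact ?groupV // ltxx.
  have zs' l' : l' \in normals P -> l' != l -> pairing (act w z) l' < h l'.
    move=> l'P ll'; rewrite -[in X in pairing _ X](dactVK R rW l' Ww) pairing_act //.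
    rewrite -(@h_dact w^-1%g) ?groupV //; apply: zs.
      by rewrite dact_normals ?groupV.
    by apply: contra ll' => /eqP e; rewrite -[l'](dactVK R rW _ Ww) e wl.
  have [|e e0 he] := @small_eps R _ (normals P) (predC1 l)
    (fun l' => pairing (act w z) l' - h l') (fun l' => pairing (act w z) l').
    by move=> l' l'P /= ll'; rewrite subr_lt0 zs'.
  exists ((1 + e) *: act w z).
    rewrite fund_height_dominant // pairingZl -{2}wl pairing_act // zl.
    by rewrite mulrDl mul1r ltrDl mulr_gt0 ?h_gt0.
  move=> l' /fund_normalsP[[l'P l'd] ll'|[k ->] _].
    rewrite fund_height_dominant // pairingZl.
    by have /= := he l' e l'P ll' (ltW e0) (lexx _); lra.
  rewrite fund_height_wall pairingZl mulr_ge0_le0 ?wC //.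
  by rewrite addr_ge0 // ltW.
Qed.

End FundamentalPolygon.

(** * Edges near the chamber *)

Implicit Types i j d : 'I_(nedges P).

Definition eperm w i : 'I_(nedges P) := edge_perm (rW w) i.

Lemma normal_eperm w i : w \in W -> n (eperm w i) = dact w (n i).
Proof.
by move=> Ww; apply: normal_edge_perm; [apply: repr_mx_unit | apply: WP].
Qed.

Lemma eperm1 i : eperm 1%g i = i.
Proof. by apply: normal_inj; rewrite normal_eperm ?group1 // (dact1 R). Qed.

Lemma epermM v w i : v \in W -> w \in W -> eperm (v * w)%g i = eperm w (eperm v i).
Proof.
by move=> Wv Ww; apply: normal_inj; rewrite !normal_eperm ?groupM // (dactM R).
Qed.

Lemma epermKV w i : w \in W -> eperm w^-1%g (eperm w i) = i.
Proof. by move=> Ww; rewrite -epermM ?groupV // mulgV eperm1. Qed.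

Lemma epermVK w i : w \in W -> eperm w (eperm w^-1%g i) = i.
Proof. by move=> Ww; rewrite -epermM ?groupV // mulVg eperm1. Qed.

Lemma eperm_inj w : w \in W -> injective (eperm w).
Proof. by move=> Ww; apply: (can_inj (fun i => epermKV i Ww)). Qed.

Lemma edge_act w i x : w \in W -> edge i x -> edge (eperm w i) (act w x).
Proof.
move=> Ww /(edgeP H)[Px xi]; apply/(edgeP H); split; first exact: act_preserve.
by rewrite normal_eperm // pairing_act // h_dact // mem_normal.
Qed.

Lemma edge_neq0 i x : edge i x -> x != 0.
Proof.
move=> /(edgeP H)[_ xi]; apply/eqP => x0; move: xi; rewrite x0 pairing0l.
by move=> e; have := h_gt0 (mem_normal i); rewrite -e ltxx.
Qed.

(** At a point of the chamber a dominant normal is at least as large as the other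
    normals of its orbit, which have the same height. *)
Lemma edge_dominant w i x : w \in W -> dominant (n i) -> chamber x ->
  edge (eperm w i) x -> edge i x.
Proof.
move=> Ww id xC /(edgeP H)[Px]; rewrite normal_eperm // h_dact ?mem_normal // => e.
apply/(edgeP H); split=> //; apply/eqP; rewrite eq_le.
have /(pg_memi H) -> := Px; rewrite /= -e.
exact: (dominant_max hrW C).
Qed.

(** Every point of a dominant edge can be brought into the chamber by an
    element preserving the edge: first for points of its relative interior,
    then for its ends by passage to the limit. *)
Lemma dominant_edge_chamber i x : dominant (n i) -> edge i x ->
  exists w, [/\ w \in W, eperm w i = i & chamber (act w x)].
Proof.
move=> id xi; apply: contrapT => hn.
have [z [zi zs]] := pg_edgei H i.
pose pos (p : gT * K) := 0 < pairing (act p.1 x) (eta p.2).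
have [p _|e e0 he] := @small_eps R _ (enum ({: gT * K})) pos
  (fun p => - pairing (act p.1 x) (eta p.2))
  (fun p => - pairing (act p.1 (z - x)) (eta p.2)).
  by rewrite /pos oppr_lt0.
pose t := Num.min e (2^-1).
have t0 : 0 < t by rewrite lt_min e0 invr_gt0 ltr0n.
have te : t <= e by rewrite ge_min lexx.
have t1 : t <= 2^-1 by rewrite ge_min lexx orbT.
pose zt := x + t *: (z - x).
have /(edgeP H)[Px xi'] := xi; have /(edgeP H)[Pz zi'] := zi.
have zts j : j != i -> pairing zt (n j) < h (n j).
  move=> ji; rewrite pairingDl pairingZl pairingBl.
  have aux (a b c d : R) : 0 < a -> a <= 2^-1 -> b <= d -> c < d ->
    b + a * (c - b) < d by move=> *; nra.
  by apply: aux => //; [have /(pg_memi H) := Px | apply: zs].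
have zti : edge i zt.
  have eq_i : pairing zt (n i) = h (n i).
    by rewrite pairingDl pairingZl pairingBl xi' zi' subrr mulr0 addr0.
  apply/(edgeP H); split=> //; apply/(pg_memi H) => j.
  by have [->|ji] := eqVneq j i; [rewrite eq_i | apply/ltW/zts].
have [w Ww wC] := chamber_orbit C zt.
have wi : eperm w i = i.
  have /(edge_act (groupVr Ww)) : edge i (act w zt).
    by apply: (edge_dominant Ww) => //; apply: edge_act.
  rewrite actKV // => /(edgeP H)[_ e'].
  have [wi|wi] := eqVneq (eperm w^-1%g i) i; first by rewrite -{1}wi epermVK.
  by have := zts _ wi; rewrite e' ltxx.
apply: hn; exists w; split=> // k; rewrite leNgt; apply/negP => kp.
have /= := he (w, k) t; rewrite mem_enum => /(_ isT kp (ltW t0) te).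
have := wC k; rewrite /zt actD actZ pairingDl pairingZl; lra.
Qed.

(** A nontrivial stabilizer is generated by a wall reflection, and the edge then
    crosses that wall orthogonally, on the side of the origin where the chamber
    is. *)
Lemma dominant_edge_stab i w : w \in W -> dominant (n i) -> eperm w i = i ->
  w = 1%g \/ exists2 k, w = s k &
    exists x, [/\ edge i x, chamber x & pairing x (eta k) = 0].
Proof.
move=> Ww id wi.
have wn : dact w (n i) = n i by rewrite -normal_eperm // wi.
have [|[k wk sk]] := dominant_stab hrW C Ww id (normal_neq0 H i) wn; first by left.
right; exists k => //; have [p [pi _]] := pg_edgei H i.
(* The midpoint of p and its mirror image is a multiple of sharp (n i). *)
have wpi : edge i (act w p) by rewrite -{1}wi; apply: edge_act.
pose x := 2^-1 *: (p + act w p).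
have /(edgeP H)[Pp pn] := pi; have /(edgeP H)[Pwp wpn] := wpi.
have xi : pairing x (n i) = h (n i).
  by rewrite pairingZl pairingDl pn wpn; lra.
have xk : pairing x (eta k) = 0.
  by rewrite pairingZl pairingDl wk (pairing_wall_act C) subrr mulr0.
exists x; split=> //.
  apply/(edgeP H); split=> //; apply/(pg_memi H) => j.
  have /(pg_memi H)/(_ j) := Pp; have /(pg_memi H)/(_ j) := Pwp.
  by rewrite pairingZl pairingDl; lra.
have e0 := wall_neq0 C k.
have [a xa] := pairing_eq0_dir e0 xk; have [b sb] := pairing_eq0_dir e0 sk.
have ni0 := normal_neq0 H i.
have b0 : b != 0.
  by apply: contra_neq (sharp_neq0 R rW ni0) => b0; rewrite sb b0 scale0r.
have xs : x = (a / b) *: sharp R rW (n i) by rewrite sb scalerA divfK.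
have ab : 0 < a / b.
  have := h_gt0 (mem_normal i); rewrite -xi xs pairingZl pmulr_lgt0 //.
  exact: pairing_sharp_gt0.
move/dominantP: id => id j; rewrite xs pairingZl; have := id j.
by move=> ?; rewrite mulr_ge0_le0 // ltW.
Qed.

(** A common point of edges in the two orbits can be moved into the chamber,
    where edge_dominant puts it on both dominant edges. *)
Lemma dominant_disjoint i j v w : v \in W -> w \in W ->
  dominant (n i) -> dominant (n j) ->
  (forall x, edge i x -> edge j x -> ~ chamber x) ->
  ~~ touch (eperm v i) (eperm w j).
Proof.
move=> Wv Ww id jd hn; apply/negP => /asboolP[x [xi xj]].
have [g Wg gC] := chamber_orbit C x; apply: (hn (act g x)) => //.
  apply: (@edge_dominant (v * g)%g); rewrite ?groupM // epermM //.
  exact: edge_act.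
apply: (@edge_dominant (w * g)%g); rewrite ?groupM // epermM //.
exact: edge_act.
Qed.

Lemma pairing_dual_wall (k j : K) l : j != k ->
  pairing (u k) (dact (s j) l) = pairing (u k) l.
Proof.
move=> jk; apply: (fmorph_inj (@ratr R)); rewrite -!pairing_map.
rewrite pairing_dact ?(wall_in C) // (wallV hrW C) (wall_fix C) //.
by rewrite pairing_map (wall_dual C) eq_sym (negbTE jk) rmorph0.
Qed.

(** Up to the stabilizer of i, a common point of i and j lies in the chamber, so
    that the dominant representative d of j passes through it. By three_edges d
    is j, or it is i and then j is the image of i under a reflection in a wall
    through that point. The wall k is excluded, and the others fix u k. *)
Lemma dominant_neighbour i j d k w : dominant (n i) ->
  (forall x, edge i x -> chamber x -> pairing x (eta k) <> 0) ->
  i != j -> touch i j -> w \in W -> d = eperm w j -> dominant (n d) ->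
  pairing (u k) (n d) = pairing (u k) (n j).
Proof.
move=> id hk ij /asboolP[p [pi pj]] Ww dE dd.
have stab g : g \in W -> eperm g i = i ->
    forall l, pairing (u k) (dact g l) = pairing (u k) l.
  move=> Wg gi l; have [->|[k' -> [x [xi xC xk]]]] := dominant_edge_stab Wg id gi.
    by rewrite (dact1 R).
  by apply: pairing_dual_wall; apply: contra_notN (hk x xi xC) => /eqP <-.
have [g [Wg gi gC]] := dominant_edge_chamber id pi.
rewrite -[RHS](stab g Wg gi) -normal_eperm //.
have {}dE : d = eperm (g^-1 * w)%g (eperm g j).
  by rewrite epermM ?groupV // epermKV.
have {}Ww : (g^-1 * w)%g \in W by rewrite groupM ?groupV.
have {}ij : i != eperm g j by rewrite -gi (inj_eq (eperm_inj Wg)).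
have {}pj := edge_act Wg pj; have {}pi := edge_act Wg pi; rewrite gi in pi.
move: (eperm g j) (act g p) (g^-1 * w)%g pi pj gC ij dE Ww => {}j {}p {}w.
move=> pi pj pC ij dE Ww {g Wg gi}.
have pd : edge d p.
  apply: (@edge_dominant w^-1%g) => //; first by rewrite groupV.
  by rewrite dE epermKV.
have [->//|dj] := eqVneq d j.
have di : d = i.
  apply/eqP; apply: contraT => di.
  by case: (three_edges H ij _ _ pi pj pd) => //; rewrite eq_sym.
rewrite di in dE *.
have wpi : edge i (act w p) by rewrite dE; apply: edge_act.
have [g [Wg gi gC]] := dominant_edge_chamber id wpi.
rewrite -actM // in gC.
have wgp := chamber_fixed hrW C (groupM Ww Wg) pC gC.
have wgj : dact (w * g)%g (n j) = n i.
  by rewrite -normal_eperm ?groupM // epermM // -dE gi.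
have [wg1|[k' wgs pk']] := chamber_stab hrW C (groupM Ww Wg) pC (edge_neq0 pi) wgp.
  move: wgj; rewrite wg1 (dact1 R) => /normal_inj e.
  by rewrite e eqxx in ij.
have k'k : k' != k by apply: contra_notN (hk p pi pC) => /eqP <-.
by rewrite -wgj wgs pairing_dual_wall.
Qed.

End Fundamental.

(** * The comparison map *)

Section CohAction.
Variables (R : realType) (P : set 'rV[R]_2) (A : 'M[int]_2).
Hypotheses (uA : A \in unitmx) (AP : lact A @` P = P).

Definition coh_actm of A \in unitmx & lact A @` P = P := @coh_act R P A.

HB.instance Definition _ := GRing.isZmodMorphism.Build (cohomology P) (cohomology P)
  (coh_actm uA AP) (coh_act_zmod_morphism uA AP).
HB.instance Definition _ := GRing.isMonoidMorphism.Build (cohomology P) (cohomology P)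
  (coh_actm uA AP) (coh_act_monoid_morphism uA AP).

Lemma coh_act_coh_pi p : coh_actm uA AP (coh_pi P p) = coh_pi P (edge_ring_act A p).
Proof. by rewrite !coh_piP; apply: coh_act_pi. Qed.

Lemma coh_act_const c : coh_actm uA AP (coh_const P c) = coh_const P c.
Proof. by rewrite coh_constE coh_act_coh_pi /edge_ring_act mmapC. Qed.

Lemma coh_act_edge i : coh_actm uA AP (coh_edge i) = coh_edge (edge_perm A i).
Proof. by rewrite /coh_edge coh_act_coh_pi [edge_ring_act _ _]edge_ring_act_var. Qed.

End CohAction.

Section Comparison.
Variables (R : realType) (gT : finGroupType) (W : {group gT}).
Variable rW : mx_representation int W 2.
Hypothesis hrW : mx_faithful rW.
Variables (K : finType) (s : K -> gT) (eta : K -> 'rV[int]_2) (u : K -> 'rV[rat]_2).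
Hypothesis C : strict_chamber R rW s eta u.
Variables (P : set 'rV[R]_2) (h : 'rV[int]_2 -> R).
Hypothesis H : polygonal (normals P) h P.
Hypothesis h_gt0 : forall l, l \in normals P -> 0 < h l.
Hypothesis WP : preserves rW P.
Variable Q : set 'rV[R]_2.
Hypothesis QE : forall x, Q x <-> P x /\ chamber eta x.
Notation act := (act rW).
Notation dact := (dact rW).
Notation chamber := (@chamber R K eta).
Notation dominant := (@dominant R gT W rW K eta).
Notation eperm := (@eperm R gT W rW P).
Notation nP := (@Defs.normal R P).
Notation nQ := (@Defs.normal R Q).
Notation X := (@coh_edge R P).
Notation kap := (coh_const P).
Implicit Types (i j : 'I_(nedges P)) (a b : 'I_(nedges Q)) (v w g : gT).

Let HQ0 := fund_polygonal hrW C H h_gt0 WP QE.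
Let HQ := pg_self HQ0.

Lemma nQP a : (nQ a \in normals P /\ dominant (nQ a)) \/ exists k, nQ a = eta k.
Proof. by apply/fund_normalsP; rewrite -(pg_normals HQ0) mem_normal. Qed.

Lemma wall_index k : exists a, nQ a = eta k.
Proof.
have : eta k \in normals Q.
  by rewrite (pg_normals HQ0); apply/fund_normalsP; right; exists k.
by move=> /normalsP[a ->]; exists a.
Qed.

Lemma dominant_index i : dominant (nP i) -> exists a, nQ a = nP i.
Proof.
move=> id; have : nP i \in normals Q.
  by rewrite (pg_normals HQ0); apply/fund_normalsP; left; rewrite mem_normal.
by move=> /normalsP[a ->]; exists a.
Qed.

Lemma dominant_edge a : dominant (nQ a) -> exists i, nP i = nQ a.
Proof.
move=> ad; have [[/normalsP[i ->] _]|[k e]] := nQP a; first by exists i.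
by move: ad; rewrite e (negbTE (wall_not_dominant C k)).
Qed.

Lemma dom_exists j : exists a, dominant (nQ a) /\ exists2 w, w \in W & nQ a = dact w (nP j).
Proof.
have [w Ww jd] := dominant_orbit C (nP j).
rewrite -normal_eperm // in jd; have [a e] := dominant_index jd.
by exists a; rewrite e; split=> //; exists w; rewrite ?normal_eperm.
Qed.

(** The edge of Q representing the orbit of an edge of P. *)
Definition dom j : 'I_(nedges Q) := projT1 (cid (dom_exists j)).

Lemma dom_dominant j : dominant (nQ (dom j)).
Proof. by have [] := projT2 (cid (dom_exists j)). Qed.

Lemma dom_orbit j : exists2 w, w \in W & nQ (dom j) = dact w (nP j).
Proof. by have [] := projT2 (cid (dom_exists j)). Qed.

Lemma dom_uniq j a w : w \in W -> dominant (nQ a) -> nQ a = dact w (nP j) -> dom j = a.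
Proof.
move=> Ww ad aE; have [v Wv dE] := dom_orbit j.
apply: normal_inj; have dd := dom_dominant j.
have e : nQ a = dact (v^-1 * w)%g (nQ (dom j)).
  by rewrite aE dE (dactM R) ?groupV // (dactKV R).
rewrite e (dominant_uniq hrW C) ?groupM ?groupV //.
by rewrite -e.
Qed.

Lemma dom_eperm w j : w \in W -> dom (eperm w j) = dom j.
Proof.
move=> Ww; have [v Wv dE] := dom_orbit j.
apply: (@dom_uniq _ _ (w^-1 * v)%g); rewrite ?groupM ?groupV ?dom_dominant //.
by rewrite dE (dactM R) ?groupV // normal_eperm // (dactKV R).
Qed.

Lemma dom_eq a j : dom j = a -> exists i w,
  [/\ w \in W, dominant (nP i), nP i = nQ a & j = eperm w i].
Proof.
move=> <-; have [w Ww e] := dom_orbit j; exists (eperm w j), w^-1%g.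
rewrite groupV normal_eperm // -e dom_dominant; split=> //.
by rewrite (epermKV WP).
Qed.

Lemma dom_self i a : dominant (nP i) -> nP i = nQ a -> dom i = a.
Proof. by move=> id e; apply: (@dom_uniq _ _ 1%g); rewrite ?group1 -?e ?(dact1 R). Qed.

(** The classes on P attached to the edges of Q, through their coefficients: the
    orbit sum for a dominant edge, and for a wall the combination of orbit sums
    dictated by the linear relation of the dual vector. *)
Definition cmp_coef a j : rat := (dom j == a)%:R
  - \sum_k (nQ a == eta k)%:R * pairing (u k) (nQ (dom j)).

Lemma sum_wall (F : 'I_(nedges Q) -> rat) k a : nQ a = eta k ->
  \sum_b (nQ b == eta k)%:R * F b = F a.
Proof.
move=> ak; rewrite (bigD1 a) //= ak eqxx mul1r big1 ?addr0 // => b ba.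
by rewrite -ak (inj_eq (@normal_inj R Q)) (negbTE ba) mul0r.
Qed.

Lemma cmp_coef_dominant a j : dominant (nQ a) -> cmp_coef a j = (dom j == a)%:R.
Proof.
move=> ad; rewrite /cmp_coef big1 ?subr0 // => k _.
case: eqP => [e|_]; last by rewrite mul0r.
by move: ad; rewrite e (negbTE (wall_not_dominant C k)).
Qed.

Lemma cmp_coef_wall a k j : nQ a = eta k ->
  cmp_coef a j = - pairing (u k) (nQ (dom j)).
Proof.
move=> ak; rewrite /cmp_coef; case: eqP => [da|_].
  by have := dom_dominant j; rewrite da ak (negbTE (wall_not_dominant C k)).
rewrite sub0r (bigD1 k) //= ak eqxx mul1r big1 ?addr0 // => k' k'k.
by rewrite (inj_eq (eta_inj C)) eq_sym (negbTE k'k) mul0r.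
Qed.

Lemma cmp_coef_eperm a w j : w \in W -> cmp_coef a (eperm w j) = cmp_coef a j.
Proof. by move=> Ww; rewrite /cmp_coef dom_eperm. Qed.

Lemma sum_cmp_coef (F : 'I_(nedges Q) -> rat) (Fw : K -> rat) j :
  (forall a k, nQ a = eta k -> F a = Fw k) ->
  \sum_a F a * cmp_coef a j
    = F (dom j) - \sum_k Fw k * pairing (u k) (nQ (dom j)).
Proof.
move=> Fk; under eq_bigr do rewrite mulrBr mulr_sumr.
rewrite sumrB (bigD1 (dom j)) //= eqxx mulr1 big1 ?addr0 => [|a aj]; last first.
  by rewrite eq_sym (negbTE aj) mulr0.
congr (_ - _); rewrite exchange_big; apply: eq_bigr => k _ /=.
have [a ak] := wall_index k.
under eq_bigr do rewrite mulrCA.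
by rewrite (@sum_wall _ k a ak) (Fk _ _ ak).
Qed.

(** A vector on all walls pairs equally with all normals of an orbit, as it and
    its opposite both lie in the chamber. *)
Lemma pairing_dom (v : 'rV[rat]_2) j : (forall k, pairing v (eta k) = 0) ->
  pairing v (nQ (dom j)) = pairing v (nP j).
Proof.
move=> v0; have [w Ww e] := dom_orbit j.
have dd := dom_dominant j; rewrite -[nP j](dactKV R rW _ Ww) -e.
apply: (fmorph_inj (@ratr R)); rewrite -!pairing_map.
have vk k : pairing (map_mx ratr v : 'rV[R]_2) (eta k) = 0.
  by rewrite pairing_map v0 rmorph0.
have WV : w^-1%g \in W by rewrite groupV.
apply/eqP; rewrite eq_le; apply/andP; split; last first.
  by apply: (dominant_max hrW C) => // k; rewrite vk.
rewrite -lerN2 -!pairingNl; apply: (dominant_max hrW C) => // k.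
by rewrite pairingNl vk oppr0.
Qed.

(** On P, the relation of v becomes the relation of the projection of v onto the
    intersection of the walls along the u k. *)
Lemma cmp_coef_lin (v : 'rV[rat]_2) : exists v' : 'rV[rat]_2,
  forall j, \sum_a pairing v (nQ a) * cmp_coef a j = pairing v' (nP j).
Proof.
exists (v - \sum_k pairing v (eta k) *: u k) => j.
rewrite -pairing_dom => [|k].
  rewrite (@sum_cmp_coef _ (fun k => pairing v (eta k))) => [|a k -> //].
  rewrite pairingBl pairing_suml; congr (_ - _).
  by apply: eq_bigr => k _; rewrite pairingZl.
rewrite pairingBl pairing_suml (bigD1 k) //= pairingZl (wall_dual C) eqxx mulr1.
rewrite big1 ?addr0 ?subrr // => k' k'k.
by rewrite pairingZl (wall_dual C) (negbTE k'k) mulr0.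
Qed.

Definition cmp_poly a : mpoly (nedges P) rat :=
  \sum_j mpolyC (nedges P) (cmp_coef a j) * mvar j.

Definition cmp_class a : cohomology P := coh_pi P (cmp_poly a).
Notation Y := cmp_class.

Lemma cmp_classE a : Y a = \sum_j kap (cmp_coef a j) * X j.
Proof.
rewrite /Y rmorph_sum; apply: eq_bigr => j _.
by rewrite rmorphM /= -coh_constE.
Qed.

Lemma cmp_dominantE a : dominant (nQ a) -> Y a = \sum_(j | dom j == a) X j.
Proof.
move=> ad; rewrite cmp_classE [RHS]big_mkcond; apply: eq_bigr => j _.
by rewrite cmp_coef_dominant //; case: eqP => _; rewrite ?rmorph1 ?mul1r ?rmorph0 ?mul0r.
Qed.

Lemma cmp_class_lin (v : 'rV[rat]_2) : \sum_a kap (pairing v (nQ a)) * Y a = 0.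
Proof.
have [v' hv] := cmp_coef_lin v.
rewrite -[RHS](coh_lin P v').
under eq_bigr do rewrite cmp_classE mulr_sumr.
rewrite exchange_big; apply: eq_bigr => j _ /=.
under eq_bigr do rewrite mulrA -rmorphM.
by rewrite -mulr_suml -rmorph_sum hv.
Qed.

Notation cact Ww := (coh_actm (repr_mx_unit rW Ww) (WP Ww)).

Lemma cact_edge w (Ww : w \in W) j : cact Ww (X j) = X (eperm w j).
Proof. exact: coh_act_edge. Qed.

Lemma cact_class w (Ww : w \in W) a : cact Ww (Y a) = Y a.
Proof.
rewrite cmp_classE rmorph_sum [RHS](reindex_inj (eperm_inj WP Ww)) /=.
apply: eq_bigr => j _; rewrite rmorphM /= coh_act_const cact_edge.
by rewrite cmp_coef_eperm.
Qed.

Lemma cmp_disjoint_dominant a b : dominant (nQ a) -> dominant (nQ b) -> a != b ->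
  ~~ touch a b -> Y a * Y b = 0.
Proof.
move=> ad bd ab ntab; rewrite !cmp_dominantE // big_distrlr /=.
rewrite big1 // => j /eqP ja; rewrite big1 // => j' /eqP jb.
apply: coh_disjoint; first by apply: contra ab => /eqP e; rewrite -ja e jb.
have [i [w [Ww id ia ->]]] := dom_eq ja; have [i' [w' [Ww' id' ib ->]]] := dom_eq jb.
apply: (dominant_disjoint hrW C H WP) => // x /(edgeP H)[Px xi] /(edgeP H)[_ xi'] xC.
move/asboolP: ntab; apply; have Qx : Q x by apply/QE.
exists x; split; apply/(edgeP HQ); split=> //.
  by rewrite -ia (fund_height_dominant C).
by rewrite -ib (fund_height_dominant C).
Qed.

(** Up to sign, the product of the wall class with a dominant edge is that of the
    linear relation of u k: by dominant_neighbour, the coefficients only differ at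
    edges that are disjoint from the dominant edge. *)
Lemma cmp_disjoint_wall a b k : dominant (nQ a) -> nQ b = eta k ->
  ~~ touch a b -> Y a * Y b = 0.
Proof.
move=> ad bk ntab; have [i ia] := dominant_edge ad.
have id : dominant (nP i) by rewrite ia.
have far x : edge i x -> chamber x -> pairing x (eta k) <> 0.
  move=> /(edgeP H)[Px xi] xC xk; move/asboolP: ntab; apply.
  have Qx : Q x by apply/QE.
  exists x; split; apply/(edgeP HQ); split=> //.
    by rewrite -ia (fund_height_dominant C).
  by rewrite bk (fund_height_wall eta h).
suff Xi : X i * Y b = 0.
  rewrite cmp_dominantE // mulr_suml big1 // => j /eqP ja.
  have [i' [w [Ww _ ia' ->]]] := dom_eq ja.
  have -> : i' = i by apply: normal_inj; rewrite ia'.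
  by rewrite -(cact_edge Ww) -(cact_class Ww) -rmorphM /= Xi rmorph0.
transitivity (- (X i * \sum_j kap (pairing (u k) (nP j)) * X j)); last first.
  by rewrite (coh_lin P) mulr0 oppr0.
rewrite cmp_classE !mulr_sumr -sumrN; apply: eq_bigr => j _.
rewrite (cmp_coef_wall _ bk) rmorphN mulNr mulrN; congr (- _).
rewrite mulrCA [RHS]mulrCA; have [->|ij] := eqVneq j i.
  by rewrite (dom_self id ia) -ia.
have [m|m] := boolP (touch i j); last first.
  by rewrite coh_disjoint ?mulr0 // eq_sym.
have [w Ww e] := dom_orbit j.
have [d de] := dominant_edge (dom_dominant j).
rewrite -de (@dominant_neighbour _ _ _ _ hrW _ _ _ _ C _ _ H h_gt0 WP i j d k w) //.
- by rewrite eq_sym.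
- by apply: normal_inj; rewrite normal_eperm // -e.
- by rewrite de dom_dominant.
Qed.

Lemma cmp_disjoint a b : a != b -> ~~ touch a b -> Y a * Y b = 0.
Proof.
move=> ab ntab.
have [[_ ad]|[k ak]] := nQP a; have [[_ bd]|[k' bk]] := nQP b.
- exact: cmp_disjoint_dominant.
- exact: cmp_disjoint_wall bk ntab.
- by rewrite mulrC; apply: cmp_disjoint_wall ak _; rewrite // touchC.
case/negP: ntab; apply/asboolP; exists 0.
have Q0 : Q 0.
  apply/QE; split; last by move=> j; rewrite pairing0l.
  by apply/(pg_mem H) => l lP; rewrite pairing0l ltW // h_gt0.
split; apply/(edgeP HQ); rewrite pairing0l ?ak ?bk;
  by rewrite (fund_height_wall eta h).
Qed.

Lemma cmp_deg3 a b c : Y a * Y b * Y c = 0.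
Proof.
rewrite !cmp_classE mulr_sumr big1 // => j _; rewrite mulrCA.
rewrite [X in _ * X](_ : _ = 0) ?mulr0 // -mulrA mulr_suml big1 // => i _.
rewrite mulr_suml mulr_sumr big1 // => i' _.
have := coh_deg3 H i i' j; set x := X i; set y := X i'; set z := X j => e.
transitivity (kap (cmp_coef a i) * kap (cmp_coef b i') * (x * y * z)); first by ring.
by rewrite e mulr0.
Qed.

Definition cmp_lift : mpoly (nedges Q) rat -> mpoly (nedges P) rat :=
  mmap (@mpolyC (nedges P) rat) cmp_poly.
HB.instance Definition _ := GRing.RMorphism.on cmp_lift.

Lemma cmp_lift_var a : cmp_lift (mvar a) = cmp_poly a.
Proof. by rewrite /cmp_lift /mvar mmapX mmap1U. Qed.

Lemma cmp_liftC c : cmp_lift (mpolyC _ c) = mpolyC _ c.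
Proof. by rewrite /cmp_lift mmapC. Qed.

Definition cmp : {rmorphism mpoly (nedges Q) rat -> cohomology P} :=
  locked (coh_pi P \o cmp_lift : {rmorphism _ -> _}).

Lemma cmpE p : cmp p = coh_pi P (cmp_lift p).
Proof. by rewrite /cmp; unlock. Qed.

Lemma cmp_var a : cmp (mvar a) = Y a.
Proof. by rewrite cmpE cmp_lift_var. Qed.

Lemma cmpC c : cmp (mpolyC _ c) = kap c.
Proof. by rewrite cmpE cmp_liftC -coh_constE. Qed.

Lemma cmp_ideal p : p \in @coh_ideal R Q -> cmp p = 0.
Proof.
move=> /asboolP[t tG ->]; rewrite rmorph_sum big1_seq // => c /andP[_ /tG cG].
rewrite rmorphM; suff -> : cmp c.2 = 0 by rewrite mulr0.
case: cG => [[S S0 ->]|[v ->]]; last first.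
  rewrite -[RHS](cmp_class_lin (map_mx intr v)) rmorph_sum; apply: eq_bigr => a _.
  by rewrite rmorphM cmpC [cmp (edge_var a)]cmp_var pairing_map.
have [a [b [ab aS bS]]] := sr_pair HQ S0.
rewrite rmorph_prod (eq_bigr Y) => [|c' _]; last exact: cmp_var.
rewrite (bigD1 a) //= (bigD1 b) /=; last by rewrite bS eq_sym.
rewrite mulrA; have [[d /and3P[dS da db]]|nd] :=
    pselect (exists d, [&& d \in S, d != a & d != b]).
  by rewrite (bigD1 d) /= ?dS ?da // mulrA cmp_deg3 mul0r.
rewrite cmp_disjoint ?mul0r //; apply/negP => /asboolP[x [xa xb]].
suff : set0 x by []; rewrite -S0 => d /= dS.
have [->//|da] := eqVneq d a; have [->//|db] := eqVneq d b.
by exfalso; apply: nd; exists d; rewrite dS da.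
Qed.

Notation ptP := (coh_pt H).
Notation ptQ := (coh_pt HQ).
Notation isP := (@isect R P).
Notation XQ := (@coh_edge R Q).
Notation kaQ := (coh_const Q).

Definition coh_cmp (y : cohomology Q) : cohomology P := cmp (projT1 (cid (coh_pi_surj y))).

Lemma coh_cmp_pi p : coh_cmp (coh_pi Q p) = cmp p.
Proof.
rewrite /coh_cmp; case: (cid _) => q /= e; apply/eqP; rewrite -subr_eq0 -rmorphB.
by apply/eqP/cmp_ideal/coh_pi_eq0; rewrite rmorphB e subrr.
Qed.

Lemma coh_cmp_zmod_morphism : zmod_morphism coh_cmp.
Proof.
move=> y z; have [p ->] := coh_pi_surj y; have [q ->] := coh_pi_surj z.
by rewrite -rmorphB !coh_cmp_pi rmorphB.
Qed.

Lemma coh_cmp_monoid_morphism : monoid_morphism coh_cmp.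
Proof.
split=> [|y z]; first by rewrite -(rmorph1 (coh_pi Q)) coh_cmp_pi rmorph1.
have [p ->] := coh_pi_surj y; have [q ->] := coh_pi_surj z.
by rewrite -rmorphM !coh_cmp_pi rmorphM.
Qed.

HB.instance Definition _ :=
  GRing.isZmodMorphism.Build _ _ coh_cmp coh_cmp_zmod_morphism.
HB.instance Definition _ :=
  GRing.isMonoidMorphism.Build _ _ coh_cmp coh_cmp_monoid_morphism.

Lemma coh_cmp_edge a : coh_cmp (XQ a) = Y a.
Proof. by rewrite coh_cmp_pi cmp_var. Qed.

Lemma coh_cmp_const c : coh_cmp (kaQ c) = kap c.
Proof. by rewrite coh_constE coh_cmp_pi cmpC. Qed.

Lemma coh_cmp_act w (Ww : w \in W) y : cact Ww (coh_cmp y) = coh_cmp y.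
Proof.
have [c [b [d ->]]] := coh_formP HQ y; rewrite !rmorphD !rmorphM !rmorph_sum /=.
rewrite !coh_cmp_const !coh_act_const !coh_cmp_edge !cact_class.
congr (_ + _ + _); apply: eq_bigr => a _.
by rewrite !rmorphM /= coh_cmp_const coh_cmp_edge coh_act_const cact_class.
Qed.

Let cC := @isectC R P.
Notation qd := (quad isP).

Lemma quad_coh p q : coh_pi P p = coh_pi P q -> qd p = qd q.
Proof.
move=> e; apply/eqP; rewrite -subr_eq0 -raddfB; apply/eqP.
have /coh_pi_eq0/(coh_ideal_taylor H)[//] : coh_pi P (p - q) = 0.
by rewrite rmorphB e subrr.
Qed.

Lemma diff0_cmp_poly a j : diff0 j (cmp_poly a) = cmp_coef a j.
Proof.
rewrite raddf_sum (bigD1 j) //= big1 ?addr0 => [|i ij].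
  by rewrite diff0M diff0C mul0r add0r ev0C diff0_var eqxx mulr1.
by rewrite diff0M diff0C mul0r add0r diff0_var eq_sym (negbTE ij) mulr0.
Qed.

Lemma ev0_cmp_poly a : ev0 (cmp_poly a) = 0.
Proof. by rewrite rmorph_sum big1 // => j _; rewrite rmorphM /= ev0_var mulr0. Qed.

Lemma quad_cmp_poly a b : qd (cmp_poly a * cmp_poly b) =
  2 * \sum_i \sum_j isP i j * cmp_coef a i * cmp_coef b j.
Proof.
rewrite quadM // !ev0_cmp_poly mulr0 mul0r !add0r; congr (_ * _).
by apply: eq_bigr => i _; apply: eq_bigr => j _; rewrite !diff0_cmp_poly.
Qed.

(** An ample invariant class on P is a combination of orbit sums, so that some
    product of classes coming from Q is nonzero in top degree. *)
Lemma cmp_top_neq0 : exists2 r, r != 0 & coh_cmp ptQ = kap r * ptP.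
Proof.
have [r er] : exists r, coh_cmp ptQ = kap r * ptP.
  rewrite /coh_pt rmorphM /= !coh_cmp_edge !cmp_classE big_distrlr /=.
  elim/big_ind: _ => [|_ _ [r ->] [r' ->]|i _].
  - by exists 0; rewrite rmorph0 mul0r.
  - by exists (r + r'); rewrite rmorphD mulrDl.
  elim/big_ind: _ => [|_ _ [r ->] [r' ->]|j _].
  - by exists 0; rewrite rmorph0 mul0r.
  - by exists (r + r'); rewrite rmorphD mulrDl.
  have [r e] := coh_mul H i j.
  exists (cmp_coef (edge0 HQ) i * cmp_coef (succ HQ (edge0 HQ)) j * r).
  by rewrite mulrACA e mulrA !rmorphM.
exists r => //; apply/eqP => r0; rewrite r0 rmorph0 mul0r in er.
have q0 a b : qd (cmp_poly a * cmp_poly b) = 0.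
  rewrite -(@raddf0 _ _ qd); apply: quad_coh.
  rewrite rmorph0 rmorphM -/(Y a) -/(Y b) -!coh_cmp_edge -rmorphM /=.
  by have [c ->] := coh_mul HQ a b; rewrite rmorphM /= er mulr0.
have hn i : 0 < h (nP i) by apply: h_gt0; apply: mem_normal.
have := ample_square_gt0 H hn; rewrite ltNge => /negP; apply.
pose hd a : R := if dominant (nQ a) then h (nQ a) else 0.
have hE j : h (nP j) = \sum_a hd a * ratr (cmp_coef a j).
  rewrite (bigD1 (dom j)) //= big1 ?addr0 => [|a aj].
    rewrite /hd dom_dominant cmp_coef_dominant ?dom_dominant // eqxx rmorph1 mulr1.
    by have [w Ww ->] := dom_orbit j; rewrite (h_dact H WP) // mem_normal.
  rewrite /hd; case: ifP => ad; last by rewrite mul0r.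
  by rewrite cmp_coef_dominant // eq_sym (negbTE aj) rmorph0 mulr0.
suff -> : \sum_i \sum_j h (nP i) * h (nP j) * (ratr (isP i j) : R) =
    \sum_a \sum_b hd a * hd b * ratr (2^-1 * qd (cmp_poly a * cmp_poly b)).
  by rewrite big1 // => a _; rewrite big1 // => b _; rewrite q0 mulr0 rmorph0 mulr0.
transitivity (\sum_i \sum_j \sum_a \sum_b
    hd a * hd b * ratr (isP i j * cmp_coef a i * cmp_coef b j)).
  apply: eq_bigr => i _; apply: eq_bigr => j _.
  rewrite !hE big_distrlr /= mulr_suml; apply: eq_bigr => a _.
  rewrite mulr_suml; apply: eq_bigr => b _; rewrite !rmorphM /=; ring.
under eq_bigr do rewrite exchange_big /=. 
rewrite exchange_big /=; apply: eq_bigr => a _.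
under eq_bigr do rewrite exchange_big /=. 
rewrite exchange_big /=; apply: eq_bigr => b _.
rewrite quad_cmp_poly mulKf // rmorph_sum mulr_sumr.
by apply: eq_bigr => i _; rewrite rmorph_sum mulr_sumr.
Qed.

Lemma qd_top : qd (mvar (edge0 H) * mvar (succ H (edge0 H))) != 0.
Proof.
rewrite quad_var2 // mulf_neq0 // /isect (negbTE (succ_neq H _)) /off_coef.
by rewrite succ_touch invr_eq0 intr_eq0 normr_eq0 gt_eqF // succ_det.
Qed.

Lemma normals_span (x : 'rV[R]_2) : (forall j, pairing x (nP j) = 0) -> x = 0.
Proof.
move=> x0; have e l : pairing x l = 0.
  have := pairing_cramer x (nP (edge0 H)) (nP (succ H (edge0 H))) l.
  rewrite !x0 !mulr0 addr0 => /eqP.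
  by rewrite mulf_eq0 intr_eq0 gt_eqF ?succ_det //= => /eqP.
by apply: row2P; rewrite mxE; have := e (delta_mx 0 _);
  [move/(_ 0) | move/(_ 1)]; rewrite pairing2 !mxE /=; lra.
Qed.

(** The normals span, so that v is fixed by the wall reflection. *)
Lemma pairing_orbit_wall (v : 'rV[rat]_2) k :
  (forall j, pairing v (nP (eperm (s k) j)) = pairing v (nP j)) ->
  pairing v (eta k) = 0.
Proof.
move=> hv; have Ws := wall_in C k.
pose x : 'rV[R]_2 := map_mx ratr v.
have xk : act (s k) x = x.
  apply/eqP; rewrite -subr_eq0; apply/eqP; apply: normals_span => j.
  apply/eqP; rewrite pairingBl subr_eq0 -[s k](wallV hrW C) -pairing_dact //.
  by rewrite -normal_eperm // !pairing_map hv.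
have /(wall_line C k) := xk; rewrite pairing_map => /eqP.
by rewrite fmorph_eq0 => /eqP.
Qed.

(** The Taylor coefficients of order 0, 1 and 2 separate the degrees. In order 1,
    a vector whose pairings with the normals are constant on orbits lies on all
    walls, and its relation already holds on Q; the dual vectors account for the
    coefficients of the walls. *)
Lemma coh_cmp_inj : injective coh_cmp.
Proof.
apply: raddf_inj => y /=; have [c [b [d ->]]] := coh_formP HQ y.
have [r r0] := cmp_top_neq0; move: (coh_pt HQ) => pt ptE.
rewrite !rmorphD !rmorphM rmorph_sum /= !coh_cmp_const ptE => y0.
pose lin : mpoly (nedges P) rat := \sum_a mpolyC _ (b a) * cmp_poly a.
pose top := mvar (edge0 H) * mvar (succ H (edge0 H)).
have pI : coh_pi P (mpolyC _ c + lin + mpolyC _ (d * r) * top) = 0.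
  rewrite -[RHS]y0 !rmorphD !rmorphM /= -!coh_constE; congr (_ + _ + _).
    rewrite rmorph_sum; apply: eq_bigr => a _.
    by rewrite !rmorphM /= coh_cmp_const coh_cmp_edge coh_constE.
  by rewrite -mulrA.
have [] := coh_ideal_taylor H ((coh_pi_eq0 _).1 pI).
have lin0 : ev0 lin = 0.
  by rewrite rmorph_sum big1 // => a _; rewrite rmorphM /= ev0_cmp_poly mulr0.
have lin1 j : diff0 j lin = \sum_a b a * cmp_coef a j.
  rewrite raddf_sum; apply: eq_bigr => a _ /=.
  by rewrite diff0M diff0C mul0r add0r ev0C diff0_cmp_poly.
have lin2 : qd lin = 0.
  rewrite raddf_sum big1 // => a _ /=; rewrite quadM // quadC mul0r add0r.
  rewrite [\sum_i _]big1 ?mulr0 ?addr0 => [|i _]; last first.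
    by rewrite big1 // => j _; rewrite diff0C mulr0 mul0r.
  rewrite /cmp_poly raddf_sum [\sum_i _]big1 ?mulr0 // => j _ /=.
  rewrite quadM // quadC mul0r add0r quad_var mulr0 add0r big1 ?mulr0 // => i _.
  by rewrite big1 // => i' _; rewrite diff0C mulr0 mul0r.
have top0 : ev0 top = 0 by rewrite rmorphM /= ev0_var mul0r.
have top1 j : diff0 j top = 0.
  by rewrite diff0M !ev0_var mulr0 mul0r addr0.
rewrite !rmorphD rmorphM /= lin0 top0 ev0C mulr0 !addr0 => -> {c y0 pI}.
move=> [v hv]; rewrite !raddfD /= lin2 quadC quadM // quadC top0 mulr0 !add0r ev0C.
rewrite [\sum_i _]big1 ?mulr0 ?addr0 => [|i _]; last first.
  by rewrite big1 // => j _; rewrite diff0C mulr0 mul0r.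
move/eqP; rewrite mulf_eq0 (negbTE qd_top) orbF mulf_eq0 (negbTE r0) orbF => /eqP ->.
rewrite !rmorph0 mul0r addr0 add0r.
have {}hv j : \sum_a b a * cmp_coef a j = pairing v (nP j).
  have := hv j; rewrite !raddfD /= diff0C add0r lin1 diff0M diff0C mul0r add0r.
  by rewrite top1 mulr0 addr0.
have vk k : pairing v (eta k) = 0.
  apply: pairing_orbit_wall => j; rewrite -!hv; apply: eq_bigr => a _.
  by rewrite cmp_coef_eperm // (wall_in C).
pose bw k := b (projT1 (cid (wall_index k))).
have bwE a k : nQ a = eta k -> b a = bw k.
  rewrite /bw; case: (cid _) => a' /= <- e; congr b; exact: normal_inj.
pose v' := v + \sum_k bw k *: u k.
rewrite -[RHS](coh_lin Q v'); apply: eq_bigr => a _; congr (kaQ _ * _).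
have [[_ ad]|[k ak]] := nQP a; last first.
  rewrite (bwE _ _ ak) ak pairingDl vk add0r pairing_suml (bigD1 k) //=.
  rewrite pairingZl (wall_dual C) eqxx mulr1 big1 ?addr0 // => k' k'k.
  by rewrite pairingZl (wall_dual C) (negbTE k'k) mulr0.
have [i ia] := dominant_edge ad; have id : dominant (nP i) by rewrite ia.
have da := dom_self id ia; have := hv i.
rewrite (sum_cmp_coef _ bwE) da ia pairingDl pairing_suml => /eqP.
rewrite subr_eq => /eqP ->; congr (_ + _).
by apply: eq_bigr => k _; rewrite pairingZl.
Qed.

(** In degree 4 the image is everything by cmp_top_neq0. In degree 2 the averaged
    coefficients are constant on orbits, and are those of dominant edges. *)
Lemma coh_cmp_surj (z : cohomology P) :
  (forall w (Ww : w \in W), cact Ww z = z) -> exists y, coh_cmp y = z.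
Proof.
have [r r0 ptE] := cmp_top_neq0; have [c [b [d zE]]] := coh_formP H z.
move=> zW; have ptW w (Ww : w \in W) : cact Ww ptP = ptP.
  have -> : ptP = coh_cmp (kaQ r^-1 * ptQ).
    rewrite rmorphM /= ptE coh_cmp_const mulrA -rmorphM mulVf // rmorph1 mul1r //.
  exact: coh_cmp_act.
move: (coh_pt HQ) (coh_pt H) ptE ptW zE => qt pt ptE ptW zE.
(* Averaging makes the linear coefficients invariant. *)
pose bW j := (#|W|%:R)^-1 * \sum_(w in W) b (eperm w j).
have W0 : (#|W|%:R : rat) != 0 by rewrite pnatr_eq0 -lt0n cardG_gt0.
have bWW v j : v \in W -> bW (eperm v j) = bW j.
  move=> Wv; rewrite /bW; congr (_ * _); rewrite [RHS](reindex_inj (mulgI v)) /=.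
  apply: eq_big => [w|w Ww]; first by rewrite (groupMl _ Wv).
  by rewrite epermM.
have zav : z = kap c + \sum_j kap (bW j) * X j + kap d * pt.
  have zw w : w \in W -> z = kap c + \sum_j kap (b (eperm w j)) * X j + kap d * pt.
    move=> Ww; have WV : w^-1%g \in W by rewrite groupV.
    rewrite -[LHS](zW _ WV) zE !rmorphD !rmorphM rmorph_sum /= !coh_act_const ptW.
    congr (_ + _ + _); rewrite (reindex_inj (eperm_inj WP Ww)) /=.
    apply: eq_bigr => j _; rewrite rmorphM /= coh_act_const cact_edge.
    by rewrite (epermKV WP).
  have kW0 : kap (#|W|%:R)^-1 * kap #|W|%:R = 1 by rewrite -rmorphM mulVf // rmorph1.
  have sumz : kap #|W|%:R * z = kap #|W|%:R * kap c
      + \sum_(w in W) \sum_j kap (b (eperm w j)) * X j + kap #|W|%:R * (kap d * pt).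
    transitivity (\sum_(w in W) z); first by rewrite sumr_const rmorph_nat mulr_natl.
    rewrite (eq_bigr _ zw) !big_split /= !sumr_const rmorph_nat !mulr_natl //.
  rewrite -[LHS]mul1r -kW0 -mulrA sumz !mulrDr !mulrA kW0 !mul1r; congr (_ + _ + _).
  rewrite exchange_big mulr_sumr; apply: eq_bigr => j _ /=.
  by rewrite -mulr_suml -rmorph_sum mulrA -rmorphM.
pose bQ a := if [pick j | dom j == a] is Some j then bW j else 0.
have bQE j : bQ (dom j) = bW j.
  rewrite /bQ; case: pickP => [i /eqP e|/(_ j)]; last by rewrite eqxx.
  have [i1 [w1 [Ww1 id1 ia1 ->]]] := dom_eq e.
  have [i2 [w2 [Ww2 id2 ia2 ->]]] := dom_eq (erefl (dom j)).
  have -> : i1 = i2 by apply: normal_inj; rewrite ia1.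
  by rewrite !bWW.
have bQ0 a k : nQ a = eta k -> bQ a = 0.
  move=> ak; rewrite /bQ; case: pickP => // j /eqP e.
  by have := dom_dominant j; rewrite e ak (negbTE (wall_not_dominant C k)).
exists (kaQ c + \sum_a kaQ (bQ a) * XQ a + kaQ (d / r) * qt).
rewrite zav !rmorphD !rmorphM rmorph_sum /= !coh_cmp_const ptE; congr (_ + _ + _).
  transitivity (\sum_a \sum_j kap (bQ a * cmp_coef a j) * X j).
    apply: eq_bigr => a _; rewrite rmorphM /= coh_cmp_const coh_cmp_edge cmp_classE.
    by rewrite mulr_sumr; apply: eq_bigr => j _; rewrite mulrA -rmorphM.
  rewrite exchange_big; apply: eq_bigr => j _ /=; rewrite -mulr_suml -rmorph_sum.
  congr (kap _ * _); rewrite (@sum_cmp_coef _ (fun=> 0)) //.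
  by rewrite big1 ?subr0 // => k _; rewrite mul0r.
by rewrite mulrA -!rmorphM divfK.
Qed.

End Comparison.

(** * The isomorphism onto the invariants *)

Lemma inj_surj_bij (T U : Type) (f : T -> U) :
  injective f -> (forall y, exists x, f x = y) -> bijective f.
Proof.
move=> fi fs; exists (fun y => projT1 (cid (fs y))) => [x|y].
  by apply: fi; case: (cid _).
by case: (cid _).
Qed.

Section Final.
Variables (R : realType) (gT : finGroupType) (W : {group gT}).
Variable rW : mx_representation int W 2.
Hypothesis hrW : mx_faithful rW.
Variables (K : finType) (s : K -> gT) (eta : K -> 'rV[int]_2) (u : K -> 'rV[rat]_2).
Hypothesis C : strict_chamber R rW s eta u.
Variables (P : set 'rV[R]_2) (h : 'rV[int]_2 -> R).
Hypothesis H : polygonal (normals P) h P.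
Hypothesis h_gt0 : forall l, l \in normals P -> 0 < h l.
Hypothesis WP : preserves rW P.
Variable Q : set 'rV[R]_2.
Hypothesis QE : forall x, Q x <-> P x /\ chamber eta x.

Notation F := (coh_cmp hrW C H h_gt0 WP QE).

Lemma coh_cmp_invariant y : F y \in invariant_pred WP.
Proof.
by apply/asboolP => w Ww; apply: (coh_cmp_act hrW C H h_gt0 WP QE Ww).
Qed.

Definition cmp_invariants y : invariants WP := Invariants (coh_cmp_invariant y).

Lemma cmp_invariants_zmod : zmod_morphism cmp_invariants.
Proof. by move=> y z; apply: val_inj; rewrite /= raddfB. Qed.

Lemma cmp_invariants_monoid : monoid_morphism cmp_invariants.
Proof.
by split=> [|y z]; apply: val_inj; rewrite /= ?rmorph1 ?rmorphM.
Qed.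

HB.instance Definition _ := GRing.isZmodMorphism.Build (cohomology Q) (invariants WP)
  cmp_invariants cmp_invariants_zmod.
HB.instance Definition _ := GRing.isMonoidMorphism.Build (cohomology Q) (invariants WP)
  cmp_invariants cmp_invariants_monoid.

Lemma cmp_invariants_bij : bijective cmp_invariants.
Proof.
apply: inj_surj_bij => [y z /(congr1 val) /= e|z].
  exact: (coh_cmp_inj e).
have [|y ye] := @coh_cmp_surj _ _ _ _ hrW _ _ _ _ C _ _ H h_gt0 WP _ QE (val z).
  by move=> w Ww; have /asboolP := valP z; apply.
by exists y; apply: val_inj.
Qed.

Lemma fundamental_iso :
  exists f : {rmorphism cohomology Q -> invariants WP}, bijective f.
Proof. by exists cmp_invariants; apply: cmp_invariants_bij. Qed.

End Final.

Theorem theorem1p1 (R : realType) (m : nat) (lam : 'I_m -> 'rV[int]_2)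
    (a : 'I_m -> R) (hP : polygon_presentation lam a)
    (gT : finGroupType) (W : {group gT}) (rW : mx_representation int W 2)
    (hrW : mx_faithful rW) (hWP : preserves rW (polytope lam a))
    (Q : set 'rV[R]_2) (hQ : fundamental_region rW (polytope lam a) Q) :
  exists f : {rmorphism cohomology Q -> invariants hWP}, bijective f.
Proof.
have H := pg_self (presentation_polygonal hP); have h0 := presentation_height_gt0 hP.
case: hQ => [[t [eta [WE rt pe fl ->]]]|[n [s1 [s2 [eta1 [eta2 [[n3 WE _ cW] [r1 r2] [p1 p2 f1 f2] CW ->]]]]]]].
  apply: (fundamental_iso hrW (order2_strict_chamber hrW WE rt pe fl) H h0) => x.
  by split=> -[Px xC]; split=> //; apply: (xC tt).
apply: (fundamental_iso hrW (dihedral_strict_chamber hrW n3 WE cW r1 r2 p1 p2 f1 f2 CW) H h0) => x.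
split=> [[[Px x1] [_ x2]]|[Px xC]]; first by split=> // -[].
by split; split=> //; [apply: (xC true) | apply: (xC false)].
Qed.
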